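(* Let $K(t)=\tan t+\sec t$, and for $l=2,3,4$ let $K_l(t)=\sum_{n=0}^{\infty}K_n^l\frac{t^n}{n!}$ be the exponential generating function of the numbers $K_n^l$ (with $l$ fixed), where $K_n^l$ is the number of connected components of the set of very nice M-morsifications of $B_n^l$. Then $$K_2(t)=K'''(t)-(tK(t))''=\frac{3\sin t-t\cos t}{(1-\sin t)^2},$$ $$K_3(t)=\bigl(K''(t)-3tK'(t)+K(t)\bigr)'''=\frac{3}{(1-\sin t)^3}\Bigl(\sin t\,(3\sin t+7)-t\cos t\,(5+\sin t)\Bigr),$$ $$K_4(t)=\bigl(K'''(t)-6tK''(t)+(3t^2+4)K'(t)-3tK(t)\bigr)^{(4)}=\left(\frac{3t^2}{1-\sin t}-\frac{3t\cos t}{(1-\sin t)^2}(3-\sin t)+\frac{3(2-\sin t)}{(1-\sin t)^2}\right)^{(4)},$$ where primes and $(4)$ denote derivatives in $t$.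
   Context: For an integer $n\ge 1$ let $P_n$ be the space of real polynomials of the form $x^n+\lambda_2x^{n-2}+\cdots+\lambda_{n-1}x$, with the topology of the coefficients $\lambda_i\in\mathbb R$ (so $P_1=\{x\}$, $P_2=\{x^2\}$). For $l\ge 0$ consider pairs $(f;b_1,\dots,b_l)\in P_n\times\mathbb R^l$; the $b_i$ are the (labelled) boundary points and the numbers $f(b_i)$ are the boundary values. Such a pair is a very nice M-morsification of $B_n^l$ if all $n-1$ critical points of $f$ (counted with multiplicity) are real and the $n-1$ critical values together with the $l$ boundary values are all pairwise distinct. $K_n^l$ is the number of connected components of the set of very nice M-morsifications of $B_n^l$, as a subspace of $P_n\times\mathbb R^l$. For $n=0$, $K_0^l$ (for $l\ge1$) is the number of connected components of the space of degree $0$ polynomials (the zero polynomial) with $l$ labelled real boundary points having pairwise distinct boundary values; thus $K_0^1=1$ and $K_0^l=0$ for $l\ge 2$. With $K_m$ the Bernoulli-Euler numbers, $\sec t+\tan t=\sum_{m\ge0}K_mt^m/m!$, it is known (Arnold) that $K_n^0=K_{n-1}$ for $n\ge1$ and $K_n^1=K_{n+1}$ for $n\ge0$. Identities are between power series at $t=0$ (equivalently analytic functions near $0$). *)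

(* Defs.v *)
From HB Require Import structures.
From mathcomp Require Import all_boot all_order all_algebra finmap.
From mathcomp Require Import all_classical all_reals all_analysis.

Set Implicit Arguments.
Unset Strict Implicit.
Unset Printing Implicit Defensive.

Import Order.TTheory GRing.Theory Num.Theory.
Import numFieldNormedType.Exports.

Local Open Scope classical_set_scope.
Local Open Scope ring_scope.

(* For n >= 1, the element of P_n with coefficients lam: the entry [lam 0 i]
   is lambda_(i+2).  The truncated predecessor [n.-2] is the number of free
   coefficients also for n = 0, 1, 2 (namely 0).  For n = 0 the only
   polynomial considered is 0. *)
Definition Ppoly (R : realType) (n : nat) (lam : 'rV[R]_(n.-2)) : {poly R} :=
  if n == 0%N then 0
  else 'X^n + \sum_(i < n.-2) lam ord0 i *: 'X^(n - i.+2).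

(* The tuple [c] lists the critical points with multiplicity: all of them are
   real iff f' is n times a product of n - 1 monic linear factors over R.  For
   n = 0 the equation reads 0 = 0 and only the boundary values matter. *)
Definition very_nice (R : realType) (n l : nat) :
    set ('rV[R]_(n.-2) * 'rV[R]_l) :=
  [set p : 'rV[R]_(n.-2) * 'rV[R]_l |
    let f := Ppoly p.1 in
    exists c : (n.-1).-tuple R,
      deriv f = n%:R *: \prod_(x <- c) ('X - x%:P) /\
      uniq ([seq f.[x] | x <- c] ++ [seq f.[p.2 ord0 i] | i : 'I_l])].

Definition components (T : topologicalType) (A : set T) : set (set T) :=
  connected_component A @` A.

(* K_n^l.  Since [fset_set] is a junk value on infinite sets, this is
   meaningful only together with the finiteness of the set of components. *)
Definition Knl (R : realType) (n l : nat) : nat :=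
  #|` fset_set (components (@very_nice R n l)) |.

(* The exponential generating series of [u] converges to [F] near 0. *)
Definition has_egf (R : realType) (u : nat -> nat) (F : R -> R) : Prop :=
  \forall t \near (0 : R),
    pseries (fun n => (u n)%:R / (n`!)%:R : R) t @ \oo --> F t.

Definition Kfun (R : realType) (t : R) : R := tan t + (cos t)^-1.

(* Main.v *)
(* Write n = m + 1.  In increasing order the m critical points and the l boundary
   points of a very nice M-morsification form N = m + l slots.  Its type records
   the ranking of the N values, a permutation of {0, ..., N - 1}, and the slots
   occupied by the labelled boundary points; the turning points of the
   permutation must be the critical slots.  The values at the slots, up to a
   common constant, can be prescribed arbitrarily subject to the signs of their
   consecutive differences, and then determine the centered slots uniquely and
   continuously.  Hence the morsifications of a given type are connected, the
   types are the components, and K_n^l = l! b(N, n), where b(N, n) counts the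
   permutations of N letters with n - 1 turning points, the graph being continued
   at its ends like that of x^n.

   Existence and uniqueness hold by connectedness of the cone of admissible
   values.  The slots are bounded in terms of the values and cannot collide, the
   map from slots to values is open, and two interlaced solutions are equal since
   the difference of the polynomials has too many zeros.  The base point for
   uniqueness is a target with critical values 1 and -1, where f^2 - 1 is
   divisible by f'^2, whence the differential equation of Chebyshev.

   Inserting the largest letter gives b(N+1, n) = n b(N, n)
   + (N + 3 - n) b(N, n - 2), which is also the recurrence of the coefficients of
   sec^n tan^(N+1-n) in the N-th derivative of sec + tan.  So b(N, N + 1) is the
   N-th Bernoulli-Euler number E_N, and the numbers K_n^2, K_n^3, K_n^4 are
   combinations of the E_(n+k) with coefficients polynomial in n. *)

Require Import Defs.
From HB Require Import structures.
From mathcomp Require Import all_boot all_order all_algebra all_fingroup finmap.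
From mathcomp Require Import polyorder polyrcf cauchyreals.
From mathcomp Require Import ring lra zify.
From mathcomp Require Import all_classical all_reals all_analysis.

Set Implicit Arguments.
Unset Strict Implicit.
Unset Printing Implicit Defensive.

Import Order.TTheory GRing.Theory Num.Theory.

(** Two arbitrary solutions of the same value problem need not be interlaced, so counting zeros
    excludes only a second solution that is interlaced with the first. Uniqueness is therefore
    propagated. The solutions for all targets near a given one stay in a fixed compact set; if the
    given target has a single solution, those of nearby targets cluster around it, are interlaced
    and coincide. This needs one target where uniqueness is known globally by other means, and there
    the differential equation leaves only a scale free. Openness comes from a minimization: the
    distance to the wanted values is minimized over a small ball, and a first-order perturbation
    lowers any positive minimum. Only differences of values are prescribed, as the members of P_n
    have constant term 0, and the centering expresses their missing coefficient of x^(n-1). Without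
    critical points the centering is empty and the polynomial is x, a case treated by hand. *)

(** * Permutations by number of turning points *)

(* Coefficient of x^n y^(N+1-n) in D^N (x + y) for the derivation
   D x = x y, D y = x^2 (satisfied by x = sec, y = tan). *)
Fixpoint bcoef (N n : nat) : nat :=
  if N is N'.+1 then
    n * bcoef N' n + (if n is n'.+2 then (N' + 3 - n) * bcoef N' n' else 0)
  else n < 2.

Fixpoint inserts (M : nat) (s : seq nat) : seq (seq nat) :=
  (M :: s) :: (if s is x :: s' then [seq x :: u | u <- inserts M s'] else [::]).

Fixpoint perms (N : nat) : seq (seq nat) :=
  if N is N'.+1 then flatten [seq inserts N' s | s <- perms N'] else [:: [::]].

(* Number of turning points of the word [x :: s] preceded by a step in
   direction [up] and followed by a step upwards. *)
Fixpoint turns_from (up : bool) (x : nat) (s : seq nat) : nat :=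
  if s is y :: s' then (up != (x < y)) + turns_from (x < y) y s' else ~~ up.

Definition turns (e : bool) (s : seq nat) : nat :=
  if s is x :: s' then turns_from e x s' else 0.

Definition rises (x : nat) (s : seq nat) := if s is y :: _ then x < y else true.

(** The incoming direction only decides whether [x] itself is a turning point. *)
Lemma turns_from_rises up x s :
  turns_from up x s + (if up then rises x s else ~~ rises x s) =
  turns_from (~~ up) x s + (if up then ~~ rises x s else rises x s).
Proof.
case: s => [|y s] /=; first by case: up.
by case: up; case: (x < y) => /=; lia.
Qed.

(** The letter [x] stays in front, so compared with [sum_inserts] the insertion before [x] is
    missing. That insertion would preserve the number of turning points unless [up && rises x s],
    whence the correction term. *)
Lemma sum_inserts_from (g : nat -> nat) M s up x : all (fun y => y < M) (x :: s) ->
  exists a, (size s).+1 = a + (turns_from up x s + (up && rises x s)) /\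
  \sum_(u <- inserts M s) g (turns_from up x u) =
    a * g (turns_from up x s).+2
    + (turns_from up x s + (up && rises x s)) * g (turns_from up x s).
Proof.
elim: s up x g => [|y s ih] up x g /= /andP[xM hs].
  by exists 0; rewrite big_seq1 /= xM; case: up => /=; rewrite ?add0n ?addn0; lia.
have yM : y < M by case/andP: hs.
have [a [e1 e2]] := ih (x < y) y (fun v => g ((up != (x < y)) + v)) hs.
rewrite big_cons big_map /= xM e2 {e2}.
have -> : (M < y) = false by lia.
have := turns_from_rises (x < y) y s.
move: e1; set k := turns_from (x < y) y s; set r := rises y s.
case xy : (x < y) => /=.
  move: (turns_from false y s) => tf e1 e3; case: up; case: r e1 e3 => /= e1 e3.
  - exists a.+1; split; first lia.
    by have -> : tf = k.+1; [lia|rewrite !add0n add1n; lia].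
  - exists a; split; first lia.
    by have -> : k = tf.+1; [lia|rewrite !add0n add1n; lia].
  - exists a.+1; split; first lia.
    by have -> : tf = k.+1; [lia|rewrite !add1n; lia].
  - exists a; split; first lia.
    by have -> : k = tf.+1; [lia|rewrite !add1n; lia].
have <- : k = turns_from false y s by rewrite /k xy.
move=> e1 _.
case: up => /=.
  by exists a; split; [lia|rewrite !add1n !add0n; lia].
by exists a.+1; split; [lia|rewrite !add1n !add0n; lia].
Qed.

Lemma sum_inserts (g : nat -> nat) M s e : all (fun y => y < M) s ->
  (s != [::]) || e ->
  exists a, size s = a + turns e s /\
  \sum_(u <- inserts M s) g (turns e u) =
    a * g (turns e s).+2 + (turns e s).+1 * g (turns e s).
Proof.
case: s => [_ /= ->|x s hs _].
  by exists 0; rewrite /= big_seq1 mul1n.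
have [a [e1 e2]] := sum_inserts_from g e hs.
rewrite /= big_cons big_map /= e2.
have xM : x < M by case/andP: hs.
have -> /= : (M < x) = false by lia.
have := turns_from_rises e x s; move: e1.
case: e e2 => /= e2; case: (rises x s) => /= e1 e3.
- exists a.+1; split; first lia.
  by rewrite (_ : 1 + turns_from false x s = (turns_from true x s).+2); lia.
- exists a; split; first lia.
  by rewrite (_ : 1 + turns_from false x s = turns_from true x s); lia.
- by exists a; split; [lia|rewrite ?add0n; lia].
- by exists a; split; [lia|rewrite ?add0n; lia].
Qed.

Lemma mem_inserts M s u : M \notin s -> (u \in inserts M s) =
  (M \in u) && (rem M u == s).
Proof.
elim: s u => [|x s ih] u /=.
  move=> _; rewrite inE; case: u => [|y u] //=; rewrite inE eqseq_cons.
  by case: (eqVneq y M) => [e|ny] /=; rewrite ?andbF.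
rewrite inE negb_or => /andP[Mx Ms]; rewrite inE.
case: u => [|y u] /=; first by apply/mapP => -[].
rewrite eqseq_cons inE; case: (eqVneq y M) => [->|yM] /=.
  case: (eqVneq u (x :: s)) => //= _.
  by apply/mapP => -[v _ [e _]]; rewrite e eqxx in Mx.
rewrite eqseq_cons; apply/mapP/and3P.
  by move=> [v + [-> ->]]; rewrite ih // => /andP[? ?]; split.
by move=> [h1 /eqP -> h3]; exists u; rewrite ?ih ?h1.
Qed.

Lemma uniq_inserts M s : M \notin s -> uniq (inserts M s).
Proof.
elim: s => [//|x s ih]; rewrite inE negb_or => /andP[Mx Ms] /=.
rewrite map_inj_uniq ?ih ?andbT //; last by move=> u v [].
by apply/mapP => -[v _ [e _]]; rewrite e eqxx in Mx.
Qed.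

Lemma mem_perms N s : (s \in perms N) = perm_eq s (iota 0 N).
Proof.
elim: N s => [|N ih] s; last rewrite [perms _]/=.
  rewrite inE; apply/eqP/idP => [->//|/perm_size/size0nil //].
have eN : perm_eq (iota 0 N.+1) (N :: iota 0 N).
  by rewrite -addn1 iotaD /= add0n perm_catC.
apply/flatten_mapP/idP => [[u + hs]|hs].
  rewrite ih => hu; have Nu : N \notin u by rewrite (perm_mem hu) mem_iota; lia.
  move: hs; rewrite mem_inserts // => /andP[Ns /eqP e].
  apply: perm_trans (perm_to_rem Ns) _; rewrite e perm_sym.
  by apply: perm_trans eN _; rewrite perm_cons perm_sym.
have Ns : N \in s by rewrite (perm_mem hs) mem_iota; lia.
have hr : perm_eq (rem N s) (iota 0 N).
  have := perm_to_rem Ns; rewrite perm_sym => h.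
  by rewrite -(perm_cons N); apply: perm_trans h _; apply: perm_trans hs eN.
exists (rem N s); first by rewrite ih.
have Nr : N \notin rem N s by rewrite (perm_mem hr) mem_iota; lia.
by rewrite mem_inserts // Ns eqxx.
Qed.

Lemma uniq_perms N : uniq (perms N).
Proof.
elim: N => //= N ih.
have nN s : s \in perms N -> N \notin s.
  by rewrite mem_perms => h; rewrite (perm_mem h) mem_iota; lia.
move: (perms N) ih nN; elim => //= s ss ihs /andP[sn us] nN.
rewrite cat_uniq uniq_inserts ?nN ?mem_head //= ihs //; last first.
  by move=> u hu; apply: nN; rewrite inE hu orbT.
rewrite andbT; apply/hasPn => u /flatten_mapP[v hv].
have Nv : N \notin v by apply: nN; rewrite inE hv orbT.
rewrite mem_inserts // => /andP[_ /eqP e].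
rewrite mem_inserts ?nN ?mem_head // e negb_and.
by apply/orP; right; apply: contraNneq sn => <-.
Qed.

Definition permcount e N k := count (fun s => turns e s == k) (perms N).

(** Every word arises by exactly one insertion of its largest letter into a shorter word, and
    [N - k'] of the insertions into a word with [k'] turning points add two. *)
Lemma permcountS e N k : e || (0 < N) ->
  permcount e N.+1 k = k.+1 * permcount e N k
    + (if k is k'.+2 then (N - k') * permcount e N k' else 0).
Proof.
move=> eN; rewrite /permcount /= count_flatten -map_comp sumnE big_map.
rewrite -!sum1_count.
have -> : \sum_(j <- perms N) (count (fun s => turns e s == k) \o inserts N) j
  = \sum_(j <- perms N) (k.+1 * (turns e j == k) + (N - turns e j) * ((turns e j).+2 == k)).
  apply: eq_big_seq => s; rewrite mem_perms => hs /=.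
  have ss : size s = N by rewrite (perm_size hs) size_iota.
  have [||a [e1 e2]] := @sum_inserts (fun v => v == k) N s e.
  - by apply/allP => y; rewrite (perm_mem hs) mem_iota; lia.
  - by rewrite orbC; move: eN; rewrite -ss; case: s {hs ss}.
  rewrite -sum1_count big_mkcond /=.
  rewrite (eq_bigr (fun u => nat_of_bool (turns e u == k))); last by move=> u _; case: eqP.
  rewrite e2 -ss e1 addnK addnC; congr (_ + _).
  by case: eqP => [->|_]; rewrite ?muln0.
rewrite big_split /=; congr (_ + _).
  by rewrite -big_distrr /= [in RHS]big_mkcond.
case: k => [|[|k]]; try by rewrite big1 // => s _; rewrite muln0.
rewrite -sum1_count big_distrr /= [in RHS]big_mkcond /=; apply: eq_bigr => s _.
by rewrite !eqSS; case: eqP => [->|]; rewrite ?muln1 ?muln0.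
Qed.

Lemma bcoef0 N : 0 < N -> bcoef N 0 = 0.
Proof. by case: N. Qed.

(* The left boundary value is -oo or +oo according to the parity of the number
   of turning points. *)
Lemma permcountE N k : 0 < N -> permcount (~~ odd k) N k = bcoef N k.+1.
Proof.
elim: N k => [//|[|N] ih] k _.
  rewrite /permcount /=; case: k => [|[|k]] //=.
  by rewrite negbK; case: (odd k); rewrite ?muln0 ?addn0 // subn_eq0.
rewrite permcountS ?orbT // ih //.
case: k => [|[|k]].
- by rewrite /= !addn0.
- by rewrite [RHS]/= -/(bcoef N.+1 2) muln0.
have -> : ~~ odd k.+2 = ~~ odd k by rewrite /= negbK.
rewrite ih // [RHS]/=; congr (_ * _ + _ * _); lia.
Qed.

Lemma bcoef_gt N n : N.+1 < n -> bcoef N n = 0.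
Proof.
elim: N n => [|N ih] n h /=; first by case: n h => [|[]].
rewrite ih ?muln0 ?add0n; last by lia.
case: n h => [|[|n]] // h; case: (ltnP N.+1 n) => h2; first by rewrite ih ?muln0.
by rewrite (_ : N + 3 - n.+2 = 0) //; lia.
Qed.

Lemma bcoefS N n : bcoef N.+1 n = n * bcoef N n
  + (if n is n'.+2 then (N.+1 - n') * bcoef N n' else 0).
Proof. by case: n => [|[|n]] //=; congr (_ + _ * _); lia. Qed.

(** This is the value of D^N (x + y) at x = y = 1: there the derivation multiplies the value of a
    homogeneous polynomial of degree [d] by [d]. It serves to bound the derivatives of sec + tan. *)
Lemma sum_bcoef N : \sum_(n < N.+2) bcoef N n = 2 * N`!.
Proof.
elim: N => [|N ih]; first by rewrite !big_ord_recr big_ord0.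
under eq_bigr do rewrite bcoefS.
rewrite big_split /= big_ord_recr /= bcoef_gt // muln0 addn0.
rewrite [X in _ + X]big_ord_recl /= add0n [X in _ + X]big_ord_recl /= add0n.
rewrite factS mulnCA -ih big_distrr /=.
rewrite [X in _ + X](eq_bigr (fun i : 'I_N.+1 => (N.+1 - i) * bcoef N i)) //.
rewrite big_ord_recr [in RHS]big_ord_recr /= addnAC -big_split /=; congr (_ + _).
by apply: eq_bigr => i _; rewrite -mulnDl subnKC // ltnW // ltnS.
Qed.

Definition word N (s : 'S_N) : seq nat := [seq (s i : nat) | i <- enum 'I_N].

Lemma size_perms N : size (perms N) = N`!.
Proof.
elim: N => //= N ih; rewrite size_flatten /shape sumnE !big_map.
have sz M u : size (inserts M u) = (size u).+1.
  by elim: u => //= x u ihu; rewrite size_map ihu.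
have -> : \sum_(s <- perms N) size (inserts N s) = \sum_(s <- perms N) N.+1.
  by apply: eq_big_seq => s; rewrite mem_perms sz => /perm_size ->; rewrite size_iota.
by rewrite big_const_seq count_predT iter_addn_0 ih factS.
Qed.

Lemma nth_word N (s : 'S_N) (i : 'I_N) : nth 0 (word s) i = s i.
Proof. by rewrite /word (nth_map i) ?size_enum_ord // nth_ord_enum. Qed.

Lemma word_inj N : injective (@word N).
Proof.
move=> s t e; apply/permP => i; apply: ord_inj.
by rewrite -!nth_word e.
Qed.

Lemma card_words N (Q : pred (seq nat)) :
  #|[set s : 'S_N | Q (word s)]| = count Q (perms N).
Proof.
have p : perm_eq [seq word s | s <- enum {: 'S_N}] (perms N).
  have u : uniq [seq word s | s <- enum {: 'S_N}].
    by rewrite (map_inj_uniq (@word_inj N)) enum_uniq.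
  have sub : {subset [seq word s | s <- enum {: 'S_N}] <= perms N}.
    move=> _ /mapP[s _ ->]; rewrite mem_perms; apply: uniq_perm.
    - rewrite map_inj_uniq ?enum_uniq // => i j /val_inj; exact: perm_inj.
    - exact: iota_uniq.
    move=> k; rewrite mem_iota add0n /=; apply/mapP/idP => [[i _ ->] //|lt].
    by exists ((s^-1)%g (Ordinal lt)); rewrite ?mem_enum // permKV.
  have := uniq_min_size u sub.
  rewrite size_map -cardE card_Sn size_perms => /(_ (leqnn _))[_ h].
  by apply: uniq_perm => //; exact: uniq_perms.
rewrite -(seq.permP p Q) count_map -size_filter cardE; congr size.
by rewrite /enum_mem -filter_predI; apply: eq_filter => s; rewrite !inE andbT.
Qed.

Definition direction (e : bool) (s : seq nat) (i : nat) : bool :=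
  if i is i'.+1 then (if i < size s then nth 0 s i' < nth 0 s i else true) else e.

Lemma directionS e s i : direction e s i.+1 =
  if i.+1 < size s then nth 0 s i < nth 0 s i.+1 else true.
Proof. by []. Qed.

Lemma turns_sum e s :
  turns e s = \sum_(i < size s) (direction e s i != direction e s i.+1).
Proof.
case: s => [|x s] /=; first by rewrite big_ord0.
elim: s e x => [|y s ih] e x; first by rewrite big_ord1 /=; case: e.
rewrite big_ord_recl [turns_from _ _ _]/= ih; congr (_ + _).
by apply: eq_bigr => i _; case: i => -[].
Qed.

(** * Permutations with marked slots as types of morsifications *)

Section Pattern.
Variable N : nat.
Implicit Types (C : {set 'I_N}) (s : 'S_N).

(** The discrete form of the sign condition on values: a polynomial with simple critical slots [C]
    that tends to +oo on the right increases after slot [i] iff an even number of critical slots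
    follow. *)
Definition pattern C s := [forall i : 'I_N, forall j : 'I_N,
  (j == i.+1 :> nat) ==> ((s i < s j) == ~~ odd #|[set k in C | i < k]|)].

Definition turnset e s := [set i : 'I_N |
  direction e (word s) i != direction e (word s) i.+1].

Lemma size_word s : size (word s) = N.
Proof. by rewrite size_map size_enum_ord. Qed.

Lemma card_turnset e s : #|turnset e s| = turns e (word s).
Proof.
rewrite turns_sum size_word -sum1_card big_mkcond /=; apply: eq_bigr => i _.
by rewrite inE; case: ifP.
Qed.

(** Every slot of [C] reverses the direction and the last direction is upwards, so [C] determines
    all directions and consists of the turning points. The direction before the first letter then
    depends on the parity of [C]. *)
Lemma patternP C s : pattern C s = (C == turnset (~~ odd #|C|) s).
Proof.
set e := ~~ odd #|C|.
(* [h i] counts the slots of [C] from [i] on; the step arriving at [i] goes up iff [h i] is even. *)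
pose h i := #|[set k in C | i <= k]|.
have h0 : h 0 = #|C| by apply: eq_card => k; rewrite inE andbT.
have hS (i : 'I_N) : h i = (i \in C) + h i.+1.
  case iC : (i \in C).
    rewrite /h (cardsD1 i) inE iC leqnn; congr (_ + _); apply: eq_card => k.
    by rewrite !inE [i < k]ltn_neqAle eq_sym; case: (k \in C); rewrite ?andbF.
  apply: eq_card => k; rewrite !inE [i < k]ltn_neqAle.
  by case: (eqVneq (i : nat) k) => [/val_inj <-|//]; rewrite iC.
have hN : h N = 0.
  by apply: eq_card0 => k; rewrite !inE leqNgt ltn_ord andbF.
have dirE (i j : 'I_N) : j = i.+1 :> nat -> direction e (word s) i.+1 = (s i < s j).
  by move=> ij; rewrite directionS size_word -ij ltn_ord !nth_word.
have dN : 0 < N -> direction e (word s) N = true.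
  by move=> N0; have := directionS e (word s) N.-1; rewrite prednK // size_word ltnn.
apply/idP/eqP => [pC|eC].
  have dh i : i <= N -> direction e (word s) i = ~~ odd (h i).
    case: i => [|i] iN; first by rewrite h0.
    case: (ltnP i.+1 N) => iN'.
      have := forallP pC (Ordinal iN) => /forallP/(_ (Ordinal iN')).
      by rewrite /= eqxx /= => /eqP <-; exact: (@dirE (Ordinal iN) (Ordinal iN')).
    by have -> : i.+1 = N; [lia|rewrite hN dN //; lia].
  apply/setP => i; rewrite inE (dh i (ltnW (ltn_ord i))) (dh i.+1 (ltn_ord i)) hS oddD oddb.
  by case: (i \in C); case: (odd _).
have dh i : i <= N -> direction e (word s) i = ~~ odd (h i).
  elim: i => [|i ih] iN; first by rewrite h0.
  have := ih (ltnW iN); rewrite (hS (Ordinal iN)) oddD oddb.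
  have := finset.in_set (fun i : 'I_N => direction e (word s) i != direction e (word s) i.+1) (Ordinal iN).
  rewrite -/(turnset e s) -eC => ->.
  by rewrite [nat_of_ord _]/=; case: direction; case: direction; case: (odd _).
apply/forallP => i; apply/forallP => j; apply/implyP => /eqP ij.
by rewrite -(dirE _ _ ij) dh ?ltn_ord.
Qed.

End Pattern.

Section Types.
Variables m l : nat.
Local Notation N := (m + l).

Definition critslots (pos : {ffun 'I_l -> 'I_N}) : {set 'I_N} :=
  [set i | i \notin codom pos].

Lemma card_critslots (pos : {ffun 'I_l -> 'I_N}) : injective pos ->
  #|critslots pos| = m.
Proof.
move=> ip; have := cardC [in codom pos]; rewrite card_ord (card_codom ip) card_ord.
move=> /eqP; rewrite addnC eqn_add2r => /eqP e; apply: etrans e.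
by apply: eq_card => i; rewrite !inE.
Qed.

Definition types : {set 'S_N * {ffun 'I_l -> 'I_N}} :=
  [set t : 'S_N * {ffun 'I_l -> 'I_N} | injectiveb t.2 && pattern (critslots t.2) t.1].

(** For a permutation with exactly [m] turning points the boundary points must occupy the other [l]
    slots, in any of the [l!] labellings; other permutations admit no position of the boundary
    points. *)
Lemma card_types : 0 < N -> #|types| = l`! * bcoef N m.+1.
Proof.
move=> N0; rewrite -permcountE // /permcount -card_words.
pose T (s : 'S_N) := turnset (~~ odd m) s.
have sec (s : 'S_N) : #|[set pos : {ffun 'I_l -> 'I_N} | (s, pos) \in types]|
    = if #|T s| == m then l`! else 0.
  have typE pos : ((s, pos) \in types) = injectiveb pos && (critslots pos == T s).
    rewrite inE /=; case: (boolP (injectiveb pos)) => //= /injectiveP ip.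
    by rewrite patternP card_critslots.
  case: eqP => [eT|nT]; last first.
    apply: eq_card0 => pos; rewrite inE typE; apply/negbTE/negP.
    by move=> /andP[/injectiveP/card_critslots h /eqP eT]; rewrite eT in h.
  have cT : #|~: T s| = l by have := cardsC (T s); rewrite card_ord eT; lia.
  (* The falling factorial is the number of injections of the labels into the slots that are not
     turning points. *)
  have <- : #|~: T s| ^_ #|'I_l| = l`! by rewrite cT card_ord ffactnn.
  rewrite -card_inj_ffuns_on; apply: eq_card => pos.
  rewrite inE typE inE andbC; case: (boolP (injectiveb pos)) => [/injectiveP ip|_]; last by rewrite !andbF.
  rewrite !andbT; apply/eqP/ffun_onP => [e j|h].
    by rewrite inE -e inE codom_f.
  apply/eqP; rewrite eq_sym eqEcard card_critslots // eT leqnn andbT.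
  apply/fintype.subsetP => i iT; rewrite inE; apply/negP => /codomP[j ej].
  by have := h j; rewrite inE -ej iT.
rewrite -sum1_card (eq_bigl (fun t => xpredT t.1 && ((t.1, t.2) \in types))); last by case.
rewrite -(pair_big_dep xpredT (fun s p => (s, p) \in types) (fun _ _ => 1)) /=.
rewrite (eq_bigr (fun s => l`! * (turns (~~ odd m) (word s) == m))); last first.
  move=> s _; rewrite sum1_card -[RHS]/(_ * nat_of_bool _) -card_turnset.
  have := sec s; rewrite cardsE => ->; rewrite -/(T s).
  by case: eqP => _; rewrite ?muln1 ?muln0.
rewrite -big_distrr /= -sum1_card big_mkcond /=; congr (_ * _).
by rewrite [RHS]big_mkcond; apply: eq_bigr => s _; rewrite inE; case: eqP.
Qed.

End Types.

Local Open Scope ring_scope.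

(** * Polynomials with prescribed critical points *)

Section Antiderivative.
Variable R : numFieldType.
Implicit Types p q : {poly R}.

(** The inverse of 0 is 0, so the constant coefficient is 0: this is the primitive that vanishes at
    0. *)
Definition antideriv p : {poly R} :=
  \poly_(i < (size p).+1) (p`_i.-1 / i%:R).

Lemma coef_antideriv p i : (antideriv p)`_i = p`_i.-1 / i%:R.
Proof.
rewrite coef_poly ltnS; case: leqP => // hi.
by rewrite nth_default ?mul0r // -ltnS prednK // (leq_trans _ hi).
Qed.

Lemma antiderivK p : (antideriv p)^`() = p.
Proof.
by apply/polyP => i; rewrite coef_deriv coef_antideriv /= -[LHS]mulr_natr divfK.
Qed.

Lemma antiderivB p q : antideriv (p - q) = antideriv p - antideriv q.
Proof. by apply/polyP => i; rewrite !(coef_antideriv, coefB) mulrBl. Qed.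

Lemma size_antideriv_le p : (size (antideriv p) <= (size p).+1)%N.
Proof. exact: size_poly. Qed.

Lemma deriv_inj_coef0 p q : p^`() = q^`() -> p`_0 = q`_0 -> p = q.
Proof.
move=> e e0; apply/polyP => -[//|i].
have := congr1 (fun r : {poly R} => r`_i) e; rewrite !coef_deriv.
by move/eqP; rewrite eqrMn2r// => /eqP.
Qed.

End Antiderivative.

Section Slots.
Variables (R : rcfType) (N : nat) (C : {set 'I_N}).
Implicit Types x y w : 'I_N -> R.

(* The slots [x i] stand for the critical points ([i \in C]) and the boundary
   points of [Fpoly C x], in increasing order; [slope i] is the sign of the
   derivative between the slots [i] and [i.+1]. *)
Definition increasing x := forall i j : 'I_N, (i < j)%N -> x i < x j.

Definition critpoly x : {poly R} := \prod_(i in C) ('X - (x i)%:P).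

(** The factor makes the polynomial monic; its constant term is 0, as in P_n. *)
Definition Fpoly x : {poly R} := #|C|.+1%:R *: antideriv (critpoly x).

Definition slope (i : 'I_N) : R := (-1) ^+ #|[set j in C | i < j]%N|.

Definition cone w := forall i j : 'I_N, j = i.+1 :> nat ->
  0 < slope i * (w j - w i).

Lemma deriv_Fpoly x : (Fpoly x)^`() = #|C|.+1%:R *: critpoly x.
Proof. by rewrite derivZ antiderivK. Qed.

Lemma critpoly_horner x t : (critpoly x).[t] = \prod_(i in C) (t - x i).
Proof. by rewrite horner_prod; apply: eq_bigr => i _; rewrite !hornerE. Qed.

Lemma size_critpoly x : size (critpoly x) = #|C|.+1.
Proof. by rewrite /critpoly -big_enum size_prod_XsubC cardE. Qed.

Lemma critpoly_eq (x x' : 'I_N -> R) : {in C, x =1 x'} -> critpoly x = critpoly x'.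
Proof. by move=> e; apply: eq_bigr => i /e ->. Qed.

Lemma monic_critpoly x : critpoly x \is monic.
Proof. exact: monic_prod_XsubC. Qed.

Lemma critpoly_lead x : (critpoly x)`_#|C| = 1.
Proof. by have /monicP := monic_critpoly x; rewrite /lead_coef size_critpoly. Qed.

Lemma critpoly_sublead x : (0 < #|C|)%N ->
  (critpoly x)`_#|C|.-1 = - \sum_(i in C) x i.
Proof.
move=> C0; rewrite /critpoly -!big_enum /=.
have := @coefPn_prod_XsubC R [seq x i | i <- enum C].
by rewrite size_map -cardE !big_map => ->//; rewrite -lt0n.
Qed.

(** The leading coefficients cancel, and so do the next ones, which are minus the sums of the roots.
    This second cancellation is what makes the zero count for interlaced solutions succeed. *)
Lemma critpolyB_size x x' : \sum_(i in C) x i = \sum_(i in C) x' i ->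
  (size (critpoly x - critpoly x')%R <= #|C|.-1)%N.
Proof.
move=> eS; apply/leq_sizeP => j hj; rewrite coefB; apply/eqP; rewrite subr_eq0.
case: (ltngtP j #|C|) => [lt|gt|->]; last by rewrite !critpoly_lead.
- have C0 : (0 < #|C|)%N by apply: leq_ltn_trans lt.
  have -> : j = #|C|.-1 by apply/eqP; rewrite eqn_leq hj andbT -ltnS prednK.
  by rewrite !critpoly_sublead // eS.
- by rewrite !nth_default ?size_critpoly.
Qed.

Lemma Fpoly_coef0 x : (Fpoly x)`_0 = 0.
Proof. by rewrite coefZ coef_antideriv invr0 !mulr0. Qed.

Lemma critpoly_sign x t : {in C, forall i, x i != t} ->
  0 < (-1) ^+ #|[set j in C | t < x j]| * (critpoly x).[t].
Proof.
move=> ht; rewrite critpoly_horner.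
rewrite (_ : _ ^+ _ = \prod_(i in C) (if t < x i then -1 else 1)).
  rewrite -big_split /=; apply: prodr_gt0 => i iC.
  have := ht _ iC; case: (ltgtP t (x i)) => h // _ /=.
    by rewrite mulN1r opprB subr_gt0.
  by rewrite mul1r subr_gt0.
rewrite -big_mkcondr /= prodr_const; congr (_ ^+ _).
by apply: eq_card => i; rewrite !inE.
Qed.

Lemma critpoly_slope x (i : 'I_N) t :
  {in C, forall j : 'I_N, (j <= i)%N -> x j < t} ->
  {in C, forall j : 'I_N, (i < j)%N -> t < x j} ->
  0 < slope i * (critpoly x).[t].
Proof.
move=> h1 h2; rewrite /slope.
rewrite (_ : [set j in C | (i < j)%N] = [set j in C | t < x j]).
  apply: critpoly_sign => j jC; case: (leqP j i) => h.
    by rewrite lt_eqF ?h1.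
  by rewrite gt_eqF ?h2.
apply/setP => j; rewrite !inE; case jC : (j \in C) => //=.
case: leqP => h; first by rewrite ltNge (ltW (h1 _ jC h)).
by rewrite h2.
Qed.

Lemma sqr_slope i : slope i * slope i = 1.
Proof. by rewrite -expr2 sqrr_sign. Qed.

End Slots.

(** * Gaps between slots, and uniqueness of interlaced solutions *)

Section SlotGaps.
Variables (R : rcfType) (N : nat) (C : {set 'I_N}).
Implicit Types x y w : 'I_N -> R.
Local Notation F := (Fpoly C).
Local Notation slope := (slope R C).

Lemma increasing_le x (i j : 'I_N) : increasing x -> (i <= j)%N -> x i <= x j.
Proof.
move=> hx; rewrite leq_eqVlt => /orP[/eqP/val_inj -> //|/hx/ltW //].
Qed.

Lemma slope_between x (i j : 'I_N) t : increasing x -> j = i.+1 :> nat ->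
  x i < t -> t < x j -> 0 < slope i * (critpoly C x).[t].
Proof.
move=> hx eij h1 h2; apply: critpoly_slope => k _ hk.
  exact: le_lt_trans (increasing_le hx hk) h1.
by apply: lt_le_trans h2 (increasing_le hx _); rewrite eij.
Qed.

Lemma horner_deriv_Fpoly x t :
  (F x)^`().[t] = #|C|.+1%:R * (critpoly C x).[t].
Proof. by rewrite deriv_Fpoly hornerZ. Qed.

Lemma Fpoly_cone x : increasing x -> cone C (fun i => (F x).[x i]).
Proof.
move=> hx i j eij; have lt : x i < x j by apply: hx; rewrite eij.
have [c cI ->] := poly_mvt (F x) lt.
rewrite horner_deriv_Fpoly mulrA pmulr_lgt0 ?subr_gt0 // mulrCA.
rewrite pmulr_rgt0 ?ltr0n //.
by move: cI; rewrite in_itv /= => /andP[h1 h2]; apply: slope_between h1 h2.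
Qed.

(** On the middle third of the gap every critical point is at distance at least a third of it, which
    bounds the derivative from below; on the outer thirds the polynomial is monotone in the same
    direction. Large gaps thus force large differences of values. *)
Lemma slot_gap_ub x (i j : 'I_N) : increasing x -> j = i.+1 :> nat ->
  #|C|.+1%:R * ((x j - x i) / 3) ^+ #|C|.+1
    <= slope i * ((F x).[x j] - (F x).[x i]).
Proof.
move=> hx eij; have lt : x i < x j by apply: hx; rewrite eij.
set g := (x j - x i) / 3; have g0 : 0 < g by rewrite divr_gt0 // subr_gt0.
have ej : x j = x i + g + g + g by rewrite /g; field.
clearbody g; set a := x i + g; set b := a + g.
have mono u v : x i <= u -> u < v -> v <= x j ->
    0 <= slope i * ((F x).[v] - (F x).[u]).
  move=> h1 h2 h3; have [c + ->] := poly_mvt (F x) h2.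
  rewrite in_itv /= => /andP[h4 h5].
  rewrite horner_deriv_Fpoly mulrA pmulr_lge0 ?subr_gt0 // mulrCA.
  rewrite pmulr_rge0 ?ltr0n //; apply/ltW/(slope_between hx eij).
    exact: le_lt_trans h1 h4.
  exact: lt_le_trans h5 h3.
have h1 : 0 <= slope i * ((F x).[a] - (F x).[x i]).
  by apply: mono; rewrite /a; lra.
have h3 : 0 <= slope i * ((F x).[x j] - (F x).[b]).
  by apply: mono; rewrite /b /a; lra.
suff : #|C|.+1%:R * g ^+ #|C|.+1 <= slope i * ((F x).[b] - (F x).[a]) by lra.
have ab : a < b by rewrite /b; lra.
have [c + ->] := poly_mvt (F x) ab.
rewrite in_itv /= => /andP[h4 h5].
rewrite (_ : b - a = g); last by rewrite /b; ring.
rewrite horner_deriv_Fpoly exprSr !mulrA; apply: ler_wpM2r; first exact: ltW.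
rewrite (mulrC (slope i)) -mulrA ler_pM2l ?ltr0n //.
have lic : x i < c by apply: lt_trans h4; rewrite /a; lra.
have lcj : c < x j by apply: lt_trans h5 _; rewrite /b /a; lra.
have /gtr0_norm <- := slope_between hx eij lic lcj.
rewrite normrM normrX normrN1 expr1n mul1r critpoly_horner normr_prod.
rewrite -prodr_const; apply: ler_prod => k _.
rewrite (ltW g0) /=; case: (leqP k i) => hk.
  have := increasing_le hx hk; move: h4; rewrite /a => *.
  by rewrite ger0_norm; lra.
have := @increasing_le x j k hx; rewrite eij => /(_ hk).
by move: h5; rewrite /b /a => *; rewrite ler0_norm; lra.
Qed.

(** Between the slots all factors of the derivative are at most [2 B], and the mean value theorem
    applies. A lower bound on the difference of values therefore keeps the slots apart. *)
Lemma slot_gap_lb x (i j : 'I_N) B : increasing x -> j = i.+1 :> nat ->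
  (forall k, `|x k| <= B) ->
  slope i * ((F x).[x j] - (F x).[x i])
    <= #|C|.+1%:R * (2 * B) ^+ #|C| * (x j - x i).
Proof.
move=> hx eij hB; have lt : x i < x j by apply: hx; rewrite eij.
have [c + ->] := poly_mvt (F x) lt.
rewrite in_itv /= => /andP[h4 h5].
rewrite horner_deriv_Fpoly !mulrA; apply: ler_wpM2r.
  by rewrite subr_ge0 ltW.
rewrite (mulrC (slope i)) -mulrA ler_pM2l ?ltr0n //.
have /gtr0_norm <- := slope_between hx eij h4 h5.
rewrite normrM normrX normrN1 expr1n mul1r critpoly_horner normr_prod.
rewrite -prodr_const; apply: ler_prod => k _.
rewrite normr_ge0 /=; apply: le_trans (ler_normB _ _) _.
rewrite mulr2n mulrDl !mul1r lerD // ler_norml.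
have /andP[h1 _] : - B <= x i <= B by rewrite -ler_norml.
have /andP[_ h2] : - B <= x j <= B by rewrite -ler_norml.
by apply/andP; split; lra.
Qed.

(** For increasing [x] and [x'] this says that the closed intervals with ends [x i] and [x' i], for
    [i] in [C], are pairwise disjoint and ordered like the indices. *)
Definition interlaced x x' := forall i j, i \in C -> j \in C -> (i < j)%N ->
  x i < x' j /\ x' i < x j.

(** Between its neighbours in [C] the critical point [x i] is the only one; the derivative has the
    sign [slope i] on its right and the opposite sign on its left. *)
Lemma Fpoly_extremum x i t : i \in C -> increasing x ->
  {in C, forall j : 'I_N, (j < i)%N -> x j < t} ->
  {in C, forall j : 'I_N, (i < j)%N -> t < x j} ->
  0 <= slope i * ((F x).[t] - (F x).[x i]).
Proof.
move=> iC hx h1 h2; case: (ltgtP t (x i)) => [lt|gt|->]; last first.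
- by rewrite subrr mulr0.
- have [c + ->] := poly_mvt (F x) gt.
  rewrite in_itv /= => /andP[h4 h5].
  rewrite horner_deriv_Fpoly mulrA pmulr_lge0 ?subr_gt0 // mulrCA.
  rewrite pmulr_rge0 ?ltr0n //; apply/ltW/critpoly_slope => j jC hj.
    exact: le_lt_trans (increasing_le hx hj) h4.
  exact: lt_trans h5 (h2 _ jC hj).
have [c + e] := poly_mvt (F x) lt.
rewrite in_itv /= => /andP[h4 h5].
rewrite -opprB e horner_deriv_Fpoly mulrN oppr_ge0 mulrA.
rewrite pmulr_lle0 ?subr_gt0 // mulrCA pmulr_rle0 ?ltr0n //.
have := @critpoly_sign _ _ C x c; set s := (_ ^+ #|_|) => hs.
have {}hs : 0 < s * (critpoly C x).[c].
  apply: hs => j jC; case: (ltngtP j i) => hj.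
  - by rewrite lt_eqF // (lt_trans (h1 _ jC hj)).
  - by rewrite gt_eqF // (lt_trans h5) // hx.
  - by rewrite (val_inj hj) gt_eqF.
(* To the left of [x i] the slot [i] itself counts among the critical slots on the right, which
   reverses the sign. *)
suff -> : slope i = - s by rewrite mulNr oppr_le0 ltW.
rewrite /slope /s (_ : [set j in C | c < x j]
   = i |: [set j in C | (i < j)%N]).
  by rewrite cardsU1 inE ltnn andbF /= add1n exprS mulN1r opprK.
apply/setP => j; rewrite !inE; case jC : (j \in C) => /=; last first.
  by rewrite orbF; apply/esym/negbTE; apply: contraFneq jC => ->.
case: (ltngtP j i) => hj.
- rewrite ltNge (ltW (lt_trans (h1 _ jC hj) h4)) /= orbF.
  by apply/esym/negbTE; rewrite neq_ltn hj.
- by rewrite orbT (lt_trans h5) // hx.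
- by rewrite (val_inj hj) eqxx h5.
Qed.

(* [F x - F x' - k] has degree less than #|C| and, by the extremality of
   critical values, a zero between [x i] and [x' i] for every [i \in C]. *)
Lemma interlaced_eq_crit x x' k : increasing x -> increasing x' ->
  interlaced x x' -> \sum_(i in C) x i = \sum_(i in C) x' i ->
  {in C, forall i, (F x).[x i] = (F x').[x' i] + k} ->
  {in C, x =1 x'}.
Proof.
move=> hx hx' il eS ev i0 i0C.
have C0 : (0 < #|C|)%N by apply/card_gt0P; exists i0.
pose H := F x - F x' - k%:P.
have HE t : H.[t] = (F x).[t] - (F x').[t] - k.
  by rewrite /H !hornerD !hornerN hornerC.
have /(all_sig2_cond (0 : R)) : forall i, i \in C ->
    {z | (Num.min (x i) (x' i) <= z <= Num.max (x i) (x' i)) & root H z}.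
  move=> i iC.
  have a1 : 0 <= slope i * H.[x' i].
    rewrite HE.
    have -> : (F x).[x' i] - (F x').[x' i] - k = (F x).[x' i] - (F x).[x i].
      by rewrite ev //; ring.
    apply: Fpoly_extremum => // j jC ji.
      by have [] := il _ _ jC iC ji.
    by have [] := il _ _ iC jC ji.
  have a2 : slope i * H.[x i] <= 0.
    rewrite HE.
    have -> : (F x).[x i] - (F x').[x i] - k = - ((F x').[x i] - (F x').[x' i]).
      by rewrite ev //; ring.
    rewrite mulrN oppr_le0; apply: Fpoly_extremum => // j jC ji.
      by have [] := il _ _ jC iC ji.
    by have [] := il _ _ iC jC ji.
  have a3 : H.[x i] * H.[x' i] <= 0.
    rewrite -[H.[x i]]mul1r -(sqr_slope R C i).
    rewrite -mulrA mulrACA; exact: mulr_le0_ge0.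
  case: (leP (x i) (x' i)) => h.
    have [z hz rz] := polyrcf.poly_ivt h a3; exists z => //.
  have [|z hz rz] := polyrcf.poly_ivt (ltW h) (_ : H.[x' i] * H.[x i] <= 0).
    by rewrite mulrC.
  by exists z.
case=> z hz rz.
have H0 : H = 0.
  apply: (@roots_geq_poly_eq0 _ _ [seq z i | i <- enum C]).
  - by apply/allP => _ /mapP[i + ->]; rewrite mem_enum => /rz.
  (* Interlacing puts the zeros into disjoint intervals, so they are distinct. *)
  - rewrite map_inj_in_uniq ?enum_uniq // => i j; rewrite !mem_enum => iC jC.
    have lt i1 j1 : i1 \in C -> j1 \in C -> (i1 < j1)%N -> z i1 < z j1.
      move=> iC1 jC1 ij; have [h1 h2] := il _ _ iC1 jC1 ij.
      have /andP[_ h3] := hz _ iC1; have /andP[h4 _] := hz _ jC1.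
      apply: le_lt_trans h3 (lt_le_trans _ h4).
      by rewrite gt_max !lt_min h1 h2 !hx ?hx'.
    case: (ltngtP i j) => [/(lt _ _ iC jC)|/(lt _ _ jC iC)|/val_inj //].
      by move=> + e; rewrite e ltxx.
    by move=> + e; rewrite e ltxx.
  - rewrite size_map -cardE /H /Fpoly -scalerBr -antiderivB.
    apply: leq_trans (size_polyD _ _) _; rewrite geq_max size_polyN.
    rewrite (leq_trans (size_polyC_leq1 _)) // andbT.
    apply: leq_trans (size_scale_leq _ _) _.
    apply: leq_trans (size_antideriv_le _) _.
    by rewrite -[leqRHS](prednK C0) ltnS critpolyB_size.
have eC : critpoly C x = critpoly C x'.
  have /eqP := congr1 (@deriv R) H0.
  rewrite /H !derivB derivC subr0 deriv0 !deriv_Fpoly -scalerBr.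
  rewrite scaler_eq0 pnatr_eq0 /= subr_eq0 => /eqP //.
(* The derivatives coincide, so [x i0] is some [x' j]; interlacing leaves only [j = i0]. *)
have : root (critpoly C x') (x i0).
  rewrite -eC rootE critpoly_horner (bigD1 i0) //= subrr mul0r //.
rewrite rootE critpoly_horner => /prodf_eq0[j jC]; rewrite subr_eq0.
case: (ltngtP j i0) => [h|h|/val_inj -> /eqP //].
  by have [_ h2] := il _ _ jC i0C h; rewrite gt_eqF.
by have [h2 _] := il _ _ i0C jC h; rewrite lt_eqF.
Qed.

(* The polynomials agree, and they are monotone between critical points. *)
Lemma eq_crit_eq x x' : increasing x -> increasing x' -> {in C, x =1 x'} ->
  (forall i, (F x).[x i] = (F x').[x' i]) -> x =1 x'.
Proof.
move=> hx hx' eC ev.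
suff lt (u v : 'I_N -> R) i : increasing u -> increasing v -> {in C, u =1 v} ->
    (F u).[u i] = (F v).[v i] -> ~~ (u i < v i).
  move=> i; apply: le_anti; rewrite !leNgt !lt //.
  by move=> j jC; rewrite eC.
move=> hu hv e ei; apply/negP => h.
have eF : F u = F v by rewrite /Fpoly (critpoly_eq e).
have iC : i \notin C by apply/negP => /e euv; move: h; rewrite euv ltxx.
have [c + /eqP] := poly_mvt (F u) h.
rewrite in_itv /= => /andP[h4 h5]; rewrite {1}eF -ei subrr eq_sym mulf_eq0.
rewrite horner_deriv_Fpoly mulf_eq0 pnatr_eq0 /= subr_eq0 (gt_eqF h) orbF.
suff /gt_eqF : 0 < slope i * (critpoly C u).[c].
  by move=> + /eqP c0; rewrite c0 mulr0 eqxx.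
apply: critpoly_slope => j jC hj.
  exact: le_lt_trans (increasing_le hu hj) h4.
by rewrite (lt_trans h5) // e // hv.
Qed.

Lemma interlaced_eq x x' i0 : increasing x -> increasing x' ->
  interlaced x x' -> \sum_(i in C) x i = \sum_(i in C) x' i ->
  i0 \in C ->
  (forall i j, (F x).[x i] - (F x).[x j] = (F x').[x' i] - (F x').[x' j]) ->
  x =1 x'.
Proof.
move=> hx hx' il eS iC ev.
(* The values agree up to the constant [k], which vanishes once the critical points, and hence the
   polynomials, are known to agree. *)
pose k := (F x).[x i0] - (F x').[x' i0].
have ev' i : (F x).[x i] = (F x').[x' i] + k.
  by have := ev i i0; rewrite /k; lra.
have eC : {in C, x =1 x'} by apply: interlaced_eq_crit il eS (in1W ev').
apply: eq_crit_eq => // i; rewrite ev'; apply/eqP; rewrite -subr_eq0 addrC addKr.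
by rewrite /k eC // /Fpoly (critpoly_eq eC) subrr.
Qed.

End SlotGaps.

(** * Uniqueness of Chebyshev polynomials *)

Section Chebyshev.
Variables (R : rcfType) (N : nat) (C : {set 'I_N}).
Implicit Types x y w : 'I_N -> R.
Local Notation F := (Fpoly C).
Local Notation P := (critpoly C).
Local Notation slope := (slope R C).
Local Notation n := #|C|.+1.

Lemma coef_Fpoly x k : (F x)`_k.+1 * k.+1%:R = n%:R * (P x)`_k.
Proof.
by rewrite coefZ coef_antideriv /= -mulrA divfK // pnatr_eq0.
Qed.

Lemma Fpoly_lead x : (F x)`_n = 1.
Proof.
have := coef_Fpoly x #|C|; rewrite critpoly_lead mulr1.
by move/eqP; rewrite -[X in _ == X]mul1r => /eqP/mulIf; apply; rewrite pnatr_eq0.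
Qed.

Lemma size_Fpoly x : size (F x) = n.+1.
Proof.
apply/eqP; rewrite eqn_leq; apply/andP; split.
  apply: leq_trans (size_scale_leq _ _) _.
  by apply: leq_trans (size_antideriv_le _) _; rewrite size_critpoly.
by rewrite ltnNge; apply/negP => /leq_sizeP/(_ _ (leqnn _))/eqP;
   rewrite Fpoly_lead oner_eq0.
Qed.

Lemma Fpoly_sublead x : (0 < #|C|)%N -> \sum_(i in C) x i = 0 ->
  (F x)`_#|C| = 0.
Proof.
move=> C0 e; have := coef_Fpoly x #|C|.-1.
rewrite critpoly_sublead // e oppr0 mulr0 prednK // => /eqP.
by rewrite mulf_eq0 pnatr_eq0 eqn0Ngt C0 orbF => /eqP.
Qed.

Lemma critpoly_simple_root x i : increasing x -> i \in C ->
  (P x)^`().[x i] != 0.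
Proof.
move=> hx iC; rewrite /critpoly (bigD1 i) //= derivM derivXsubC mul1r.
rewrite hornerD hornerM hornerXsubC subrr mul0r addr0 horner_prod.
apply/prodf_neq0 => j /andP[jC ji]; rewrite hornerXsubC subr_eq0.
case: (ltngtP i j) => [/hx/lt_eqF -> //|/hx/gt_eqF -> //|/val_inj e].
by rewrite e eqxx in ji.
Qed.

Lemma dvd_critpoly x (G : {poly R}) : increasing x ->
  {in C, forall i, root G (x i)} -> P x %| G.
Proof.
move=> hx hr; rewrite /critpoly -big_enum /= -(big_map x xpredT (fun a => 'X - a%:P)).
apply: uniq_roots_dvdp.
  by apply/allP => _ /mapP[i + ->]; rewrite mem_enum => /hr.
rewrite uniq_rootsE map_inj_in_uniq ?enum_uniq // => i j _ _ e.
case: (ltngtP i j) => [/hx|/hx|/val_inj //].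
  by rewrite e ltxx.
by rewrite e ltxx.
Qed.

Lemma coefXderiv (q : {poly R}) k : ('X * q^`())`_k = k%:R * q`_k.
Proof. by rewrite coefXM coef_deriv; case: k => [|k]; rewrite ?mul0r //= mulr_natl. Qed.

Lemma coefX2deriv2 (q : {poly R}) k :
  ('X^2 * q^`()^`())`_k = k%:R * (k%:R - 1) * q`_k.
Proof.
have -> : 'X^2 * q^`()^`() = 'X * ('X * q^`())^`() - 'X * q^`().
  by rewrite derivM derivX; ring.
by rewrite coefB !coefXderiv; ring.
Qed.

(** The coefficientwise form of [(X^2 - a^2) f'' + X f' = n^2 f], the equation satisfied by the
    Chebyshev polynomial [T_n (X / a)]. *)
Definition chebyshev_rec (a : R) (f : {poly R}) := forall k,
  (n%:R ^+ 2 - k%:R ^+ 2) * f`_k = - a ^+ 2 * k.+1%:R * k.+2%:R * f`_k.+2.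

(* [f ^ 2 - 1] is divisible by [f' ^ 2]; differentiating the resulting
   identity gives the Chebyshev differential equation. *)
Lemma chebyshev_ode x k : increasing x -> (0 < #|C|)%N ->
  \sum_(i in C) x i = 0 ->
  {in C, forall i, (F x).[x i] + k = - slope i} ->
  exists2 a, 0 < a & chebyshev_rec a (F x + k%:P).
Proof.
move=> hx C0 e0 hv; have [f ef] : {f | f = F x + k%:P} by eexists.
rewrite -ef.
have df : f^`() = n%:R *: P x by rewrite ef derivD derivC addr0 deriv_Fpoly.
have fv i : i \in C -> f.[x i] = - slope i.
  by move=> iC; rewrite ef hornerD hornerC hv.
pose G := f ^+ 2 - 1.
have n0 : n%:R != 0 :> R by rewrite pnatr_eq0.
have G1 : P x %| G.
  apply: dvd_critpoly => // i iC; rewrite rootE /G !hornerE fv //.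
  by rewrite sqrrN expr2 sqr_slope subrr.
have [H eH] := dvdpP _ _ G1.
have dG : G^`() = n.*2%:R *: (f * P x).
  rewrite /G derivB derivC subr0 expr2 derivM df -!scalerAl -!scalerAr.
  by rewrite [P x * f]mulrC -scalerDl -natrD addnn.
(* [G' = H' P + H P'] is a multiple of [P = P x], whose roots are simple; so [H] vanishes at them as
   well. *)
have H1 : P x %| H.
  apply: dvd_critpoly => // i iC; rewrite rootE.
  have := congr1 (horner^~ (x i)) dG.
  have Pi : (P x).[x i] = 0.
    by rewrite critpoly_horner (bigD1 i) //= subrr mul0r.
  rewrite eH derivM /= hornerD hornerZ !hornerM Pi !mulr0 add0r.
  by move/eqP; rewrite mulf_eq0 (negPf (critpoly_simple_root hx iC)) orbF.
have [Q eQ] := dvdpP _ _ H1.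
have P0 : P x != 0 by exact/monic_neq0/monic_critpoly.
have eG : G = Q * P x ^+ 2 by rewrite eH eQ expr2 mulrA.
have ode : n.*2%:R *: f = Q^`() * P x + Q * (P x)^`() *+ 2.
  apply: (mulIf P0).
  rewrite -scalerAl -dG eG expr2 !derivM mulrDl; ring.
have sf : size f = n.+1.
  by rewrite ef size_polyDl size_Fpoly // (leq_ltn_trans (size_polyC_leq1 _)).
have fm : f \is monic.
  by rewrite monicE /lead_coef sf /= ef coefD coefC /= addr0 Fpoly_lead.
have Gm : G \is monic.
  rewrite monicE lead_coefDl ?lead_coef_exp ?(monicP fm) ?expr1n //.
  by rewrite size_polyN size_poly1 expr2 size_monicM ?monic_neq0 ?sf ?addSn ?addnS.
have sG : size G = n.*2.+1.
  rewrite size_polyDl expr2 size_monicM ?sf ?monic_neq0 //.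
    by rewrite addSn -addnn addnS.
  by rewrite size_polyN size_poly1 addSn addnS.
have Qm : Q \is monic.
  by rewrite -(monicMr _ (monic_exp 2 (monic_critpoly C x))) -eG.
(* Comparing degrees, [2n = deg Q + 2(n - 1)], so [Q] is quadratic. *)
have sQ : size Q = 3.
  have := sG; rewrite eG size_Mmonic ?monic_neq0 ?monic_exp ?monic_critpoly //.
  rewrite expr2 size_monicM ?monic_critpoly ?monic_neq0 ?monic_critpoly //.
  by rewrite size_critpoly; move: (size Q) => q; lia.
pose p := Q`_1; pose r := Q`_0.
have EQ : Q = 'X^2 + p *: 'X + r%:P.
  have Q2 : Q`_2 = 1 by have /monicP := Qm; rewrite /lead_coef sQ.
  apply/polyP => -[|[|[|j]]]; rewrite !(coefD, coefXn, coefZ, coefX, coefC) /=.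
  - by rewrite mulr0 !add0r.
  - by rewrite mulr1 add0r addr0.
  - by rewrite mulr0 !addr0.
  - by rewrite mulr0 !addr0 nth_default // sQ.
have dQ : Q^`() = 'X *+ 2 + p%:P.
  by rewrite EQ !derivD derivZ derivXn derivX derivC addr0 /= expr1 alg_polyC.
have fn1 : f`_#|C| = 0.
  by rewrite ef coefD Fpoly_sublead // coefC -[#|C|]prednK //= addr0.
have ode2 : n%:R ^+ 2 *: f *+ 2 = ('X *+ 2 + p%:P) * f^`()
    + ('X^2 + p *: 'X + r%:P) * f^`()^`() *+ 2.
  rewrite -EQ -dQ df derivZ -!mul_polyC.
  transitivity (n%:R%:P * (Q^`() * P x + Q * (P x)^`() *+ 2)); last by ring.
  rewrite -ode -mul_polyC -muln2 natrM mulr_natr expr2 !polyCM polyCMn; ring.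
have co k0 : n%:R ^+ 2 * f`_k0 *+ 2 =
   (k0%:R * f`_k0) *+ 2 + p * (k0.+1%:R * f`_k0.+1)
   + (k0%:R * (k0%:R - 1) * f`_k0 + p * (k0%:R * (k0.+1%:R * f`_k0.+1))
      + r * (k0.+1%:R * k0.+2%:R * f`_k0.+2)) *+ 2.
  have := congr1 (fun q : {poly R} => q`_k0) ode2.
  rewrite coefMn coefZ => ->; rewrite mulrDl mulrnAl !mulrDl.
  rewrite !(coefD, coefMn) !coefCM -scalerAl coefZ coefXderiv coefX2deriv2.
  by rewrite coefXderiv !coef_deriv; ring.
(* The coefficient of degree [n - 1] in the equation, where that of [f] is 0 by centering, gives
   [p = 0]. *)
have p0 : p = 0.
  have := co #|C|; rewrite fn1.
  have -> : f`_n = 1 by have /monicP := fm; rewrite /lead_coef sf.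
  rewrite [f`_n.+1]nth_default ?sf // => e.
  have : p * (n%:R * (1 + 2 * #|C|%:R)) = 0 by transitivity (n%:R ^+ 2 * (0 : R) *+ 2); [rewrite e; ring|ring].
  move/eqP; rewrite mulf_eq0 mulf_eq0 (negPf n0) /= => /orP[/eqP //|].
  by rewrite -natrM nat1r pnatr_eq0.
pose i0 := xchoose (card_gt0P C0).
have i0C : i0 \in C := xchooseP (card_gt0P C0).
(* At the last critical point [x i1] the value is -1, and beyond it [f] grows to +oo and takes the
   value 1 at some [z]. There [P x] does not vanish, so [Q] does, and [a = z] serves. Centering
   gives [x i1 >= 0], hence [z > 0]. *)
have [i1 i1C hi1] : exists2 i1, i1 \in C & {in C, forall j : 'I_N, (j <= i1)%N}.
  by case: (@arg_maxnP _ i0 [in C] (@nat_of_ord N) i0C) => i1 ? ?; exists i1.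
have s1 : slope i1 = 1.
  rewrite /slope (_ : [set j in C | _] = finset.set0) ?cards0 //.
  by apply/setP => j; rewrite !inE; apply/negP => /andP[/hi1]; rewrite leqNgt => /negP.
have x1 : 0 <= x i1.
  rewrite leNgt; apply/negP => x1n.
  have neg j : j \in C -> x j < 0.
    by move=> /hi1/(increasing_le hx) h; apply: le_lt_trans x1n.
  have : \sum_(j in C) - x j = 0 by rewrite sumrN e0 oppr0.
  move/psumr_eq0P => /(_ _ i1 i1C) => h.
  have /h/eqP : forall j, j \in C -> 0 <= - x j.
    by move=> j /neg /ltW; rewrite oppr_ge0.
  by rewrite oppr_eq0 lt_eqF.
have [z z1 fz] : exists2 z, x i1 < z & f.[z] = 1.
  have sq : size (f - 1) = n.+1 by rewrite size_polyDl ?sf // size_polyN size_poly1.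
  have lq : 0 < lead_coef (f - 1).
    by rewrite /lead_coef sq coefB coef1 subr0 -[n]/(n.+1.-1) -sf -/(lead_coef f) (monicP fm).
  have [T hT] := poly_pinfty_gt_lc lq.
  pose t := Num.max T (x i1 + 1).
  have t1 : x i1 < t by rewrite lt_max ltrDl ltr01 orbT.
  have [|z hz rz] := @poly_ivtoo _ (f - 1) (x i1) t (ltW t1).
    rewrite nmulr_rlt0; first by apply: lt_le_trans lq (hT _ _); rewrite le_max lexx.
    by rewrite hornerD hornerN hornerC fv // s1; lra.
  exists z; first by move: hz; rewrite in_itv /= => /andP[].
  by move: rz; rewrite rootE hornerD hornerN hornerC subr_eq0 => /eqP.
have Qz : z ^+ 2 + r = 0.
  have : G.[z] = 0 by rewrite /G hornerD hornerN hornerC expr2 hornerM fz mulr1 subrr.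
  rewrite eG hornerM horner_exp => /eqP; rewrite mulf_eq0 => /orP[/eqP|].
    by rewrite EQ p0 scale0r addr0 hornerD hornerXn hornerC.
  rewrite expf_eq0 /= critpoly_horner => /prodf_eq0[j jC]; rewrite subr_eq0.
  by rewrite gt_eqF // (le_lt_trans (increasing_le hx (hi1 _ jC))).
exists z; first exact: le_lt_trans z1.
move=> k0; have := co k0; rewrite p0.
have -> : r = - z ^+ 2 by apply/eqP; rewrite -addr_eq0 addrC Qz.
by move=> e; lra.
Qed.

(** The recurrence goes down by two from the coefficients 1 and 0 of degrees [n] and [n - 1], and
    [n^2 - k^2] is nonzero for [k < n]; hence the scale determines the polynomial. *)
Lemma chebyshev_scaling a b (f g : {poly R}) : 0 < a -> 0 < b ->
  chebyshev_rec a f -> chebyshev_rec b g ->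
  size f = n.+1 -> size g = n.+1 -> f`_n = 1 -> g`_n = 1 ->
  f`_#|C| = 0 -> g`_#|C| = 0 ->
  f = (a / b) ^+ n *: (g \Po ((b / a) *: 'X)).
Proof.
move=> a0 b0 hf hg sf sg fn gn fm gm.
have an0 : a != 0 by rewrite gt_eqF.
have bn0 : b != 0 by rewrite gt_eqF.
have key j : (j <= n)%N -> f`_(n - j) = (a / b) ^+ j * g`_(n - j).
  elim/ltn_ind: j => -[|[|j]] ih hj.
  - by rewrite subn0 fn gn mulr1.
  - by rewrite subn1 /= fm gm mulr0.
  have [k ek] : {k | n = (k + j.+2)%N} by exists (n - j.+2)%N; rewrite subnK.
  have e2 : (n - j = k.+2)%N by rewrite ek !addnS -!addSn addnK.
  have e0 : (n - j.+2 = k)%N by rewrite ek addnK.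
  have := ih j (leqnSn _) (leq_trans (leqnSn _) (leq_trans (leqnSn _) hj)).
  rewrite e0 e2 => e; have := hf k; have := hg k; rewrite e.
  have d0 : n%:R ^+ 2 - k%:R ^+ 2 != 0 :> R.
    rewrite subr_sqr; apply: mulf_neq0; last by rewrite -natrD pnatr_eq0 addSn.
    by rewrite ek natrD addrC addKr pnatr_eq0.
  move=> e3 e4; apply: (mulfI d0); rewrite e4 [in RHS]mulrCA e3.
  rewrite !exprSr; field.
  by rewrite bn0.
apply/polyP => k; case: (leqP k n) => hk; last first.
  rewrite nth_default ?sf // coefZ.
  rewrite (_ : (g \Po _)`_k = 0) ?mulr0 //.
  rewrite nth_default //; apply: leq_trans (size_comp_poly_leq _ _) _.
  rewrite sg /= size_scale ?size_polyX ?muln1 //.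
  by rewrite mulf_neq0 // invr_eq0.
rewrite coefZ coef_comp_poly sg (bigD1 (Ordinal (hk : (k < n.+1)%N))) //=.
rewrite exprZn coefZ coefXn eqxx mulr1 big1 ?addr0; last first.
  move=> i ik; rewrite exprZn coefZ coefXn.
  have -> : (k == i) = false by apply/negbTE; rewrite eq_sym.
  by rewrite !mulr0.
have := key (n - k)%N (leq_subr _ _); rewrite subKn // => ->.
have -> : (a / b) ^+ n = (a / b) ^+ (n - k) * (a / b) ^+ k by rewrite -exprD subnK.
rewrite -mulrA; congr (_ * _); rewrite mulrCA -exprMn.
by rewrite [X in X ^+ k](_ : _ = 1) ?expr1n ?mulr1 //; field; rewrite an0.
Qed.

Lemma critpoly_inj x x' : increasing x -> increasing x' -> P x = P x' ->
  {in C, x =1 x'}.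
Proof.
move=> hx hx' e.
have mem (u v : 'I_N -> R) i : P u = P v -> i \in C -> exists2 j, j \in C & u i = v j.
  move=> euv iC; have : root (P v) (u i).
    by rewrite -euv rootE critpoly_horner (bigD1 i) //= subrr mul0r.
  rewrite rootE critpoly_horner => /prodf_eq0[j jC].
  by rewrite subr_eq0 => /eqP ->; exists j.
suff le (u v : 'I_N -> R) (i : 'I_N) : increasing u -> increasing v ->
    P u = P v -> i \in C -> {in C, forall j : 'I_N, (j < i)%N -> u j = v j} ->
    u i <= v i.
  move=> i iC; have [m hm] := ubnP (val i); elim: m => // m ih in i iC hm *.
  have eq j : j \in C -> (j < i)%N -> x j = x' j.
    by move=> jC ji; apply: ih => //; apply: leq_trans ji _.
  by apply: le_anti; rewrite !le // => j jC ji; rewrite eq.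
move=> hu hv euv iC eq; have [j jC e1] := mem v u i (esym euv) iC.
rewrite e1; case: (ltnP j i) => ji; last exact: increasing_le.
by have := hv _ _ ji; rewrite e1 -(eq j) // ltxx.
Qed.

(** After the addition of constants both polynomials satisfy the Chebyshev recurrence, so they agree
    up to scale, and the critical values 1 and -1 fix the scale. The boundary slots follow by
    [eq_crit_eq]. *)
Lemma chebyshev_unique x x' i0 : increasing x -> increasing x' -> i0 \in C ->
  \sum_(i in C) x i = 0 -> \sum_(i in C) x' i = 0 ->
  (forall i j, (F x).[x i] - (F x).[x j] = (F x').[x' i] - (F x').[x' j]) ->
  {in C &, forall i j, (F x).[x i] - (F x).[x j] = slope j - slope i} ->
  x =1 x'.
Proof.
move=> hx hx' iC e e' ev es.
have C0 : (0 < #|C|)%N by apply/card_gt0P; exists i0.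
pose k := - slope i0 - (F x).[x i0]; pose k' := - slope i0 - (F x').[x' i0].
have hk i : i \in C -> (F x).[x i] + k = - slope i.
  by move=> iC'; have := es _ _ iC' iC; rewrite /k; lra.
have hk' i : i \in C -> (F x').[x' i] + k' = - slope i.
  by move=> iC'; have := es _ _ iC' iC; rewrite ev /k'; lra.
have [a a0 ha] := chebyshev_ode hx C0 e hk.
have [b b0 hb] := chebyshev_ode hx' C0 e' hk'.
have sz (u : 'I_N -> R) c : size (F u + c%:P) = n.+1.
  by rewrite size_polyDl size_Fpoly // (leq_ltn_trans (size_polyC_leq1 _)).
have ld (u : 'I_N -> R) c : (F u + c%:P)`_n = 1 by rewrite coefD coefC addr0 Fpoly_lead.
have sl (u : 'I_N -> R) c : \sum_(i in C) u i = 0 -> (F u + c%:P)`_#|C| = 0.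
  by move=> eu; rewrite coefD Fpoly_sublead // coefC -[#|C|]prednK //= addr0.
have := chebyshev_scaling a0 b0 ha hb (sz _ _) (sz _ _) (ld _ _) (ld _ _)
  (sl _ _ e) (sl _ _ e').
have an0 : a != 0 by rewrite gt_eqF.
have bn0 : b != 0 by rewrite gt_eqF.
have dF (u : 'I_N -> R) c t : (F u + c%:P)^`().[t] = n%:R * (P u).[t].
  by rewrite derivD derivC addr0 horner_deriv_Fpoly.
move=> sc.
have rt : (P x').[b / a * x i0] = 0.
  have := congr1 (fun q : {poly R} => q^`().[x i0]) sc.
  rewrite /= dF derivZ deriv_comp derivZ derivX alg_polyC hornerZ hornerM.
  rewrite horner_comp hornerZ hornerX dF hornerC.
  rewrite critpoly_horner (bigD1 i0) //= subrr mul0r mulr0 => /eqP.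
  rewrite eq_sym mulf_eq0 expf_eq0 /= !mulf_eq0 !invr_eq0.
  by rewrite (negPf an0) (negPf bn0) pnatr_eq0 /= !orbF => /eqP.
have [j jC ej] : exists2 j, j \in C & b / a * x i0 = x' j.
  move/eqP: rt; rewrite critpoly_horner => /prodf_eq0[j jC].
  by rewrite subr_eq0 => /eqP ->; exists j.
(* Scaling takes the critical point [x i0] to one of the other polynomial, and the squares of both
   values are 1; hence [(a / b)^(2n) = 1] with [a / b] positive. *)
have ab1 : a / b = 1.
  have := congr1 (fun q : {poly R} => q.[x i0] ^+ 2) sc.
  rewrite /= hornerZ horner_comp hornerZ hornerX ej exprMn.
  rewrite !hornerD !hornerC hk // hk' // !sqrrN !expr2 !sqr_slope mulr1 -expr2.
  rewrite -exprM => /esym/eqP; rewrite pexpr_eq1 ?muln_gt0 //; last first.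
    by rewrite divr_ge0 // ltW.
  by move/eqP.
have ab : b / a = 1 by rewrite -[b / a]invrK invf_div ab1 invr1.
have eP : P x = P x'.
  have /(congr1 (@deriv R)) := sc.
  rewrite ab1 ab expr1n !scale1r comp_polyXr !derivD !derivC !addr0 !deriv_Fpoly.
  by apply: scalerI; rewrite pnatr_eq0.
have eC := critpoly_inj hx hx' eP.
apply: (eq_crit_eq hx hx' eC) => i.
have := ev i i0; rewrite (eC _ iC) /Fpoly eP => h.
by apply: (addIr (- (F x').[x' i0])); rewrite /Fpoly.
Qed.

End Chebyshev.

(** * Polynomials with prescribed values at the slots *)

Section Finite.
Variables (R : realFieldType) (I : finType).

Lemma fin_lower_bound (P : pred I) (f : I -> R) : (forall i, P i -> 0 < f i) ->
  exists r : R, [/\ 0 < r, r <= 1 & forall i, P i -> r <= f i].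
Proof.
move=> f0; exists (\big[Num.min/1]_(i | P i) f i); split.
- by elim/big_ind: _ => // a b a0 b0; rewrite lt_min a0.
- by elim/big_rec: _ => // i a _ a1; rewrite ge_min a1 orbT.
- by move=> i Pi; rewrite (bigD1 i) //= ge_min lexx.
Qed.

Lemma fin_upper_bound (f : I -> R) :
  exists B : R, 0 < B /\ forall i, f i <= B.
Proof.
exists (1 + \sum_i `|f i|); split.
  by rewrite ltr_wpDr // sumr_ge0.
move=> i; rewrite (bigD1 i) //=; apply: le_trans (ler_norm _) _.
by rewrite addrCA lerDl addr_ge0 // sumr_ge0.
Qed.

End Finite.

(** * First-order perturbation of slots and values *)

Section Perturb.
Variables (R : rcfType) (N : nat) (C : {set 'I_N}).
Implicit Types x y w : 'I_N -> R.
Local Notation F := (Fpoly C).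
Local Notation P := (critpoly C).
Local Notation n := #|C|.+1.

Lemma increasing_gap x : increasing x ->
  exists r : R, [/\ 0 < r, r <= 1 & forall i j, i != j -> r <= `|x i - x j|].
Proof.
move=> hx.
have [|r [r0 r1 hr]] := @fin_lower_bound R _ [pred p : 'I_N * 'I_N | p.1 != p.2]
    (fun p => `|x p.1 - x p.2|).
  move=> [i j] /= ij; rewrite normr_gt0 subr_eq0.
  case: (ltngtP i j) => [/hx/lt_eqF -> //|/hx/gt_eqF -> //|/val_inj e].
  by rewrite e eqxx in ij.
by exists r; split => // i j ij; apply: (hr (i, j)).
Qed.

Lemma small_sum_sign (a b c d : R) : `|b| < `|a| -> `|d| < `|c| -> a * c < 0 ->
  (a + b) * (c + d) <= 0.
Proof.
rewrite !ltr_norml => /andP[b1 b2] /andP[d1 d2] ac.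
case: (ltgtP 0 a) ac b1 b2 => [a0|a0|<-]; last by rewrite mul0r ltxx.
- rewrite pmulr_rlt0 // gtr0_norm // => c0 *; rewrite ltr0_norm // in d1 d2.
  by apply: mulr_ge0_le0; lra.
- rewrite nmulr_rlt0 // ltr0_norm // => c0 *; rewrite gtr0_norm // in d1 d2.
  by apply: mulr_le0_ge0; lra.
Qed.

(** At distance [h = k e] from a root, [P x] exceeds [q] in absolute value, so [P x + q] changes
    sign between [x i - h] and [x i + h]. As [h] is at most a third of the least gap, these
    intervals are disjoint, and all roots have been found. *)
Lemma critpoly_perturb x : increasing x -> exists B k e0 : R,
  [/\ 0 < B, 0 < k, 0 < e0 & forall (q : {poly R}) (e : R), (size q <= #|C|)%N ->
   0 < e -> e <= e0 -> (forall t : R, `|t| <= B -> `|q.[t]| <= e) ->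
   exists2 x', {in C, forall i, `|x' i - x i| <= k * e} &
     P x + q = P x'].
Proof.
move=> hx; have [g [g0 g1 hg]] := increasing_gap hx.
have [B [B0 hB]] := fin_upper_bound (fun i => `|x i| + 1).
pose rho := g / 3; have rho0 : 0 < rho by rewrite divr_gt0.
have rho1 : rho <= 1 by rewrite /rho; lra.
have hrho i j : i != j -> 3 * rho <= `|x i - x j|.
  by move=> /hg; rewrite /rho; lra.
(* Chosen so that [h rho^(#|C| - 1) = 2 e]: for [h <= rho] the other roots stay at distance at least
   [rho] from a point at distance [h] from [x i]. *)
pose k := 2 / rho ^+ #|C|.-1.
have k0 : 0 < k by rewrite divr_gt0 // exprn_gt0.
exists B, k, (rho / k); split => //; first by rewrite divr_gt0.
move=> q e sq e0 ee hq.
pose h := k * e; have h0 : 0 < h by rewrite mulr_gt0.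
have hle : h <= rho by rewrite /h mulrC -ler_pdivlMr.
have hB' i t : `|t - x i| <= h -> `|q.[t]| <= e.
  move=> ht; apply: hq; apply: le_trans (hB i).
  rewrite -[t](subrK (x i)) addrC; apply: le_trans (ler_normD _ _) _.
  by rewrite lerD2l; lra.
have Pbig i t : i \in C -> `|t - x i| = h -> e < `|(P x).[t]|.
  move=> iC ht; rewrite critpoly_horner (bigD1 i) //= normrM ht normr_prod.
  have : rho ^+ #|C|.-1 <= \prod_(j in C | j != i) `|t - x j|.
    rewrite (cardD1 i) iC add1n /= -prodr_const.
    rewrite [leLHS](eq_bigl (fun j => (j \in C) && (j != i))); last first.
      by move=> j; rewrite !inE andbC.
    apply: ler_prod => j /andP[_ ji]; rewrite ltW //=.
    have := hrho _ _ ji; have : `|x j - x i| <= `|t - x j| + `|t - x i|.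
      by rewrite (distrC t (x j)) -{1}[x j](subrK t) -addrA ler_normD.
    by rewrite ht; lra.
  move=> /(ler_wpM2l (ltW h0)) le1; apply: lt_le_trans le1.
  rewrite /h /k; have -> : 2 / rho ^+ #|C|.-1 * e * rho ^+ #|C|.-1 = 2 * e.
    by field; rewrite expf_neq0 // gt_eqF.
  by lra.
have /(all_sig2_cond (0 : R)) [x' hx' rx'] : forall i, i \in C ->
    {z | (x i - h <= z <= x i + h) & root (P x + q) z}.
  move=> i iC.
  have [||z] := @polyrcf.poly_ivt _ (P x + q) (x i - h) (x i + h).
  - by lra.
  - have n1 : `|x i - h - x i| = h.
      by rewrite addrAC subrr sub0r normrN gtr0_norm.
    have n2 : `|x i + h - x i| = h by rewrite addrAC subrr add0r gtr0_norm.
    rewrite !hornerD; apply: small_sum_sign.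
    + by apply: le_lt_trans (Pbig i _ iC n1); apply: (hB' i); rewrite n1.
    + by apply: le_lt_trans (Pbig i _ iC n2); apply: (hB' i); rewrite n2.
    rewrite !critpoly_horner -big_split /= (bigD1 i) //=.
    rewrite pmulr_llt0; first by rewrite nmulr_rlt0; lra.
    apply: prodr_gt0 => j /andP[_ ji].
    have -> : (x i - h - x j) * (x i + h - x j) = (x i - x j) ^+ 2 - h ^+ 2.
      by ring.
    rewrite subr_gt0 -[X in _ < X]real_normK ?num_real //.
    rewrite ltr_pXn2r ?nnegrE ?normr_ge0 ?(ltW h0) //.
    by have := hrho i j; rewrite eq_sym => /(_ ji); lra.
  - by rewrite in_itv /= => hz rz; exists z.
have near i : i \in C -> `|x' i - x i| <= h.
  by move=> /hx' /andP[h1 h2]; rewrite ler_norml; apply/andP; split; lra.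
exists x' => //.
have sz : size (P x + q) = n by rewrite size_polyDl size_critpoly ?ltnS.
rewrite (@all_roots_prod_XsubC _ (P x + q) [seq x' i | i <- enum C]).
- rewrite /lead_coef sz /= coefD critpoly_lead [q`_ _]nth_default // addr0.
  by rewrite scale1r big_map big_enum.
- by rewrite sz size_map -cardE.
- by apply/allP => _ /mapP[i + ->]; rewrite mem_enum => /rx'.
rewrite uniq_rootsE map_inj_in_uniq ?enum_uniq // => i j.
rewrite !mem_enum => iC jC exx; apply/eqP; apply: contraT => /hrho.
have : `|x i - x j| <= `|x' i - x i| + `|x' j - x j|.
  rewrite (distrC (x' i)) -{1}[x i](subrK (x' i)) -addrA exx ler_normD //.
by have := near _ iC; have := near _ jC; lra.
Qed.

Lemma interpolation x (z : 'I_N -> R) : increasing x ->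
  exists2 p : {poly R}, (size p <= #|C|)%N & {in C, forall i, p.[x i] = z i}.
Proof.
move=> hx.
have nz i j : i != j -> x i - x j != 0.
  move=> ij; rewrite subr_eq0.
  case: (ltngtP i j) => [/hx/lt_eqF -> //|/hx/gt_eqF -> //|/val_inj e].
  by rewrite e eqxx in ij.
pose L i := \prod_(j in C :\ i) ('X - (x j)%:P).
exists (\sum_(i in C) (z i / (L i).[x i]) *: L i).
  apply: leq_trans (size_sum _ _ _) _; apply/bigmax_leqP => i iC.
  apply: leq_trans (size_scale_leq _ _) _.
  by rewrite /L -big_enum size_prod_XsubC /= -cardE [#|C|](cardsD1 i) iC.
move=> i iC; rewrite horner_sum (bigD1 i) //= hornerZ divfK; last first.
  rewrite /L horner_prod; apply/prodf_neq0 => j; rewrite !inE => /andP[ji _].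
  by rewrite hornerXsubC nz // eq_sym.
rewrite big1 ?addr0 // => j /andP[jC ji].
rewrite hornerZ [X in _ * X]horner_prod [X in _ * X](bigD1 i) /=.
  by rewrite hornerXsubC subrr mul0r mulr0.
by rewrite !inE eq_sym ji.
Qed.

Lemma poly_taylor1 (p : {poly R}) (B : R) : exists K : R, 0 < K /\
  forall u v : R, `|u| <= B -> `|v| <= B ->
    `|p.[v] - p.[u]| <= K * `|v - u| /\
    `|p.[v] - p.[u] - p^`().[u] * (v - u)| <= K * (v - u) ^+ 2.
Proof.
have [k1 k11 h1] := poly_lipshitz p (- B) B.
have [k2 k21 h2] := poly_lipshitz p^`() (- B) B.
have inB (u : R) : `|u| <= B -> u \in `[- B, B] by rewrite in_itv /= ler_norml.
have sq (u v : R) : (v - u) ^+ 2 = `|v - u| * `|v - u|.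
  by rewrite -expr2 real_normK ?num_real.
exists (k1 + k2); split; first lra.
move=> u v uB vB; split.
  apply: le_trans (h1 _ _ (inB _ uB) (inB _ vB)) _.
  by apply: ler_wpM2r => //; lra.
have [->|/eqP nuv] := eqVneq u v.
  by rewrite !subrr mulr0 subrr normr0 expr0n mulr0.
have [c hc ->] : exists2 c, `|c - u| <= `|v - u| /\ `|c| <= B &
    p.[v] - p.[u] = p^`().[c] * (v - u).
  case: (ltgtP u v) nuv => // lt _.
    have [c + e] := poly_mvt p lt; rewrite in_itv /= => /andP[h3 h4].
    exists c => //; split; first by rewrite !ger0_norm; lra.
    by move: uB vB; rewrite !ler_norml => /andP[? ?] /andP[? ?]; lra.
  have [c + e] := poly_mvt p lt; rewrite in_itv /= => /andP[h3 h4].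
  exists c; last by rewrite -[p.[v] - _]opprB e; ring.
  split; first by rewrite !ler0_norm; lra.
  by move: uB vB; rewrite !ler_norml => /andP[? ?] /andP[? ?]; lra.
rewrite -mulrBl normrM sq mulrA ler_wpM2r //.
apply: le_trans (h2 _ _ (inB _ uB) (inB _ hc.2)) _.
apply: le_trans (_ : k2 * `|v - u| <= _); last by apply: ler_wpM2r => //; lra.
by apply: ler_wpM2l; [lra|exact: hc.1].
Qed.

(* Add [e p] to the polynomial, with [p] interpolating the prescribed response
   at the critical slots, and move the other slots by hand. *)
Lemma first_order x (z : 'I_N -> R) : increasing x -> (0 < #|C|)%N ->
  exists K e0 : R, [/\ 0 < K, 0 < e0 & forall e : R, 0 < e -> e <= e0 ->
    exists x', [/\ increasing x', \sum_(i in C) x' i = \sum_(i in C) x i,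
      forall i, `|x' i - x i| <= K * e &
      forall i j, `|(F x').[x' i] - (F x').[x' j]
        - ((F x).[x i] - (F x).[x j] + e * (z i - z j))| <= K * e ^+ 2]].
Proof.
move=> hx C0.
have [p sp hp] := interpolation z hx.
have [B [k [e1 [B0 k0 e10 hpert]]]] := critpoly_perturb hx.
have [g [g0 g1 hg]] := increasing_gap hx.
have [L [L0 hL]] : exists L : R, 0 < L /\ forall t : R, `|t| <= B -> `|p^`().[t]| <= L.
  exists (poly_bound p^`() 0 B); split; first exact: poly_bound_gt0.
  by move=> t tB; apply: poly_boundP; rewrite subr0.
have [X [X0 hX]] := fin_upper_bound (fun i => `|x i|).
(* The displacement that gives a boundary slot the response [z i] to first order, from
   [F' s + p = z]. On [C] the derivative is 0 and [p] already interpolates [z]. *)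
pose s i := (z i - p.[x i]) / (F x)^`().[x i].
have [S [S0 hS]] := fin_upper_bound (fun i => `|s i|).
have [K1 [K10 hK1]] := poly_taylor1 (F x) (X + 1).
have [K2 [K20 hK2]] := poly_taylor1 p (X + 1).
have n0 : 0 < n%:R :> R by rewrite ltr0n.
pose D := k * L + S; have D0 : 0 < D by rewrite addr_gt0 // mulr_gt0.
pose E := K1 * D ^+ 2 + K2 * D.
have E0 : 0 < E by rewrite addr_gt0 // mulr_gt0 // exprn_gt0.
exists (D + 2 * E), (Num.min (e1 / L) (g / (3 * D))); split.
- by rewrite addr_gt0 // mulr_gt0.
- by rewrite lt_min !divr_gt0 // mulr_gt0.
move=> e e_gt0; rewrite le_min => /andP[ee1 ee2].
have eDg : e * D <= g / 3.
  by move: ee2; rewrite ler_pdivlMr ?mulr_gt0 // => ?; lra.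
have [||||xc hxc ePc] := hpert ((e / n%:R) *: p^`()) (e * L).
- apply: leq_trans (size_scale_leq _ _) _.
  by rewrite size_deriv; apply: leq_trans (leq_pred _) sp.
- by rewrite mulr_gt0.
- by rewrite -ler_pdivlMr.
- move=> t tB; rewrite hornerZ normrM normrM gtr0_norm //.
  rewrite -mulrA ler_pM2l // ger0_norm ?invr_ge0 ?ler0n // mulrC.
  apply: le_trans (hL _ tB); rewrite ler_pdivrMr // ler_peMr //.
  by rewrite ler1n.
pose x' i := if i \in C then xc i else x i + e * s i.
have dx i : `|x' i - x i| <= D * e.
  rewrite /x' /D; case: ifP => iC.
    apply: le_trans (hxc _ iC) _; rewrite mulrDl mulrCA mulrC lerDl.
    by rewrite mulr_ge0 // ltW.
  rewrite addrAC subrr add0r normrM gtr0_norm // mulrC ler_wpM2r ?ltW //.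
  by apply: le_lt_trans (hS i) _; rewrite ltrDr mulr_gt0.
have ePx' : P x' = P x + (e / n%:R) *: p^`().
  by rewrite ePc; apply: critpoly_eq => i iC; rewrite /x' iC.
have eF : F x' = F x + e *: p - (e * p`_0)%:P.
  apply: deriv_inj_coef0.
    rewrite derivB derivC subr0 derivD !deriv_Fpoly derivZ ePx' scalerDr scalerA.
    by rewrite mulrCA divff ?mulr1 // gt_eqF.
  by rewrite coefB coefC /= coefD [(e *: p)`_0]coefZ !Fpoly_coef0 add0r subrr.
have le1 : e * D <= 1 by lra.
have x'B i : `|x' i| <= X + 1.
  have -> : x' i = x i + (x' i - x i) by ring.
  apply: le_trans (ler_normD _ _) _; apply: lerD (hX i) _.
  by apply: le_trans (dx i) _; rewrite mulrC.
have xB i : `|x i| <= X + 1 by apply: le_trans (hX i) _; lra.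
pose err i := (F x').[x' i] - ((F x).[x i] + e * z i - e * p`_0).
have herr i : `|err i| <= E * e ^+ 2.
  have [_ t1] := hK1 _ _ (xB i) (x'B i).
  have [t2 _] := hK2 _ _ (xB i) (x'B i).
  have lin : (F x)^`().[x i] * (x' i - x i) = e * (z i - p.[x i]).
    rewrite /x'; case: ifP => iC.
      rewrite horner_deriv_Fpoly critpoly_horner (bigD1 i) //= subrr mul0r mulr0.
      by rewrite mul0r hp // subrr mulr0.
    rewrite addrAC subrr add0r mulrCA /s; congr (e * _); rewrite mulrCA mulfV ?mulr1 //.
    rewrite horner_deriv_Fpoly mulf_neq0 ?pnatr_eq0 // critpoly_horner.
    apply/prodf_neq0 => j jC; rewrite subr_eq0.
    case: (ltngtP i j) => [/hx/lt_eqF -> //|/hx/gt_eqF -> //|/val_inj ee].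
    by rewrite ee jC in iC.
  have -> : err i = ((F x).[x' i] - (F x).[x i] - (F x)^`().[x i] * (x' i - x i))
      + e * (p.[x' i] - p.[x i]).
    by rewrite lin /err eF !hornerD hornerN hornerC [(e *: p).[_]]hornerZ; ring.
  apply: le_trans (ler_normD _ _) _; rewrite mulrDl; apply: lerD.
    apply: le_trans t1 _; rewrite -mulrA ler_pM2l // -exprMn.
    rewrite -[leLHS]real_normK ?num_real // ler_pXn2r ?nnegrE //.
    by rewrite mulr_ge0 ?ltW.
  rewrite normrM gtr0_norm // expr2 mulrA [leRHS]mulrC ler_pM2l // -mulrA.
  by apply: le_trans t2 _; rewrite ler_pM2l.
exists x'; split.
- move=> i j ij; have := hg i j; rewrite neq_ltn ij => /(_ isT).
  rewrite ltr0_norm ?subr_lt0 ?hx // => h3.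
  have := dx i; have := dx j; rewrite !ler_norml => /andP[? ?] /andP[? ?]; lra.
(* The degree of [p'] is below [#|C| - 1], so the sum of the critical points does not change. *)
- apply: oppr_inj; rewrite -!critpoly_sublead // ePx' coefD coefZ [p^`()`_ _]nth_default ?mulr0 ?addr0 //.
  by rewrite size_deriv -!subn1 leq_sub2r.
- move=> i; apply: le_trans (dx i) _; rewrite ler_pM2r // lerDl.
  by rewrite mulr_ge0 // ltW.
move=> i j.
have -> : (F x').[x' i] - (F x').[x' j]
    - ((F x).[x i] - (F x).[x j] + e * (z i - z j)) = err i - err j.
  by rewrite /err; ring.
apply: le_trans (ler_normB _ _) _.
have e20 : 0 <= e ^+ 2 by rewrite sqr_ge0.
have := mulr_ge0 (ltW D0) e20; have := herr i; have := herr j; lra.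
Qed.

End Perturb.

Import numFieldNormedType.Exports.
Local Open Scope classical_set_scope.
Local Open Scope ring_scope.

(** * Compactness and continuity of the slot values *)

Section Topology.
Variable R : realType.

Section Combinators.
Variables (T : topologicalType) (f g : T -> R).
Hypotheses (cf : continuous f) (cg : continuous g).

Lemma continuous_subr : continuous (fun x => f x - g x).
Proof. by move=> x; apply: cvgB; [exact: cf|exact: cg]. Qed.

Lemma continuous_mulr : continuous (fun x => f x * g x).
Proof. by move=> x; apply: cvgM; [exact: cf|exact: cg]. Qed.

Lemma continuous_exprn k : continuous (fun x => f x ^+ k).
Proof.
move=> x; apply: (@continuous_comp _ _ _ f (fun t : R => t ^+ k)); first exact: cf.
exact: exprn_continuous.
Qed.

End Combinators.

Lemma continuous_sum (T : topologicalType) (I : Type) (r : seq I) (P : pred I)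
    (f : I -> T -> R) : (forall i, continuous (f i)) ->
  continuous (fun x => \sum_(i <- r | P i) f i x).
Proof.
move=> hf; elim: r => [|i r ih] x.
  by under eq_fun do rewrite big_nil; exact: cvg_cst.
under eq_fun do rewrite big_cons; case: (P i); last exact: ih.
by apply: cvgD; [exact: hf|exact: ih].
Qed.

Lemma compact_separation (T : topologicalType) (I : finType) (A : set T)
    (a : I -> T -> R) (w : I -> R) : compact A -> (forall i, continuous (a i)) ->
  (forall x, A x -> exists i, a i x != w i) ->
  exists2 mu, 0 < mu & forall x, A x -> mu <= \sum_i (a i x - w i) ^+ 2.
Proof.
move=> cA ca hA.
have [A0|/set0P/negP/negPn/eqP A0] := pselect (A !=set0); last first.
  by exists 1 => // x; rewrite A0.
have [|c] := compact_EVT_min (f := fun x => \sum_i (a i x - w i) ^+ 2) A0 cA.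
  apply: continuous_subspaceT; apply: continuous_sum => i x.
  under eq_fun do rewrite expr2.
  by apply: cvgM; apply: cvgB => //; [exact: ca|exact: cvg_cst|exact: ca|exact: cvg_cst].
rewrite inE => Ac hc; exists (\sum_i (a i c - w i) ^+ 2); last first.
  by move=> x Ax; apply: hc; rewrite inE.
have [i hi] := hA _ Ac; rewrite (bigD1 i) //= ltr_wpDr //.
  by apply: sumr_ge0 => j _; exact: sqr_ge0.
by rewrite exprn_even_gt0 //= subr_eq0.
Qed.

(** The squared distance to [w] has a positive lower bound on the compact set, so avoiding [w] is
    stable under small changes of [w]. *)
Lemma compact_avoid (T : topologicalType) (I : finType) (A : set T)
    (a : I -> T -> R) (w : I -> R) : compact A -> (forall i, continuous (a i)) ->
  (forall x, A x -> exists i, a i x != w i) ->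
  exists2 d : R, 0 < d & forall w', (forall i, `|w' i - w i| < d) ->
    forall x, A x -> exists i, a i x != w' i.
Proof.
move=> cA ca hA; have [mu mu0 hmu] := compact_separation cA ca hA.
(* As [d <= 1], the square of a number below [d] is at most [d]; a point with values [w'] would be
   at squared distance at most [#|I| d < mu]. *)
pose d := Num.min 1 (mu / (#|I|%:R + 1)).
have d0 : 0 < d by rewrite lt_min ltr01 divr_gt0 // ltr_wpDl.
exists d => // w' hw x Ax; apply: contrapT => /forallNP hx.
have e i : a i x = w' i by apply/eqP/negPn/negP/hx.
have := hmu _ Ax; rewrite leNgt => /negP; apply.
have [d1 d2] : d <= 1 /\ d * (#|I|%:R + 1) <= mu.
  by rewrite -ler_pdivlMr ?ltr_wpDl // !ge_min !lexx orbT.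
apply: lt_le_trans d2; apply: (@le_lt_trans _ _ (\sum_(i : I) d)); last first.
  by rewrite sumr_const -[X in X < _]mulr_natr ltr_pM2l // ltrDl.
apply: ler_sum => i _; rewrite e -[X in X <= _]real_normK ?num_real // expr2.
have h1 := hw i; apply: le_trans (ltW h1); rewrite ler_piMr //; lra.
Qed.

Variables (N : nat) (C : {set 'I_N}).
Local Notation F := (Fpoly C).
Local Notation P := (critpoly C).
Local Notation n := #|C|.+1.
Implicit Types x y : 'rV[R]_N.

Definition slotvalue x i := (F (x ord0)).[x ord0 i].

Lemma coef_critpoly_continuous k : continuous (fun x => (P (x ord0))`_k).
Proof.
have -> : (fun x => (P (x ord0))`_k)
    = (fun x => (\prod_(i <- enum C) ('X - (x ord0 i)%:P))`_k).
  by apply/funext => x; rewrite big_enum.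
elim: (enum C) k => [|i s ih] k.
  rewrite (_ : (fun x => _) = fun _ : 'rV[R]_N => (1 : {poly R})`_k).
    exact: (@cst_continuous _ R).
  by apply/funext => y; rewrite big_nil.
rewrite (_ : (fun x => _) = fun y : 'rV[R]_N =>
    (if k == 0%N then 0 else (\prod_(j <- s) ('X - (y ord0 j)%:P))`_k.-1)
     - y ord0 i * (\prod_(j <- s) ('X - (y ord0 j)%:P))`_k); last first.
  by apply/funext => y; rewrite big_cons mulrBl coefB coefXM coefCM.
apply: continuous_subr.
  by case: k => [|k] /=; [exact: (@cst_continuous _ R)|exact: ih].
by apply: continuous_mulr; [exact: coord_continuous|exact: ih].
Qed.

Lemma coef_Fpoly_continuous k : continuous (fun x => (F (x ord0))`_k).
Proof.
rewrite (_ : (fun x => _) = fun x : 'rV[R]_N =>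
    #|C|.+1%:R * ((P (x ord0))`_k.-1 * k%:R^-1)); last first.
  by apply/funext => x; rewrite coefZ coef_antideriv.
apply: continuous_mulr; first exact: (@cst_continuous _ R).
by apply: continuous_mulr; [exact: coef_critpoly_continuous|exact: (@cst_continuous _ R)].
Qed.

Lemma slotvalue_continuous i : continuous (slotvalue ^~ i).
Proof.
rewrite (_ : slotvalue ^~ i = fun x : 'rV[R]_N =>
    \sum_(k < n.+1) (F (x ord0))`_k * x ord0 i ^+ k); last first.
  by apply/funext => x; rewrite /slotvalue horner_coef size_Fpoly.
apply: continuous_sum => k.
apply: continuous_mulr; first exact: coef_Fpoly_continuous.
exact/continuous_exprn/coord_continuous.
Qed.

Lemma slotvalueB_continuous i j :
  continuous (fun x => slotvalue x i - slotvalue x j).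
Proof. by apply: continuous_subr; exact: slotvalue_continuous. Qed.

Definition centered x := \sum_(i in C) x ord0 i = 0.

Lemma closed_centered : closed [set x : 'rV[R]_N | centered x].
Proof.
have -> : [set x : 'rV[R]_N | centered x] = (fun x : 'rV[R]_N => \sum_(i in C) x ord0 i) @^-1` [set 0 : R].
  by [].
apply: preimage_closed; last exact: closed_eq.
by move=> x _; apply: continuous_sum => i; exact: coord_continuous.
Qed.

Lemma closed_coord_le i j (a : R) : closed [set x : 'rV[R]_N | x ord0 i - x ord0 j <= a].
Proof.
apply: (@preimage_closed _ _ (fun x : 'rV[R]_N => x ord0 i - x ord0 j) [set t : R | t <= a]).
  by move=> x _; apply: continuous_subr; exact: coord_continuous.
exact: closed_le.
Qed.

Lemma compact_box (a b : 'I_N -> R) :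
  compact [set x : 'rV[R]_N | forall i, a i <= x ord0 i <= b i].
Proof.
exact: (@rV_compact R N (fun i => `[a i, b i]%classic) (fun i => @segment_compact _ _ _)).
Qed.

(** Bounded differences of values bound the gaps, and then the slots themselves since the mean of
    the critical ones is 0; differences of at least [d] then keep the slots apart. *)
Lemma slot_bounds (d D : R) : (0 < #|C|)%N -> 0 < d -> exists eta B : R,
  0 < eta /\ forall x : 'I_N -> R, increasing x -> \sum_(i in C) x i = 0 ->
  (forall i j : 'I_N, j = i.+1 :> nat ->
    d <= slope R C i * ((F x).[x j] - (F x).[x i]) <= D) ->
  (forall i, `|x i| <= B) /\
  (forall i j : 'I_N, j = i.+1 :> nat -> eta <= x j - x i).
Proof.
(* If a third [g] of a gap exceeds 1, then [g <= n g^n <= D]; so [g <= 1 + |D|] in any case. *)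
move=> C0 d0; pose G := 3 * (1 + `|D|); pose B := 1 + N%:R * G.
have G0 : 0 < G by rewrite mulr_gt0 // ltr_wpDr.
have B0 : 0 < B by rewrite ltr_wpDr // mulr_ge0 // ltW.
have n0 : 0 < n%:R :> R by rewrite ltr0n.
have M0 : 0 < n%:R * (2 * B) ^+ #|C| by rewrite mulr_gt0 // exprn_gt0 // mulr_gt0.
exists (d / (n%:R * (2 * B) ^+ #|C|)), B; split; first by rewrite divr_gt0.
move=> x hx cx hd.
have gap (i j : 'I_N) : j = i.+1 :> nat -> x j - x i <= G.
  move=> eij; have ub := slot_gap_ub C hx eij.
  have /andP[_ h2] := hd _ _ eij.
  set g := (x j - x i) / 3 in ub; suff : g <= 1 + `|D| by rewrite /g /G; lra.
  case: (leP g 1) => g1; first by apply: le_trans g1 _; rewrite lerDl.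
  apply: le_trans (_ : `|D| <= _); last by rewrite lerDr.
  apply: le_trans (ler_norm D); apply: le_trans h2; apply: le_trans ub.
  apply: le_trans (_ : g ^+ n <= _).
    by rewrite exprS ler_peMr ?exprn_ege1 // ltW // (lt_trans ltr01).
  by rewrite ler_peMl ?ler1n // exprn_ge0 // ltW // (lt_trans ltr01).
have dist k : forall i j : 'I_N, j = (i + k)%N :> nat -> x j - x i <= k%:R * G.
  elim: k => [|k ih] i j e.
    by have -> : j = i; [apply: val_inj; rewrite /= e addn0|rewrite subrr mul0r].
  have lt : (i + k < N)%N by have := ltn_ord j; rewrite e addnS => /ltnW.
  have := ih i (Ordinal lt) erefl; have := gap (Ordinal lt) j.
  by rewrite e addnS => /(_ erefl); rewrite -natr1 mulrDl mul1r; lra.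
have distB i j : x j - x i <= N%:R * G.
  case: (leqP i j) => ij.
    apply: le_trans (dist (j - i)%N i j _) _; first by rewrite subnKC.
    rewrite ler_pM2r // ler_nat; apply: leq_trans (leq_subr _ _) (ltnW (ltn_ord j)).
  apply: le_trans (_ : 0 <= _); last by rewrite mulr_ge0 // ltW.
  by rewrite subr_le0 ltW // hx.
have xB i : `|x i| <= B.
  have e : #|C|%:R * x i = \sum_(j in C) (x i - x j).
    by rewrite sumrB cx subr0 sumr_const mulr_natl.
  have C0' : 0 < #|C|%:R :> R by rewrite ltr0n.
  rewrite -(ler_pM2l C0') -[X in X * `|_|]gtr0_norm // -normrM e.
  apply: le_trans (ler_norm_sum _ _ _) _.
  rewrite mulr_natl -sumr_const; apply: ler_sum => j _.
  have := distB i j; have := distB j i; rewrite ler_norml /B => ? ?.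
  by apply/andP; split; lra.
split => // i j eij; have lb := slot_gap_lb C hx eij xB.
have /andP[h1 _] := hd _ _ eij.
by rewrite ler_pdivrMr // mulrC; apply: le_trans lb.
Qed.

End Topology.

Lemma increasing_succ (R : rcfType) N (x : 'I_N -> R) :
  (forall i j : 'I_N, j = i.+1 :> nat -> x i < x j) -> increasing x.
Proof.
move=> h i j ij; have [k e] : exists k, j = (i + k.+1)%N :> nat.
  by exists (j - i.+1)%N; rewrite addnS -addSn subnKC.
elim: k j e {ij} => [|k ih] j e; first by apply: h; rewrite e addn1.
have lt : (i + k.+1 < N)%N by have := ltn_ord j; rewrite e addnS => /ltnW.
by apply: lt_trans (ih (Ordinal lt) erefl) (h _ _ _); rewrite e addnS.
Qed.

(** * Openness of the map from slots to values *)

Section OpenMap.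
Variables (R : realType) (N : nat) (C : {set 'I_N}).
Local Notation sv := (@slotvalue R N C).
Implicit Types x y : 'rV[R]_N.

Lemma closed_far x i (r : R) :
  closed [set y : 'rV[R]_N | r <= (y ord0 i - x ord0 i) ^+ 2].
Proof.
apply: (@preimage_closed _ _ (fun y : 'rV[R]_N => (y ord0 i - x ord0 i) ^+ 2)
  [set t : R | r <= t]); last exact: closed_ge.
move=> y _; apply/continuous_exprn/continuous_subr; first exact: coord_continuous.
exact: (@cst_continuous _ R).
Qed.

(* Minimize the distance from the values to [w] over a small ball around [x]:
   by [first_order] the minimum cannot be positive. *)
Lemma open_map x (r : R) : increasing (x ord0) -> centered C x ->
  (0 < #|C|)%N -> 0 < r ->
  exists2 d : R, 0 < d & forall w : 'I_N -> R,
    (forall i j, `|(w i - w j) - (sv x i - sv x j)| < d) ->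
    exists x', [/\ increasing (x' ord0), centered C x',
      (forall i, `|x' ord0 i - x ord0 i| < r) &
      forall i j, sv x' i - sv x' j = w i - w j].
Proof.
move=> hx cx C0 r0; have [i0 i0C] := card_gt0P C0.
have [g [g0 g1 hg]] := increasing_gap hx.
pose rho := Num.min r (g / 4).
have rho0 : 0 < rho by rewrite lt_min r0 divr_gt0.
have [rho_r rho_g] : rho <= r /\ rho <= g / 4 by rewrite !ge_min !lexx orbT.
pose Bl := [set y : 'rV[R]_N | forall i, x ord0 i - rho <= y ord0 i <= x ord0 i + rho]
  `&` [set y | centered C y].
have cBl : compact Bl.
  apply: compact_closedI; first exact: compact_box.
  exact: closed_centered.
have xBl : Bl x by split => // i; apply/andP; split; lra.
have gap (i j : 'I_N) : (i < j)%N -> g <= x ord0 j - x ord0 i.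
  move=> ij; have := hg j i; rewrite neq_ltn ij orbT => /(_ isT).
  by rewrite ger0_norm // subr_ge0 ltW // hx.
have inBl y : Bl y -> increasing (y ord0) /\ interlaced C (y ord0) (x ord0).
  move=> [hy _]; have key (i j : 'I_N) : (i < j)%N ->
      [/\ y ord0 i < y ord0 j, y ord0 i < x ord0 j & x ord0 i < y ord0 j].
    move=> ij; have := gap _ _ ij; have /andP[? ?] := hy i.
    by have /andP[? ?] := hy j; split; lra.
  by split=> [i j /key[]//|i j _ _ /key[]].
pose dv i y := sv y i - sv y i0.
have cdv i : continuous (dv i) by exact: slotvalueB_continuous.
(* Where some coordinate is [rho] away from [x], the differences of values stay away from those of
   [x]: configurations in the small ball are interlaced with [x], so [interlaced_eq] applies. *)
have /choice[mu hmu] : forall k, exists m : R, 0 < m /\ forall y, Bl y ->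
    rho ^+ 2 <= (y ord0 k - x ord0 k) ^+ 2 ->
    m <= \sum_i (dv i y - dv i x) ^+ 2.
  move=> k; have [||y [By fy]|m m0 hm] := @compact_separation R _ _
    (Bl `&` [set y | rho ^+ 2 <= (y ord0 k - x ord0 k) ^+ 2])
    dv (dv ^~ x).
  - by apply: compact_closedI => //; exact: closed_far.
  - exact: cdv.
  - apply: contrapT => /forallNP h.
    have e i : dv i y = dv i x by apply/eqP/negPn/negP/h.
    have [hy il] := inBl _ By.
    have := @interlaced_eq R N C _ _ i0 hy hx il.
    rewrite By.2 cx => /(_ erefl i0C) h2.
    move: fy; rewrite /= h2 ?subrr ?expr0n /=.
      by rewrite leNgt exprn_gt0.
    by move=> i j; have := e i; have := e j; rewrite /dv /slotvalue; lra.
  by exists m; split => // y By fy; apply: hm.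
have [m [m0 _ hm]] := @fin_lower_bound R _ predT mu (fun k _ => (hmu k).1).
(* This makes [4 E x < m], which keeps the minimizer [c] off the boundary: the squared distance
   between the values at [c] and at [x] is at most [2 E c + 2 E x <= 4 E x]. *)
pose d := Num.min 1 (m / (4 * (N%:R + 1))).
have N1 : 0 < 4 * (N%:R + 1) :> R by rewrite mulr_gt0 // ltr_wpDl.
have d0 : 0 < d by rewrite lt_min ltr01 divr_gt0.
have [d1 dm] : d <= 1 /\ d * (4 * (N%:R + 1)) <= m.
  by rewrite -ler_pdivlMr // !ge_min !lexx orbT.
exists d => // w hw.
pose u i y := dv i y - (w i - w i0).
pose E y := \sum_i u i y ^+ 2.
have Ex : 4 * E x < m.
  apply: lt_le_trans dm; rewrite mulrCA ltr_pM2l //.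
  apply: (@le_lt_trans _ _ (\sum_(i < N) d)); last first.
    by rewrite sumr_const card_ord -[X in X < _]mulr_natr ltr_pM2l // ltrDl.
  apply: ler_sum => i _; rewrite -[X in X <= _]real_normK ?num_real // expr2.
  have := hw i i0; rewrite distrC => h1; apply: le_trans (ltW h1).
  by rewrite ler_piMr //; lra.
have cE : continuous E.
  apply: continuous_sum => i; apply/continuous_exprn/continuous_subr => //.
  exact: (@cst_continuous _ R).
have [|c] := compact_EVT_min (ex_intro _ _ xBl) cBl (f := E).
  exact: continuous_subspaceT.
rewrite inE => Bc hc; have {}hc y : Bl y -> E c <= E y by move=> By; apply: hc; rewrite inE.
have near k : `|c ord0 k - x ord0 k| < rho.
  rewrite ltNge; apply/negP => far.
  have : rho ^+ 2 <= (c ord0 k - x ord0 k) ^+ 2.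
    by rewrite -[leRHS]real_normK ?num_real // ler_pXn2r ?nnegrE // ltW.
  move=> /((hmu k).2 _ Bc); have := hm k isT; have := hc _ xBl.
  have : \sum_i (dv i c - dv i x) ^+ 2 <= 2 * E c + 2 * E x.
    rewrite /E !mulr_sumr -big_split /=; apply: ler_sum => i _; rewrite /u.
    set a := dv i c; set b := dv i x; set v := w i - w i0.
    have := sqr_ge0 ((a - v) + (b - v)); lra.
  by lra.
have [hcx _] := inBl _ Bc.
suff E0 : E c = 0.
  have uz i : u i c = 0.
    have := psumr_eq0P _ E0 => h; have /h/(_ i isT)/eqP : forall j : 'I_N, xpredT j -> 0 <= u j c ^+ 2.
      by move=> j _; exact: sqr_ge0.
    by rewrite sqrf_eq0 => /eqP.
  exists c; split => //; first exact: Bc.2.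
    by move=> i; apply: lt_le_trans (near i) rho_r.
  by move=> i j; have := uz i; have := uz j; rewrite /u /dv; lra.
apply/eqP; rewrite eq_le; apply/andP; split; last first.
  by apply: sumr_ge0 => i _; exact: sqr_ge0.
rewrite leNgt; apply/negP => Epos.
(* Moving against the residual [u] turns it into [(1 - e) u] up to [K e^2], and [E] into at most
   [(1 - e)^2 E + e^2 W], which is smaller than [E] as soon as [e (E + W) <= E]. *)
have [K [e0 [K0 e00 hK]]] := first_order (fun i => - u i c) hcx C0.
have [t [t0 _ ht]] := @fin_lower_bound R _ predT
  (fun k => rho - `|c ord0 k - x ord0 k|) (fun k _ => etrans (subr_gt0 _ _) (near k)).
pose W := \sum_i (2 * `|u i c| * K + K ^+ 2).
have W0 : 0 <= W.
  by apply: sumr_ge0 => i _; rewrite addr_ge0 ?sqr_ge0 // !mulr_ge0 // ltW.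
have EW : 0 < E c + W by rewrite ltr_wpDr.
pose e := Num.min (Num.min e0 1) (Num.min (t / K) (E c / (E c + W))).
have e_gt0 : 0 < e by rewrite !lt_min e00 ltr01 !divr_gt0.
have ee0 : e <= e0 by rewrite !ge_min lexx.
have e1 : e <= 1 by rewrite !ge_min lexx orbT.
have et : K * e <= t by rewrite mulrC -ler_pdivlMr // !ge_min lexx !orbT.
have eE : e * (E c + W) <= E c by rewrite -ler_pdivlMr // !ge_min lexx !orbT.
have [x' [hx' sx' nx' vx']] := hK e e_gt0 ee0.
pose y : 'rV[R]_N := \row_i x' i.
have yE : y ord0 =1 x' by move=> i; rewrite mxE.
have yfE : (y ord0 : 'I_N -> R) = x' by apply/funext.
have By : Bl y.
  split; last by rewrite /= /centered yfE sx'; exact: Bc.2.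
  move=> i; rewrite yE; have := ht i isT; have := nx' i => h1 h2.
  have : `|x' i - x ord0 i| <= rho.
    have -> : x' i - x ord0 i = (x' i - c ord0 i) + (c ord0 i - x ord0 i) by ring.
    by apply: le_trans (ler_normD _ _) _; lra.
  by rewrite ler_norml => /andP[? ?]; apply/andP; split; lra.
have := hc _ By; apply/negP; rewrite -ltNge.
have u0 : u i0 c = 0 by rewrite /u /dv !subrr.
have uy i : `|u i y - (1 - e) * u i c| <= K * e ^+ 2.
  have := vx' i i0; rewrite u0 /u /dv /slotvalue yfE => h.
  by apply: le_trans h; rewrite le_eqVlt; apply/orP; left; apply/eqP; congr `|_|; ring.
have e2 : 0 <= e ^+ 2 by exact: sqr_ge0.
apply: (@le_lt_trans _ _ ((1 - e) ^+ 2 * E c + e ^+ 2 * W)); last first.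
  have : e * (e * (E c + W)) <= e * E c by rewrite ler_pM2l.
  have := mulr_gt0 e_gt0 Epos; lra.
rewrite /E /W !mulr_sumr -big_split /=; apply: ler_sum => i _.
set a := u i c; set th := u i y - (1 - e) * a.
have hth : `|th| <= K * e ^+ 2 := uy i.
have -> : u i y ^+ 2 = (1 - e) ^+ 2 * a ^+ 2 + 2 * ((1 - e) * (a * th)) + th ^+ 2.
  by rewrite (_ : u i y = (1 - e) * a + th); [ring|rewrite /th; ring].
have h1 : a * th <= `|a| * (K * e ^+ 2).
  by apply: le_trans (ler_norm _) _; rewrite normrM ler_wpM2l.
have h2 : (1 - e) * (a * th) <= `|a| * (K * e ^+ 2).
  apply: le_trans (_ : (1 - e) * (`|a| * (K * e ^+ 2)) <= _).
    by rewrite ler_wpM2l // subr_ge0.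
  rewrite ler_piMl ?mulr_ge0 // ?ltW //; lra.
have h3 : th ^+ 2 <= K ^+ 2 * e ^+ 2.
  rewrite -[leLHS]real_normK ?num_real //.
  apply: le_trans (_ : (K * e ^+ 2) ^+ 2 <= _).
    by rewrite ler_pXn2r ?nnegrE // mulr_ge0 // ltW.
  rewrite exprMn ler_wpM2l ?sqr_ge0 // expr2 ler_piMl //.
  by rewrite expr_le1 // ltW.
by move: h2 h3; rewrite /a; lra.
Qed.

End OpenMap.

(** * Existence, uniqueness and continuity of the slots with given values *)

Section Inverse.
Variables (R : realType) (N : nat) (C : {set 'I_N}).
Hypothesis C0 : (0 < #|C|)%N.
Local Notation sv := (@slotvalue R N C).
Local Notation slope := (slope R C).
Implicit Types (x y : 'rV[R]_N) (w : 'I_N -> R).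

Definition close w w' (d : R) := forall i, `|w' i - w i| < d.

Definition segment w0 w1 (s : R) i := (1 - s) * w0 i + s * w1 i.

Lemma cone_segment w0 w1 s : cone C w0 -> cone C w1 -> 0 <= s <= 1 ->
  cone C (segment w0 w1 s).
Proof.
move=> h0 h1 /andP[s0 s1] i j e; have {}h0 := h0 _ _ e; have {}h1 := h1 _ _ e.
have -> : slope i * (segment w0 w1 s j - segment w0 w1 s i) =
  (1 - s) * (slope i * (w0 j - w0 i)) + s * (slope i * (w1 j - w1 i)).
  by rewrite /segment; ring.
case: (ltP 0 s) => hs; first by apply: ltr_wpDl; [rewrite mulr_ge0 ?subr_ge0 // ltW|rewrite mulr_gt0].
have -> : s = 0 by apply/eqP; rewrite eq_le s0 hs.
by rewrite subr0 mul1r mul0r addr0.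
Qed.

Lemma segment_close w0 w1 : exists2 M, 0 < M & forall s t i,
  `|segment w0 w1 t i - segment w0 w1 s i| <= M * `|t - s|.
Proof.
have [M [M0 hM]] := fin_upper_bound (fun i => `|w1 i - w0 i|).
exists M => // s t i; have -> : segment w0 w1 t i - segment w0 w1 s i
   = (w1 i - w0 i) * (t - s) by rewrite /segment; ring.
by rewrite normrM ler_wpM2r.
Qed.

Lemma open_ball_union (B : R -> R -> Prop) :
  open [set t : R | exists s d, [/\ B s d, 0 < d & `|t - s| < d]].
Proof.
rewrite openE => t /= [s [d [Bsd d0 ts]]]; rewrite /interior /=.
apply/nbhs_ballP; exists (d - `|t - s|); first by rewrite /= subr_gt0.
move=> t' /=; rewrite /ball /= => tt'; exists s, d; split => //.
have -> : t' - s = (t - s) - (t - t') by ring.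
by apply: le_lt_trans (ler_normB _ _) _; rewrite addrC -ltrBrDr.
Qed.

(** The cone is convex, so the segment from [w0] to [w1] stays in it, and the two hypotheses make
    [Q] clopen on the connected parameter interval. *)
Lemma cone_clopen (Q : ('I_N -> R) -> Prop) :
  (forall w, cone C w -> Q w -> exists2 d, 0 < d &
     forall w', cone C w' -> close w w' d -> Q w') ->
  (forall w, cone C w -> ~ Q w -> exists2 d, 0 < d &
     forall w', cone C w' -> close w w' d -> ~ Q w') ->
  forall w0 w1, cone C w0 -> cone C w1 -> Q w0 -> Q w1.
Proof.
move=> ho hc w0 w1 c0 c1 Q0.
have [M M0 hM] := segment_close w0 w1.
pose sg := segment w0 w1.
have sgc s : `[0, 1]%classic s -> cone C (sg s).
  by rewrite /= in_itv /= => hs; exact: cone_segment.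
have near (G : ('I_N -> R) -> Prop) s d : 0 < d ->
    (forall w', cone C w' -> close (sg s) w' d -> G w') ->
    forall t, `[0, 1]%classic t -> `|t - s| < d / M -> G (sg t).
  move=> d0 h t ht hts; apply: h; first exact: sgc.
  move=> i; apply: le_lt_trans (hM _ _ _) _.
  by rewrite mulrC -ltr_pdivlMr.
pose U (G : ('I_N -> R) -> Prop) : set R := [set t : R | exists s d,
  [/\ (forall t, `[0, 1]%classic t -> `|t - s| < d -> G (sg t)), 0 < d &
   `|t - s| < d]].
have oU G : open (U G) by exact: open_ball_union.
have e1 : [set s | `[0, 1]%classic s /\ Q (sg s)] = `[0, 1]%classic `&` U Q.
  apply/seteqP; split => s /= [s01 h]; split => //.
    have [d d0 hd] := ho _ (sgc _ s01) h.
    exists s, (d / M); split; [exact: near hd|by rewrite divr_gt0|].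
    by rewrite subrr normr0 divr_gt0.
  by have [s' [d [h1 d0 h2]]] := h; apply: h1.
have e2 : [set s | `[0, 1]%classic s /\ Q (sg s)]
   = `[0, 1]%classic `&` ~` U (fun w => ~ Q w).
  apply/seteqP; split => s /= [s01 h]; split => //.
    by move=> [s' [d [h1 d0 h2]]]; apply: h1 h.
  apply: contrapT => nQ; apply: h.
  have [d d0 hd] := hc _ (sgc _ s01) nQ.
  exists s, (d / M); split; [exact: (near _ _ _ d0 hd)|by rewrite divr_gt0|].
  by rewrite subrr normr0 divr_gt0.
have sg0 : sg 0 = w0.
  by apply/funext => i; rewrite /sg /segment subr0 mul1r mul0r addr0.
have sg1 : sg 1 = w1.
  by apply/funext => i; rewrite /sg /segment subrr mul0r mul1r add0r.
have e : [set s | `[0, 1]%classic s /\ Q (sg s)] = `[0, 1]%classic.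
  apply: (@segment_connected R 0 1).
  - by exists 0; split; [rewrite /= in_itv /= lexx ler01|rewrite sg0].
  - by exists (U Q).
  - by exists (~` U (fun w => ~ Q w)) => //; apply: open_closedC.
have : `[0, 1]%classic (1 : R) by rewrite /= in_itv /= lexx ler01.
by rewrite -e => -[_]; rewrite sg1.
Qed.

Definition slotbox (eta B : R) := [set x : 'rV[R]_N |
  [/\ forall i, - B <= x ord0 i <= B, centered C x &
   forall p : 'I_N * 'I_N, p.2 = p.1.+1 :> nat -> eta <= x ord0 p.2 - x ord0 p.1]].

Lemma compact_slotbox eta B : compact (slotbox eta B).
Proof.
have -> : slotbox eta B =
  [set x : 'rV[R]_N | forall i, - B <= x ord0 i <= B] `&`
  ([set x | centered C x] `&`
   \bigcap_(p in [set p : 'I_N * 'I_N | p.2 = p.1.+1 :> nat])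
     [set x : 'rV[R]_N | x ord0 p.1 - x ord0 p.2 <= - eta]).
  apply/seteqP; split => x /= [h1 h2].
    by move=> h3; split=> //; split=> // p /h3 /=; lra.
  by case: h2 => h2 h3; split => // p /h3 /=; lra.
apply: compact_closedI; first exact: compact_box.
apply: closedI; first exact: closed_centered.
by apply: closed_bigI => p _; exact: closed_coord_le.
Qed.

Lemma slotbox_increasing eta B x : 0 < eta -> slotbox eta B x ->
  increasing (x ord0).
Proof.
move=> e0 [_ _ h]; apply: increasing_succ => i j e.
by have := h (i, j) e => /=; lra.
Qed.

Definition solution w x := [/\ increasing (x ord0), centered C x &
  forall i j, sv x i - sv x j = w i - w j].

Lemma solution_cone w x : solution w x -> cone C w.
Proof.
move=> [hx _ h] i j e; rewrite -h; exact: Fpoly_cone.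
Qed.

Lemma solution_bounds w : cone C w -> exists eta B d : R,
  [/\ 0 < eta, 0 < d & forall w' x, close w w' d -> solution w' x ->
    slotbox eta B x].
Proof.
move=> cw.
have [g [g0 _ hg]] := @fin_lower_bound R _ [pred p : 'I_N * 'I_N | p.2 == p.1.+1 :> nat]
  (fun p => slope p.1 * (w p.2 - w p.1)) (fun p hp => cw _ _ (eqP hp)).
have [G [G0 hG]] := fin_upper_bound (fun p : 'I_N * 'I_N => slope p.1 * (w p.2 - w p.1)).
have g20 : 0 < g / 2 by rewrite divr_gt0.
have [eta [B [eta0 hb]]] := @slot_bounds R N C (g / 2) (G + g) C0 g20.
(* Moving the target by less than [g / 4] changes a consecutive difference by less than [g / 2]. *)
exists eta, B, (g / 4); split => //; first by rewrite divr_gt0.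
move=> w' x hw' [hx cx hs].
have [|h1 h2] := hb _ hx cx; last first.
  split => //; first by move=> i; rewrite -ler_norml.
  by move=> [i j] /= e; apply: h2.
move=> i j e; have := hs j i; rewrite /slotvalue => ->.
have := hg (i, j); rewrite /= e eqxx => /(_ isT) hgij.
have hGij := hG (i, j); rewrite /= in hGij.
have : `|slope i * ((w' j - w j) - (w' i - w i))| < g / 2.
  rewrite normrM normrX normrN1 expr1n mul1r.
  apply: le_lt_trans (ler_normB _ _) _.
  by have := hw' i; have := hw' j; lra.
by rewrite ltr_norml mulrBr !mulrBr in hgij hGij * => /andP[? ?]; apply/andP; split; lra.
Qed.

Lemma exists_crit : exists i, i \in C.
Proof. by have /card_gt0P := C0. Qed.

Lemma avoid_solution (A : set 'rV[R]_N) w : compact A ->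
  (forall x, A x -> ~ (forall i j, sv x i - sv x j = w i - w j)) ->
  exists2 d : R, 0 < d & forall w', close w w' d -> forall x, A x ->
    ~ (forall i j, sv x i - sv x j = w' i - w' j).
Proof.
move=> cA hA; have [i0 _] := exists_crit.
have [||d d0 hd] := @compact_avoid R _ _ A (fun i x => sv x i - sv x i0)
  (fun i => w i - w i0) cA.
- by move=> i; exact: slotvalueB_continuous.
- move=> x Ax; apply: contrapT => /forallNP h; apply: (hA _ Ax) => i j.
  have e k : sv x k - sv x i0 = w k - w i0 by apply/eqP/negPn/negP/h.
  by have := e i; have := e j; lra.
exists (d / 2); first by rewrite divr_gt0.
move=> w' hw' x Ax h.
have [i|i /eqP] := hd (fun i => w' i - w' i0) _ x Ax; last by apply; exact: h.
have -> : w' i - w' i0 - (w i - w i0) = (w' i - w i) - (w' i0 - w i0) by ring.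
apply: le_lt_trans (ler_normB _ _) _.
by have := hw' i; have := hw' i0; lra.
Qed.

Lemma solution_open w x (r : R) : solution w x -> 0 < r ->
  exists2 d, 0 < d & forall w', close w w' d ->
    exists2 x', solution w' x' & forall i, `|x' ord0 i - x ord0 i| < r.
Proof.
move=> [hx cx hs] r0; have [d d0 hd] := open_map hx cx C0 r0.
exists (d / 2); first by rewrite divr_gt0.
move=> w' hw'; have [i j|x' [h1 h2 h3 h4]] := hd w'; last by exists x'.
rewrite hs; have -> : w' i - w' j - (w i - w j) = (w' i - w i) - (w' j - w j) by ring.
apply: le_lt_trans (ler_normB _ _) _.
by have := hw' i; have := hw' j; lra.
Qed.

(* The targets with a solution form a nonempty clopen subset of the cone. *)
Lemma slot_exists w : cone C w -> exists x, solution w x.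
Proof.
move=> cw.
pose c : R := (\sum_(i in C) (i : nat)%:R) / #|C|%:R.
pose x0 : 'rV[R]_N := \row_i ((i : nat)%:R - c).
have i0 : increasing (x0 ord0).
  by move=> i j ij; rewrite !mxE ltrD2r ltr_nat.
have c0 : centered C x0.
  rewrite /centered; under eq_bigr do rewrite mxE.
  rewrite sumrB sumr_const -[X in _ - X]mulr_natr /c divfK ?subrr //.
  by rewrite pnatr_eq0 -lt0n.
apply: (@cone_clopen (fun w => exists x, solution w x) _ _ (sv x0) w) => //.
- move=> v _ [x hx]; have [d d0 hd] := solution_open hx ltr01.
  by exists d => // w' _ /hd[x' hx' _]; exists x'.
(* If [v] has no solution, the compact box that contains all solutions for nearby targets avoids the
   values [v], hence also those nearby targets. *)
- move=> v cv nx; have [eta [B [d [eta0 d0 hb]]]] := solution_bounds cv.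
  have [x [h1 h2 h3] h|d' d'0 hd'] := @avoid_solution (slotbox eta B) v (@compact_slotbox _ _).
    by apply: nx; exists x; split => //; apply: slotbox_increasing eta0 (And3 h1 h2 h3).
  exists (Num.min d d'); first by rewrite lt_min d0.
  move=> w' _ hw' [x hx]; apply: (hd' w' _ x).
  + by move=> i; have := hw' i; rewrite lt_min => /andP[].
  + by apply: hb hx => i; have := hw' i; rewrite lt_min => /andP[].
  + by case: hx.
- exact: Fpoly_cone.
- by exists x0; split.
Qed.

Lemma slope_succ (i j : 'I_N) : j = i.+1 :> nat ->
  slope i = if j \in C then - slope j else slope j.
Proof.
move=> e; rewrite /slope; case: ifP => jC.
  rewrite (_ : [set k in C | (i < k)%N] = j |: [set k in C | (j < k)%N]).
    by rewrite cardsU1 inE ltnn andbF /= add1n exprS mulN1r.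
  apply/setP => k; rewrite !inE -e; case: (eqVneq k j) => [->|kj] /=.
    by rewrite jC leqnn.
  by rewrite (leq_eqVlt j) eq_sym -(inj_eq val_inj) in kj * ; rewrite (negPf kj).
congr (_ ^+ #|pred_of_set _|); apply/setP => k; rewrite !inE -e leq_eqVlt.
case: (eqVneq (j : nat) k) => // jk; rewrite -(val_inj jk) jC //.
Qed.

(* All the critical values are 1 or -1, so that up to scaling and a constant
   only the Chebyshev polynomial of degree #|C|.+1 realizes them. *)
Definition chebyshev_values (i : 'I_N) : R :=
  slope i * (1 - (if i \in C then 2 else i.+1%:R^-1)).

(** On a branch of slope [s] a critical slot at the start has value [-s] and one at the end has
    value [s]; the boundary slots have the values [s (1 - 1/(i + 1))], which lie strictly between
    and are monotone in [i]. *)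
Lemma chebyshev_values_cone : cone C chebyshev_values.
Proof.
move=> i j e; rewrite /chebyshev_values (slope_succ e).
have h (k : nat) : 0 < k.+1%:R^-1 :> R by rewrite invr_gt0 ltr0n.
have h1 (k : nat) : k.+1%:R^-1 <= 1 :> R by rewrite invf_le1 ?ler1n ?ltr0n.
have := sqr_slope R C j; move: (slope j) => s ss.
have e0 : 0 < (if i \in C then 2 else i.+1%:R^-1 : R) by case: ifP.
case: ifP => jC; last first.
  have -> (a b : R) : s * (s * (1 - a) - s * (1 - b)) = s * s * (b - a) by ring.
  rewrite ss mul1r subr_gt0; case: ifP => iC.
    by apply: le_lt_trans (h1 j) _; rewrite ltr1n.
  by rewrite ltf_pV2 ?posrE ?ltr0n // ltr_nat e.
have -> (a : R) : - s * (s * (1 - 2) - - s * (1 - a)) = s * s * a by ring.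
by rewrite ss mul1r.
Qed.

Lemma not_interlaced_pair (x y : 'I_N -> R) : ~ interlaced C x y ->
  exists p : 'I_N * 'I_N, [/\ p.1 \in C, p.2 \in C, (p.1 < p.2)%N &
    x p.2 <= y p.1 \/ y p.2 <= x p.1].
Proof.
move=> h; apply: contrapT => /forallNP hp; apply: h => i j iC jC ij.
have := hp (i, j) => /= h; split; rewrite ltNge; apply/negP => ?; apply: h; split => //.
  by right.
by left.
Qed.

(* The targets with two solutions form a clopen subset of the cone, because
   nearby solutions are interlaced, hence equal; the Chebyshev target is not
   among them. *)
Lemma slot_unique w x y : solution w x -> solution w y -> x = y.
Proof.
pose Q w := exists x y, [/\ solution w x, solution w y & x != y].
suff nQ : ~ Q w.
  by move=> hx hy; apply/eqP; apply: contrapT => /negP xy; apply: nQ; exists x, y.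
move=> Qw; have cw : cone C w by case: Qw => a [b [ha _ _]]; exact: solution_cone ha.
have [i0 iC] := exists_crit.
have : Q chebyshev_values; last first.
  move=> [a [b [[ha ca sa] [hb cb sb] ab]]]; apply/negP: ab; rewrite negbK; apply/eqP.
  apply/rowP; apply: (chebyshev_unique ha hb iC ca cb) => [i j|i j iC' jC].
    by have := sa i j; have := sb i j; rewrite /slotvalue => -> ->.
  have := sa i j; rewrite /slotvalue => ->.
  by rewrite /chebyshev_values iC' jC; ring.
apply: (@cone_clopen Q _ _ w) => // [v cv [a [b [ha hb ab]]]|v cv nQ|].
- have [k hk] : exists k, a ord0 k != b ord0 k.
    apply: contrapT => /forallNP h; move/negP: ab; apply; apply/eqP/rowP => k.
    by apply/eqP/negPn/negP/h.
  (* With this radius the perturbed solutions still differ in coordinate [k]. *)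
  have r0 : 0 < `|a ord0 k - b ord0 k| / 2 by rewrite divr_gt0 // normr_gt0 subr_eq0.
  have [d1 d10 h1] := solution_open ha r0.
  have [d2 d20 h2] := solution_open hb r0.
  exists (Num.min d1 d2); first by rewrite lt_min d10.
  move=> w' _ hw'.
  have [|a' ha' na] := h1 w'; first by move=> i; have := hw' i; rewrite lt_min => /andP[].
  have [|b' hb' nb] := h2 w'; first by move=> i; have := hw' i; rewrite lt_min => /andP[].
  exists a', b'; split => //; apply/eqP => e.
  have := na k; have := nb k; rewrite e => ? ?.
  have : `|a ord0 k - b ord0 k| <= `|b' ord0 k - b ord0 k| + `|b' ord0 k - a ord0 k|.
    have -> : a ord0 k - b ord0 k = (b' ord0 k - b ord0 k) - (b' ord0 k - a ord0 k) by ring.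
    exact: ler_normB.
  by lra.
- have [eta [B [d [eta0 d0 hb]]]] := solution_bounds cv.
  have nint a b : solution v a -> solution v b -> interlaced C (a ord0) (b ord0).
    move=> ha hb'; have -> : b = a.
      apply/eqP; apply: contrapT => /negP ab; apply: nQ; exists b, a; split => //.
    by case: ha => ha _ _ i j _ _ ij; split; exact: ha.
  (* The pairs of configurations in the box that violate the interlacing at [p]. No pair of
     solutions for [v] is among them, as [v] has at most one solution, and by compactness this
     persists for nearby targets. *)
  pose A (p : 'I_N * 'I_N) := (slotbox eta B `*` slotbox eta B) `&`
    [set q : 'rV[R]_N * 'rV[R]_N | q.1 ord0 p.2 - q.2 ord0 p.1 <= 0].
  have cA p : compact (A p).
    apply: compact_closedI; first by apply: compact_setX; exact: compact_slotbox.
    apply: (@preimage_closed _ _ (fun q : 'rV[R]_N * 'rV[R]_N => q.1 ord0 p.2 - q.2 ord0 p.1)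
      [set t : R | t <= 0]); last exact: closed_le.
    move=> q _; apply: continuous_subr => {}q.
      apply: (@continuous_comp _ _ _ (fun q : 'rV[R]_N * 'rV[R]_N => q.1)
        (fun z : 'rV[R]_N => z ord0 p.2)); first exact: cvg_fst.
      exact: coord_continuous.
    apply: (@continuous_comp _ _ _ (fun q : 'rV[R]_N * 'rV[R]_N => q.2)
      (fun z : 'rV[R]_N => z ord0 p.1)); first exact: cvg_snd.
    exact: coord_continuous.
  pose a (k : 'I_N + 'I_N) (q : 'rV[R]_N * 'rV[R]_N) :=
    match k with inl k => sv q.1 k - sv q.1 i0 | inr k => sv q.2 k - sv q.2 i0 end.
  pose tg (w : 'I_N -> R) (k : 'I_N + 'I_N) :=
    match k with inl k => w k - w i0 | inr k => w k - w i0 end.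
  have ca k : continuous (a k).
    case: k => k q.
      apply: (@continuous_comp _ _ _ (fun q : 'rV[R]_N * 'rV[R]_N => q.1)
        (fun z : 'rV[R]_N => sv z k - sv z i0)); first exact: cvg_fst.
      exact: slotvalueB_continuous.
    apply: (@continuous_comp _ _ _ (fun q : 'rV[R]_N * 'rV[R]_N => q.2)
      (fun z : 'rV[R]_N => sv z k - sv z i0)); first exact: cvg_snd.
    exact: slotvalueB_continuous.
  have /choice[dl hdl] : forall p : 'I_N * 'I_N, exists d : R, 0 < d /\
      (p.1 \in C -> p.2 \in C -> (p.1 < p.2)%N ->
       forall w', close v w' d -> forall q, A p q ->
       exists k, a k q != tg w' k).
    move=> p; case: (boolP [&& p.1 \in C, p.2 \in C & (p.1 < p.2)%N]); last first.
      by move=> h; exists 1; split => // h1 h2 h3; rewrite h1 h2 h3 in h.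
    move=> /and3P[p1 p2 p12].
    have [q [[bx1 bx2] le]|dd dd0 hdd] := @compact_avoid R _ _ (A p) a (tg v) (cA p) ca.
      apply: contrapT => /forallNP h.
      have e k : a k q = tg v k by apply/eqP/negPn/negP/h.
      have [||h1 h2] := nint q.1 q.2 _ _ _ _ p1 p2 p12; last first.
      + by move: le; rewrite /=; have := h2; have := h1; lra.
      + split; [exact: slotbox_increasing bx2|by case: bx2|] => i j.
        by have := e (inr i); have := e (inr j); rewrite /a /tg; lra.
      + split; [exact: slotbox_increasing bx1|by case: bx1|] => i j.
        by have := e (inl i); have := e (inl j); rewrite /a /tg; lra.
    exists (dd / 2); split; first by rewrite divr_gt0.
    move=> _ _ _ w' hw' q Aq; apply: hdd => // k.
    have key i : `|w' i - w' i0 - (v i - v i0)| < dd.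
      have -> : w' i - w' i0 - (v i - v i0) = (w' i - v i) - (w' i0 - v i0) by ring.
      apply: le_lt_trans (ler_normB _ _) _.
      by have := hw' i; have := hw' i0; lra.
    by case: k => k; exact: key.
  have [m [m0 _ hm]] := @fin_lower_bound R _ predT dl (fun p _ => (hdl p).1).
  exists (Num.min d m); first by rewrite lt_min d0.
  move=> w' _ hw' [x1 [y1 [hx1 hy1 /eqP]]]; apply.
  have cl1 : close v w' d by move=> i; have := hw' i; rewrite lt_min => /andP[].
  have cl2 p : close v w' (dl p).
    move=> i; have := hw' i; rewrite lt_min => /andP[_ h].
    exact: lt_le_trans h (hm p isT).
  have bx1 := hb _ _ cl1 hx1; have by1 := hb _ _ cl1 hy1.
  have il : interlaced C (x1 ord0) (y1 ord0).
    apply: contrapT => /not_interlaced_pair[p [p1 p2 p12 h]].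
    have sx k : sv x1 k - sv x1 i0 = w' k - w' i0 by case: hx1.
    have sy k : sv y1 k - sv y1 i0 = w' k - w' i0 by case: hy1.
    case: h => h.
      have [|[k|k]] := (hdl p).2 p1 p2 p12 w' (cl2 p) (x1, y1).
      + by split => //=; rewrite subr_le0.
      + by rewrite /a /tg /= sx eqxx.
      + by rewrite /a /tg /= sy eqxx.
    have [|[k|k]] := (hdl p).2 p1 p2 p12 w' (cl2 p) (y1, x1).
    + by split => //=; rewrite subr_le0.
    + by rewrite /a /tg /= sy eqxx.
    + by rewrite /a /tg /= sx eqxx.
  case: hx1 hy1 => hx1 cx1 sx1 [hy1 cy1 sy1].
  apply/rowP; apply: (interlaced_eq hx1 hy1 il _ iC).
    by rewrite cx1 cy1.
  by move=> i j; have := sx1 i j; have := sy1 i j; rewrite /slotvalue => -> ->.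
- exact: chebyshev_values_cone.
Qed.

(** Solutions for nearby targets lie in a compact box. By uniqueness the part of the box away from
    [x] contains no solution for [w], and hence none for nearby targets. *)
Lemma solution_continuous w x (r : R) : cone C w -> solution w x -> 0 < r ->
  exists2 d, 0 < d & forall w' x', close w w' d -> solution w' x' ->
    forall i, `|x' ord0 i - x ord0 i| < r.
Proof.
move=> cw hx r0; have [eta [B [d [eta0 d0 hb]]]] := solution_bounds cw.
have /choice[dl hdl] : forall k, exists d : R, 0 < d /\ forall w', close w w' d ->
    forall y, slotbox eta B y -> r ^+ 2 <= (y ord0 k - x ord0 k) ^+ 2 ->
    ~ (forall i j, sv y i - sv y j = w' i - w' j).
  move=> k; have [||d' d'0 hd'] := @avoid_solution
    (slotbox eta B `&` [set y | r ^+ 2 <= (y ord0 k - x ord0 k) ^+ 2]) w.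
  - by apply: compact_closedI; [exact: compact_slotbox|exact: closed_far].
  - move=> y [bxy fy] sy.
    have e : y = x.
      apply: slot_unique hx; split => //; last by case: bxy.
      exact: slotbox_increasing bxy.
    by move: fy; rewrite /= e subrr expr0n /= leNgt exprn_gt0.
  - by exists d'; split => // w' hw' y by_ fy; exact: hd'.
have [m [m0 _ hm]] := @fin_lower_bound R _ predT dl (fun p _ => (hdl p).1).
exists (Num.min d m); first by rewrite lt_min d0.
move=> w' x' hw' hx' k; rewrite ltNge; apply/negP => far.
apply: ((hdl k).2 w' _ x'); last by case: hx'.
- move=> i; have := hw' i; rewrite lt_min => /andP[_ h].
  exact: lt_le_trans h (hm k isT).
- by apply: hb hx' => i; have := hw' i; rewrite lt_min => /andP[].
- by rewrite -[leRHS]real_normK ?num_real // ler_pXn2r ?nnegrE // ltW.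
Qed.

End Inverse.

(** * Lifting a segment of values to a path of slots *)

Section Path.
Variables (R : realType) (N : nat) (C : {set 'I_N}).
Local Notation F := (Fpoly C).
Local Notation sv := (@slotvalue R N C).
Implicit Types (x y : 'rV[R]_N) (w : 'I_N -> R).

Lemma card0_slotvalue x i : #|C| = 0%N -> sv x i = x ord0 i.
Proof.
move=> c0; rewrite /slotvalue; suff -> : F (x ord0) = 'X by rewrite hornerX.
rewrite /Fpoly c0 scale1r; apply: deriv_inj_coef0.
  rewrite antiderivK derivX /critpoly big_pred0 // => i'.
  by rewrite (cards0_eq c0) inE.
by rewrite coef_antideriv invr0 mulr0 coefX.
Qed.

Lemma card0_slope i : #|C| = 0%N -> slope R C i = 1.
Proof.
move=> c0; rewrite /slope eq_card0 // => j.
by rewrite inE (cards0_eq c0) finset.in_set0.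
Qed.

Lemma card0_centered x : #|C| = 0%N -> centered C x.
Proof.
by move=> c0; apply: big_pred0 => j; rewrite (cards0_eq c0) inE.
Qed.

Lemma slot_exists_gen w : cone C w -> exists x, solution C w x.
Proof.
case: (posnP #|C|) => [c0 cw|C0 cw]; last exact: (slot_exists C0 cw).
exists (\row_i w i); split; last by move=> i j; rewrite !card0_slotvalue // !mxE.
  apply: increasing_succ => i j e; have := cw _ _ e.
  by rewrite card0_slope // mul1r subr_gt0 !mxE.
exact: card0_centered.
Qed.

(** With critical points present, the segment of values is lifted through the continuous inverse.
    Without them the slots are their own values and are determined only up to translation, so the
    straight segment is taken. *)
Lemma slot_path x0 x1 : increasing (x0 ord0) -> increasing (x1 ord0) ->
  centered C x0 -> centered C x1 ->
  exists g : R -> 'rV[R]_N, [/\ g 0 = x0, g 1 = x1,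
    forall i, continuous (fun s => g s ord0 i) &
    forall s, 0 <= s <= 1 -> solution C (segment (sv x0) (sv x1) s) (g s)].
Proof.
move=> i0 i1 c0 c1.
have seg0 (w0 w1 : 'I_N -> R) : segment w0 w1 0 = w0.
  by apply/funext => i; rewrite /segment subr0 mul1r mul0r addr0.
have seg1 (w0 w1 : 'I_N -> R) : segment w0 w1 1 = w1.
  by apply/funext => i; rewrite /segment subrr mul0r mul1r add0r.
case: (posnP #|C|) => [cC|C0].
  exists (fun s => (1 - s) *: x0 + s *: x1); split.
  - by rewrite subr0 scale1r scale0r addr0.
  - by rewrite subrr scale0r scale1r add0r.
  - move=> i; rewrite (_ : (fun s => _) = fun s : R =>
        x0 ord0 i - (s * x0 ord0 i - s * x1 ord0 i)); last first.
      by apply/funext => s; rewrite !mxE; ring.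
    apply: continuous_subr; first exact: (@cst_continuous _ R).
    apply: continuous_subr; apply: continuous_mulr.
    + by move=> s; exact: cvg_id.
    + exact: (@cst_continuous _ R).
    + by move=> s; exact: cvg_id.
    + exact: (@cst_continuous _ R).
  move=> s /andP[s0 s1]; split.
  - move=> i j ij; rewrite !mxE; have h0 := i0 _ _ ij; have h1 := i1 _ _ ij.
    have e1 : 0 <= (1 - s) * (x0 ord0 j - x0 ord0 i).
      by rewrite mulr_ge0 ?subr_ge0 // ltW.
    have e2 : 0 <= s * (x1 ord0 j - x1 ord0 i).
      by rewrite mulr_ge0 // subr_ge0 ltW.
    case: (ltP s 1) => hs.
      have : 0 < (1 - s) * (x0 ord0 j - x0 ord0 i) by rewrite mulr_gt0 // subr_gt0.
      by lra.
    have -> : s = 1 by apply/eqP; rewrite eq_le s1 hs.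
    by rewrite subrr !mul0r !mul1r !add0r.
  - exact: card0_centered.
  - by move=> i j; rewrite /segment !card0_slotvalue // !mxE.
have n0 : cone C (sv x0) by exact: Fpoly_cone.
have n1 : cone C (sv x1) by exact: Fpoly_cone.
(* Clamping the parameter to the unit interval defines the path, and makes it continuous, on the
   whole line. *)
pose cl (s : R) := Num.max 0 (Num.min 1 s).
have cl01 s : 0 <= cl s <= 1.
  by rewrite /cl le_max lexx /= ge_max ler01 ge_min lexx.
have clid s : 0 <= s <= 1 -> cl s = s.
  by move=> /andP[s0 s1]; rewrite /cl min_r // max_r.
have cllip s t : `|cl t - cl s| <= `|t - s|.
  rewrite /cl; case: (lerP 1 s); case: (lerP 1 t) => ? ?;
  rewrite ?(max_r ler01) ?subrr ?normr0 //.
  - by case: (lerP 0 t) => ?; rewrite !ler0_norm; lra.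
  - by case: (lerP 0 s) => ?; rewrite !ger0_norm; lra.
  - case: (lerP 0 s); case: (lerP 0 t) => ? ?; rewrite ?subrr ?normr0 // ?sub0r ?subr0.
    + by rewrite normrN ger0_norm // ler0_norm; lra.
    + by rewrite !ger0_norm; lra.
have cs s : cone C (segment (sv x0) (sv x1) (cl s)).
  exact: cone_segment.
have /choice[g hg] := fun s => slot_exists C0 (cs s).
exists g; split.
- apply: (slot_unique C0 (hg 0)); rewrite clid ?lexx ?ler01 // seg0.
  by split.
- apply: (slot_unique C0 (hg 1)); rewrite clid ?lexx ?ler01 // seg1.
  by split.
- move=> i s; apply/cvgrPdist_lt => e e0.
  have [d d0 hd] := solution_continuous C0 (cs s) (hg s) e0.
  have [M M0 hM] := segment_close (sv x0) (sv x1).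
  apply/nbhs_ballP; exists (d / M); first by rewrite /= divr_gt0.
  move=> t; rewrite /ball /= distrC ltr_pdivlMr // mulrC => ts.
  rewrite distrC; apply: hd (hg t) i => k.
  apply: le_lt_trans (hM _ _ _) _; apply: le_lt_trans ts.
  by rewrite ler_pM2l.
- by move=> s s01; have := hg s; rewrite clid.
Qed.

Lemma continuous_row (T : topologicalType) (f : T -> 'rV[R]_N) :
  (forall i, continuous (fun t => f t ord0 i)) -> continuous f.
Proof.
move=> hf t; apply/cvg_ballP => e e0.
have : \forall u \near t, forall i, ball (f t ord0 i) e (f u ord0 i).
  by apply: filter_forall => i; have := hf i t => /cvg_ballP/(_ e e0).
apply: filterS => u hu; split => // i j; rewrite (ord1 i); exact: hu.
Qed.

End Path.

(** * Components of the space of very nice morsifications *)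

Section Ppoly.
Variables (R : realType) (m : nat).
Implicit Type lam : 'rV[R]_(m.+1.-2).

Lemma coef_Ppoly lam k : (@Ppoly R m.+1 lam)`_k =
  (k == m.+1)%:R + \sum_(i < m.-1) lam ord0 i * (k == m.+1 - i.+2)%N%:R.
Proof.
rewrite /Ppoly /= coefD coefXn coef_sum; congr (_ + _).
by apply: eq_bigr => i _; rewrite coefZ coefXn.
Qed.

Lemma coef_Ppoly_lam lam (i : 'I_(m.-1)) :
  (@Ppoly R m.+1 lam)`_(m.+1 - i.+2) = lam ord0 i.
Proof.
rewrite coef_Ppoly (bigD1 i) //= eqxx mulr1 big1 => [|j ji].
  by rewrite (_ : (_ == m.+1) = false) ?add0r ?addr0 //; lia.
rewrite (_ : (_ == _) = false) ?mulr0 //; apply/negbTE.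
have := ltn_ord i; have := ltn_ord j; rewrite -(inj_eq val_inj) /= in ji; lia.
Qed.

Lemma coef_Ppoly0 lam k : k = 0%N \/ k = m \/ (m.+1 < k)%N ->
  (@Ppoly R m.+1 lam)`_k = 0.
Proof.
move=> hk; rewrite coef_Ppoly big1 => [|i _].
  by rewrite (_ : (k == m.+1) = false) ?addr0 //; lia.
rewrite (_ : (_ == _) = false) ?mulr0 //; apply/negbTE.
have := ltn_ord i; lia.
Qed.

Lemma coef_Ppoly_lead lam : (@Ppoly R m.+1 lam)`_m.+1 = 1.
Proof.
rewrite coef_Ppoly eqxx big1 ?addr0 // => i _.
by rewrite (_ : (_ == _) = false) ?mulr0 //; lia.
Qed.

Definition coef_row (f : {poly R}) : 'rV[R]_(m.+1.-2) :=
  \row_(i < m.+1.-2) f`_(m.+1 - i.+2).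

Lemma coef_rowK lam : coef_row (@Ppoly R m.+1 lam) = lam.
Proof. by apply/rowP => i; rewrite mxE coef_Ppoly_lam. Qed.

Lemma Ppoly_coef_row (f : {poly R}) : f`_m.+1 = 1 -> f`_m = 0 -> f`_0 = 0 ->
  (size f <= m.+2)%N -> @Ppoly R m.+1 (coef_row f) = f.
Proof.
move=> f1 fm f0 sf; apply/polyP => k.
case: (ltngtP k m.+1) => hk.
- case: (eqVneq k 0%N) => [->|k0]; first by rewrite coef_Ppoly0; [|left].
  case: (eqVneq k m) => [->|km]; first by rewrite coef_Ppoly0; [|right; left].
  have ik : (m.-1 - k < m.-1)%N by lia.
  have e : k = (m.+1 - (Ordinal ik).+2)%N by rewrite /=; lia.
  by rewrite {1}e coef_Ppoly_lam mxE -e.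
- by rewrite coef_Ppoly0 ?nth_default //; [exact: leq_trans sf _|right; right].
- by rewrite hk coef_Ppoly_lead f1.
Qed.

Section Slots.
Variables (N : nat) (C : {set 'I_N}).
Hypothesis cC : #|C| = m.

Lemma Ppoly_Fpoly (x : 'I_N -> R) : \sum_(i in C) x i = 0 ->
  @Ppoly R m.+1 (coef_row (Fpoly C x)) = Fpoly C x.
Proof.
move=> cx; apply: Ppoly_coef_row.
- by rewrite -cC Fpoly_lead.
- case: (posnP m) => [m0|mp]; first by rewrite m0 Fpoly_coef0.
  by rewrite -[X in _`_X]cC Fpoly_sublead // cC.
- exact: Fpoly_coef0.
- by rewrite size_Fpoly cC.
Qed.

(** Both constant terms are 0, and the missing term of degree [m] in the members of P_n says that
    the critical points have sum 0. *)
Lemma deriv_Ppoly_Fpoly lam (x : 'I_N -> R) :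
  (@Ppoly R m.+1 lam)^`() = m.+1%:R *: critpoly C x ->
  @Ppoly R m.+1 lam = Fpoly C x /\ \sum_(i in C) x i = 0.
Proof.
move=> e.
have eF : @Ppoly R m.+1 lam = Fpoly C x.
  apply: deriv_inj_coef0; first by rewrite deriv_Fpoly cC.
  by rewrite Fpoly_coef0 coef_Ppoly0; [|left].
split=> //; case: (posnP m) => [m0|mp].
  by apply: big_pred0 => i; rewrite (cards0_eq (etrans cC m0)) finset.in_set0.
have C0 : (0 < #|C|)%N by rewrite cC.
have := coef_Fpoly C x #|C|.-1; rewrite prednK // -eF cC coef_Ppoly0; last by right; left.
rewrite mul0r => /esym/eqP; rewrite mulf_eq0 pnatr_eq0 /= => /eqP h.
by apply: oppr_inj; rewrite -critpoly_sublead // cC h oppr0.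
Qed.

End Slots.
End Ppoly.

Lemma continuous_prod (T U V : topologicalType) (f : T -> U) (g : T -> V) :
  continuous f -> continuous g -> continuous (fun x => (f x, g x)).
Proof. by move=> cf cg x; exact: (cvg_pair (cf x) (cg x)). Qed.

Section Config.
Variables (R : realType) (m l : nat).
Local Notation N := (m + l)%N.
Local Notation n := m.+1.
Local Notation space := ('rV[R]_(n.-2) * 'rV[R]_l)%type.
Local Notation type := ('S_N * {ffun 'I_l -> 'I_N})%type.
Implicit Types (p : space) (t : type) (x : 'I_N -> R).

Definition config p t x := [/\ increasing x,
  (@Ppoly R n p.1)^`() = n%:R *: critpoly (critslots t.2) x,
  forall j, p.2 ord0 j = x (t.2 j) &
  forall i j, ((@Ppoly R n p.1).[x i] < (@Ppoly R n p.1).[x j])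
    = (t.1 i < t.1 j)%N].

Definition cell t : set space := [set p | exists x, config p t x].

Definition ranks (s : 'S_N) : 'I_N -> R := fun i => (s i)%:R.

Lemma nth_map_ord (T : Type) (a : T) k (u : 'I_k -> T) (i : 'I_k) :
  nth a [seq u j | j <- enum 'I_k] i = u i.
Proof. by rewrite (nth_map i) ?size_enum_ord // nth_ord_enum. Qed.

Lemma increasing_inj x : increasing x -> injective x.
Proof.
move=> hx i j e; case: (ltngtP i j) => [/hx|/hx|/val_inj //].
  by rewrite e ltxx.
by rewrite e ltxx.
Qed.

Lemma pattern_cone (C : {set 'I_N}) (s : 'S_N) (y : 'I_N -> R) :
  (forall i j, (y i < y j) = (s i < s j)%N) ->
  pattern C s <-> cone C y.
Proof.
move=> ys.
have yinj (i j : 'I_N) : i != j -> y i != y j.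
  move=> ij; apply/eqP => e; have := ys i j; have := ys j i; rewrite e ltxx.
  move=> h1 h2; have : s i = s j by apply: ord_inj; lia.
  by move/perm_inj => eij; rewrite eij eqxx in ij.
have key (i j : 'I_N) : j = i.+1 :> nat ->
   (0 < slope R C i * (y j - y i)) = ((s i < s j)%N == ~~ odd #|[set k in C | (i < k)%N]%SET|).
  move=> e; rewrite /slope -signr_odd -ys.
  have : y i != y j by apply: yinj; rewrite -(inj_eq val_inj) /= e; lia.
  case: (odd _); rewrite /= ?expr1 ?expr0 ?mulN1r ?mul1r ?opprB subr_gt0.
    by case: ltgtP.
  by case: ltgtP.
split=> [h i j e|h].
  by rewrite key //; move/forallP: h => /(_ i)/forallP/(_ j); rewrite e eqxx.
apply/forallP => i; apply/forallP => j; apply/implyP => /eqP e.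
by rewrite -key //; apply: h.
Qed.

Lemma ranks_ltP s i j : (ranks s i < ranks s j) = (s i < s j)%N.
Proof. by rewrite /ranks ltr_nat. Qed.

Lemma perm_of_rank (y : 'I_N -> R) : injective y ->
  exists s : 'S_N, forall i j, (y i < y j) = (s i < s j)%N.
Proof.
move=> yi.
have lt (i : 'I_N) : (#|[pred j | (y j < y i)%R]| < N)%N.
  rewrite -[X in (_ < X)%N]card_ord; apply: proper_card; apply/properP; split.
    exact: subset_predT.
  by exists i; rewrite ?inE // ltxx.
pose f (i : 'I_N) := Ordinal (lt i).
have mono i j : y i < y j -> (f i < f j)%N.
  move=> ij /=; apply: proper_card; apply/properP; split.
    by apply/fintype.subsetP => k; rewrite !inE => /lt_trans; apply.
  by exists i; rewrite !inE // ltxx.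
have fi : injective f.
  move=> i j e; apply: yi; case: (ltgtP (y i) (y j)) => // /mono.
    by rewrite e ltnn.
  by rewrite e ltnn.
exists (perm fi) => i j; rewrite !permE; case: (ltgtP (y i) (y j)) => h.
- by rewrite mono.
- by apply/esym/negbTE; rewrite -leqNgt ltnW // mono.
- by rewrite (yi _ _ h) ltnn.
Qed.

Lemma ord_iso_perm (s s' : 'S_N) :
  (forall i j, (s i < s j)%N = (s' i < s' j)%N) -> s = s'.
Proof.
move=> h; apply/permP => i; apply: ord_inj.
have rk (u : 'S_N) : u i = #|[pred j | (u j < u i)%N]| :> nat.
  rewrite -[LHS](card_ord (u i)).
  have -> : #|[pred j | (u j < u i)%N]| = #|[pred k : 'I_N | (k < u i)%N]|.
    by rewrite -!sum1_card [RHS](reindex_inj (@perm_inj _ u)).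
  rewrite card_ord -sum1_card -(big_ord_widen_cond N xpredT (fun=> 1%N)) ?sum1_card ?card_ord //.
  exact: ltnW.
by rewrite [LHS]rk [RHS]rk; apply: eq_card => j; rewrite !inE h.
Qed.

(* [x] is the increasing enumeration of the critical and boundary points. *)
Lemma config_slots p t t' x x' : config p t x -> config p t' x' -> x = x'.
Proof.
move=> [hx dx bx _] [hx' dx' bx' _].
have mem (u : 'I_N -> R) (v : type) : increasing u ->
    (@Ppoly R n p.1)^`() = n%:R *: critpoly (critslots v.2) u ->
    (forall j, p.2 ord0 j = u (v.2 j)) ->
    [seq u i | i <- enum 'I_N] =i
    [pred z | root (@Ppoly R n p.1)^`() z || [exists j, p.2 ord0 j == z]].
  move=> hu du bu z; rewrite inE; apply/mapP/orP.
    move=> [i _ ->]; case: (boolP (i \in critslots v.2)) => iC.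
      left; rewrite du rootE hornerZ critpoly_horner (bigD1 i) //= subrr mul0r.
      by rewrite mulr0.
    right; move: iC; rewrite inE negbK => /codomP[j ->].
    by apply/existsP; exists j; rewrite bu.
  case=> [|/existsP[j /eqP <-]]; last by exists (v.2 j); rewrite ?mem_enum.
  rewrite du rootE hornerZ mulf_eq0 pnatr_eq0 /= critpoly_horner.
  by move=> /prodf_eq0[i _]; rewrite subr_eq0 => /eqP ->; exists i; rewrite ?mem_enum.
have srt (u : 'I_N -> R) : increasing u -> sorted <%R [seq u i | i <- enum 'I_N].
  move=> hu; rewrite sorted_map.
  apply: (@sub_sorted _ (fun i j : 'I_N => (i < j)%N)).
    by move=> i j; exact: hu.
  have : sorted ltn [seq val i | i <- enum 'I_N] by rewrite val_enum_ord iota_ltn_sorted.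
  by rewrite sorted_map.
have e : [seq x i | i <- enum 'I_N] = [seq x' i | i <- enum 'I_N].
  apply: lt_sorted_eq; [exact: srt|exact: srt|].
  by move=> z; rewrite (mem _ _ hx dx bx) (mem _ _ hx' dx' bx').
apply/funext => i.
have : nth 0 [seq x i | i <- enum 'I_N] i = nth 0 [seq x' i | i <- enum 'I_N] i.
  by rewrite e.
by rewrite !nth_map_ord.
Qed.

Lemma cell_disjoint p t t' : cell t p -> cell t' p -> t = t'.
Proof.
move=> [x cx] [x' cx']; have e := config_slots cx cx'; subst x'.
case: t t' cx cx' => [s pos] [s' pos'] [hx _ b o] [_ _ b' o'] /=.
rewrite /= in b b' o o'; congr (_, _).
  by apply: ord_iso_perm => i j; rewrite -o -o'.
by apply/ffunP => j; apply: (increasing_inj hx); rewrite -b -b'.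
Qed.

Lemma config_type p t x : injective t.2 -> config p t x -> t \in types m l.
Proof.
move=> ip [hx dx _ o]; rewrite inE; apply/andP; split; first exact/injectiveP.
apply/(pattern_cone _ o).
have [-> _] := deriv_Ppoly_Fpoly (card_critslots ip) dx.
exact: Fpoly_cone.
Qed.

Lemma typesP t : t \in types m l -> injective t.2 /\ cone (critslots t.2) (ranks t.1).
Proof.
rewrite inE => /andP[/injectiveP ip pt]; split => //.
by apply/(pattern_cone _ (ranks_ltP t.1)).
Qed.

Definition realize t (y : 'rV[R]_N) : space :=
  (coef_row m (Fpoly (critslots t.2) (y ord0)), \row_j y ord0 (t.2 j)).

Lemma realize_config t (w : 'I_N -> R) (y : 'rV[R]_N) : injective t.2 ->
  (forall i j, (w i < w j) = (t.1 i < t.1 j)%N) ->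
  solution (critslots t.2) w y -> config (realize t y) t (y ord0).
Proof.
move=> ip hw [hy cy sy]; have cC := card_critslots ip.
split => //=.
- by rewrite Ppoly_Fpoly // deriv_Fpoly cC.
- by move=> j; rewrite mxE.
by move=> i j; rewrite Ppoly_Fpoly // -hw -subr_lt0 -[RHS]subr_lt0 -sy.
Qed.

Lemma cell_nonempty t : t \in types m l -> cell t !=set0.
Proof.
move=> /typesP[ip /slot_exists_gen[y hy]]; exists (realize t y), (y ord0).
by apply: realize_config hy => // i j; exact: ranks_ltP.
Qed.

Lemma config_realize p t x : injective t.2 -> config p t x ->
  p = realize t (\row_i x i).
Proof.
move=> ip [hx dx bx _]; have [e _] := deriv_Ppoly_Fpoly (card_critslots ip) dx.
have ex : ((\row_i x i) ord0 : 'I_N -> R) = x by apply/funext => i; rewrite mxE.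
case: p dx bx e => lam b /= dx bx e; rewrite /realize ex -e coef_rowK; congr (_, _).
by apply/rowP => j; rewrite !mxE bx.
Qed.

Lemma realize_continuous t (g : R -> 'rV[R]_N) :
  (forall i, continuous (fun s => g s ord0 i)) ->
  continuous (realize t \o g).
Proof.
move=> hg; have cg : continuous g by exact: continuous_row.
have c1 : continuous (fun s => coef_row m (Fpoly (critslots t.2) (g s ord0)) : 'rV[R]_(n.-2)).
  apply: continuous_row => i.
  rewrite (_ : (fun s => _) = (fun y : 'rV[R]_N =>
     (Fpoly (critslots t.2) (y ord0))`_(n - i.+2)) \o g); last first.
    by apply/funext => s; rewrite mxE.
  move=> s; apply: continuous_comp; first exact: cg.
  exact: coef_Fpoly_continuous.
have c2 : continuous (fun s => \row_j g s ord0 (t.2 j) : 'rV[R]_l).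
  apply: continuous_row => j.
  rewrite (_ : (fun s => _) = (fun s => g s ord0 (t.2 j))) //.
  by apply/funext => s; rewrite mxE.
exact: (continuous_prod c1 c2).
Qed.

(** The two value vectors are ranked in the same way, so are their convex combinations; the lifted
    path of [slot_path] therefore stays in the cell. *)
Lemma cell_connected t p q : injective t.2 -> cell t p -> cell t q ->
  exists A, [/\ connected A, A `<=` cell t, A p & A q].
Proof.
move=> ip [x cx] [x' cx']; have cC := card_critslots ip.
have ep := config_realize ip cx; have eq := config_realize ip cx'.
case: (cx) (cx') => [hx dx _ ox] [hx' dx' _ ox'].
have [ex sx] := deriv_Ppoly_Fpoly cC dx.
have [ex' sx'] := deriv_Ppoly_Fpoly cC dx'.
pose y : 'rV[R]_N := \row_i x i; pose y' : 'rV[R]_N := \row_i x' i.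
have ey : (y ord0 : 'I_N -> R) = x by apply/funext => i; rewrite mxE.
have ey' : (y' ord0 : 'I_N -> R) = x' by apply/funext => i; rewrite mxE.
have [||||g [g0 g1 cg hg]] := @slot_path R N (critslots t.2) y y'.
- by rewrite ey.
- by rewrite ey'.
- by rewrite /centered ey.
- by rewrite /centered ey'.
exists ((realize t \o g) @` `[0, 1]%classic); split.
- apply: connected_continuous_connected; first exact: segment_connected.
  apply: continuous_subspaceT; exact: realize_continuous.
- move=> _ [s s01 <-]; rewrite /= in_itv /= in s01; exists (g s ord0).
  apply: realize_config (hg s s01) => // i j.
  have oy : (slotvalue (critslots t.2) y i < slotvalue (critslots t.2) y j) = (t.1 i < t.1 j)%N.
    by rewrite /slotvalue ey -ox ex.
  have oy' : (slotvalue (critslots t.2) y' i < slotvalue (critslots t.2) y' j) = (t.1 i < t.1 j)%N.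
    by rewrite /slotvalue ey' -ox' ex'.
  move: oy oy'; rewrite /segment; set a := slotvalue _ y i; set b := slotvalue _ y j.
  set a' := slotvalue _ y' i; set b' := slotvalue _ y' j => oy oy'.
  move/andP: s01 => [s0 s1].
  case: (ltnP (t.1 i) (t.1 j)) oy oy' => _ h h'.
    have e1 : 0 <= s * (b' - a') by rewrite mulr_ge0 // subr_ge0 ltW.
    have e2 : 0 <= (1 - s) * (b - a) by rewrite mulr_ge0 // subr_ge0 // ltW.
    case: (ltP 0 s) => hs.
      by have : 0 < s * (b' - a') by [rewrite mulr_gt0 // subr_gt0]; lra.
    have -> : s = 0 by apply/eqP; rewrite eq_le hs s0.
    by rewrite subr0 !mul1r !mul0r !addr0.
  apply/negbTE; rewrite -leNgt; move/negbT: h; move/negbT: h'; rewrite -!leNgt => h' h.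
  have e1 : 0 <= s * (a' - b') by rewrite mulr_ge0 // subr_ge0.
  have e2 : 0 <= (1 - s) * (a - b) by rewrite mulr_ge0 // subr_ge0.
  by lra.
- exists 0; first by rewrite /= in_itv /= lexx ler01.
  by rewrite /= g0 -ep.
- exists 1; first by rewrite /= in_itv /= lexx ler01.
  by rewrite /= g1 -eq.
Qed.

End Config.

Section Open.
Variables (R : realType) (m l : nat).
Local Notation N := (m + l)%N.
Local Notation n := m.+1.
Local Notation space := ('rV[R]_(n.-2) * 'rV[R]_l)%type.
Local Notation type := ('S_N * {ffun 'I_l -> 'I_N})%type.
Implicit Types (p : space) (t : type) (x : 'I_N -> R).

Lemma PpolyB (lam lam' : 'rV[R]_(n.-2)) : @Ppoly R n lam' - @Ppoly R n lam
  = \sum_(i < n.-2) (lam' ord0 i - lam ord0 i) *: 'X^(n - i.+2).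
Proof.
rewrite /Ppoly /= opprD addrACA subrr add0r -sumrB; apply: eq_bigr => i _.
by rewrite scalerBl.
Qed.

Lemma PpolyB_bound (B : R) : 0 < B -> exists2 K : R, 0 < K &
  forall (lam lam' : 'rV[R]_(n.-2)) (e : R), 0 <= e ->
  (forall i, `|lam' ord0 i - lam ord0 i| <= e) -> forall u : R, `|u| <= B ->
  `|(@Ppoly R n lam' - @Ppoly R n lam).[u]| <= K * e /\
  `|(@Ppoly R n lam' - @Ppoly R n lam)^`().[u]| <= K * e.
Proof.
move=> B0; pose a i := B ^+ (n - i.+2); pose b i := B ^+ (n - i.+2).-1 *+ (n - i.+2).
have a0 i : 0 <= a i by rewrite exprn_ge0 // ltW.
have b0 i : 0 <= b i by rewrite mulrn_wge0 // exprn_ge0 // ltW.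
have s1 : 0 <= \sum_(i < n.-2) a i by apply: sumr_ge0 => i _.
have s2 : 0 <= \sum_(i < n.-2) b i by apply: sumr_ge0 => i _.
exists (1 + \sum_(i < n.-2) a i + \sum_(i < n.-2) b i).
  by rewrite -addrA ltr_wpDr // addr_ge0.
move=> lam lam' e e0 he u uB; rewrite PpolyB.
have pw k : `|u ^+ k| <= B ^+ k.
  by rewrite normrX; apply: lerXn2r; rewrite ?nnegrE // ltW.
have key (c : 'I_(n.-2) -> R) (g : nat -> R) :
    (forall i : 'I_(n.-2), `|c i| <= g i * e) ->
    `|\sum_i c i| <= (\sum_(i < n.-2) g i) * e.
  move=> h; apply: le_trans (ler_norm_sum _ _ _) _; rewrite mulr_suml.
  by apply: ler_sum.
split.
  rewrite horner_sum; apply: (@le_trans _ _ ((\sum_(i < n.-2) a i) * e)).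
    apply: key => i; rewrite hornerZ hornerXn normrM mulrC.
    by apply: ler_pM.
  by rewrite ler_wpM2r //; lra.
rewrite raddf_sum horner_sum; apply: (@le_trans _ _ ((\sum_(i < n.-2) b i) * e)).
  apply: key => i; rewrite /= derivZ derivXn hornerZ hornerMn hornerXn normrM mulrC.
  by apply: ler_pM => //; rewrite normrMn ler_wMn2r.
by rewrite ler_wpM2r //; lra.
Qed.

Lemma size_PpolyB (lam lam' : 'rV[R]_(n.-2)) :
  (size (@Ppoly R n lam' - @Ppoly R n lam)%R <= m)%N.
Proof.
apply/leq_sizeP => k hk; rewrite coefB; case: (ltngtP k m.+1) => h.
- by rewrite !coef_Ppoly0 ?subrr //; right; left; lia.
- by rewrite !coef_Ppoly0 ?subrr //; right; right.
- by rewrite h !coef_Ppoly_lead subrr.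
Qed.

(** By [critpoly_perturb] the critical points move by at most a multiple of the change of the
    coefficients; small changes thus preserve the order of the slots and that of their values. *)
Lemma cell_open t p : injective t.2 -> cell t p -> nbhs p (cell t).
Proof.
move=> ip [x [hx dx bx ox]]; have cC := card_critslots ip.
set C := critslots t.2 in dx cC.
have [B1 [k [e0 [B10 k0 e00 hpert]]]] := critpoly_perturb C hx.
have [X [X0 hX]] := fin_upper_bound (fun i => `|x i|).
pose B := B1 + X + 1.
have B0 : 0 < B by rewrite /B; lra.
have [K K0 hK] := PpolyB_bound B0.
pose f := @Ppoly R n p.1.
have [L [L0 hL]] := poly_taylor1 f B.
have [g [g0 g1 hg]] := increasing_gap hx.
have fxi i j : i != j -> f.[x i] != f.[x j].
  move=> ij; apply/eqP => e; have := ox i j; have := ox j i; rewrite -/f e ltxx.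
  move=> h1 h2; have : t.1 i = t.1 j.
    by apply: ord_inj; apply/eqP; rewrite eqn_leq leqNgt -h1 leqNgt -h2.
  by move/perm_inj => eij; rewrite eij eqxx in ij.
have [|v [v0 _ hv]] := @fin_lower_bound R _ [pred q : 'I_N * 'I_N | q.1 != q.2]
    (fun q => `|f.[x q.1] - f.[x q.2]|).
  by move=> [i j] /= ij; rewrite normr_gt0 subr_eq0 fxi.
pose M := k * K + 1; have M0 : 0 < M by rewrite ltr_wpDl // mulr_ge0 // ltW.
pose T := K + L * M; have T0 : 0 < T by rewrite addr_gt0 // mulr_gt0.
(* In this order: [critpoly_perturb] applies, slots move by at most a third of the least gap, and
   values by at most a third of their least difference. *)
pose e := Num.min (e0 / K) (Num.min (g / (3 * M)) (v / (3 * T))).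
have e_gt0 : 0 < e by rewrite !lt_min !divr_gt0 ?mulr_gt0.
have eK : K * e <= e0 by rewrite mulrC -ler_pdivlMr // !ge_min lexx.
have eM : M * e <= g / 3.
  have : e * (3 * M) <= g by rewrite -ler_pdivlMr ?mulr_gt0 // !ge_min lexx !orbT.
  lra.
have eT : T * e <= v / 3.
  have : e * (3 * T) <= v by rewrite -ler_pdivlMr ?mulr_gt0 // !ge_min lexx !orbT.
  lra.
apply/nbhs_ballP; exists e => // p' [[_ b1] [_ b2]].
have hl i : `|p'.1 ord0 i - p.1 ord0 i| <= e.
  by have := b1 ord0 i; rewrite /ball /= distrC => /ltW.
have hb j : `|p'.2 ord0 j - p.2 ord0 j| <= e.
  by have := b2 ord0 j; rewrite /ball /= distrC => /ltW.
pose f' := @Ppoly R n p'.1; pose D := f' - f.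
have hD := hK p.1 p'.1 e (ltW e_gt0) hl.
have [||||xc hxc exc] := hpert (n%:R^-1 *: D^`()) (K * e).
- rewrite cC; apply: leq_trans (size_scale_leq _ _) _.
  by rewrite polyorder.size_deriv; apply: leq_trans (leq_pred _) (size_PpolyB _ _).
- by rewrite mulr_gt0.
- exact: eK.
- move=> u uB; rewrite hornerZ normrM.
  have uB' : `|u| <= B by apply: le_trans uB _; rewrite /B; lra.
  have [_ h] := hD u uB'.
  apply: le_trans h; rewrite -/f -/f' -/D ler_piMl // ger0_norm ?invr_ge0 ?ler0n //.
  by rewrite invf_le1 ?ler1n ?ltr0n.
pose x' i := if [pick j | t.2 j == i] is Some j then p'.2 ord0 j else xc i.
have x'pos j : x' (t.2 j) = p'.2 ord0 j.
  rewrite /x'; case: pickP => [j' /eqP/ip -> //|/(_ j)].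
  by rewrite eqxx.
have x'C i : i \in C -> x' i = xc i.
  rewrite inE /x' => iC; case: pickP => // j /eqP ej.
  by rewrite -ej codom_f in iC.
have near i : `|x' i - x i| <= M * e.
  case: (boolP (i \in C)) => iC.
    rewrite x'C //; apply: le_trans (hxc _ iC) _.
    by rewrite mulrA ler_pM2r // /M lerDl.
  move: iC; rewrite inE negbK => /codomP[j ->]; rewrite x'pos -bx.
  apply: le_trans (hb j) _; apply: ler_peMl; first exact: ltW.
  by rewrite /M lerDr mulr_ge0 // ltW.
exists x'; split.
- move=> i j ij; have := hg i j; rewrite neq_ltn ij => /(_ isT).
  rewrite ltr0_norm ?subr_lt0 ?hx // => h3.
  by have := near i; have := near j; rewrite !ler_norml => /andP[? ?] /andP[? ?]; lra.
- have -> : critpoly (critslots t.2) x' = critpoly C xc by apply: critpoly_eq.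
  rewrite -exc scalerDr -dx scalerA mulfV ?pnatr_eq0 // scale1r /D derivB addrC.
  by rewrite -/f -/f' subrK.
- by move=> j; rewrite x'pos.
move=> i j; rewrite -ox -/f -/f'.
have val q : `|f'.[x' q] - f.[x q]| <= v / 3.
  have xB : `|x q| <= B by apply: le_trans (hX q) _; rewrite /B; lra.
  have x'B : `|x' q| <= B.
    have -> : x' q = x q + (x' q - x q) by ring.
    apply: le_trans (ler_normD _ _) _; have := hX q; have := near q; rewrite /B; lra.
  have [h1 _] := hD _ x'B; have [h2 _] := hL _ _ xB x'B.
  apply: le_trans eT; rewrite /T mulrDl.
  have -> : f'.[x' q] - f.[x q] = (f' - f).[x' q] + (f.[x' q] - f.[x q]).
    by rewrite hornerD hornerN; ring.
  apply: le_trans (ler_normD _ _) _; apply: lerD; first exact: h1.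
  by apply: le_trans h2 _; rewrite -mulrA ler_pM2l.
case: (eqVneq i j) => [->|ij]; first by rewrite !ltxx.
have := hv (i, j) ij; have := val i; have := val j.
rewrite !ler_norml /= => /andP[h1 h2] /andP[h3 h4].
clear - v0 h1 h2 h3 h4.
case: (ltP f.[x i] f.[x j]) => h.
  rewrite ltr0_norm ?subr_lt0 // => h5; lra.
rewrite ger0_norm ?subr_ge0 // => h5; apply/negbTE; rewrite -leNgt; lra.
Qed.

Lemma very_nice_cells : @very_nice R n l =
  \bigcup_(t in [set` types m l]) cell t.
Proof.
apply/seteqP; split => p.
  move=> [c [dc uv]]; set f := Ppoly p.1 in dc uv.
  pose bs := [seq p.2 ord0 j | j <- enum 'I_l].
  have uvals : uniq [seq f.[z] | z <- c ++ bs] by rewrite map_cat -map_comp.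
  (* Distinct values force distinct points: the critical points are simple and differ from the
     boundary points. *)
  have uall : uniq (c ++ bs) := map_uniq uvals.
  pose s := sort <=%R (c ++ bs).
  have ps : perm_eq s (c ++ bs) by rewrite perm_sort.
  have us : uniq s by rewrite (perm_uniq ps).
  have ss : size s = N.
    by rewrite (perm_size ps) size_cat size_tuple size_map size_enum_ord.
  pose x (i : 'I_N) := nth 0 s i.
  have srt : sorted <%R s by rewrite sort_lt_sorted.
  have hx : increasing x.
    move=> i j ij; apply: (sorted_ltn_nth lt_trans _ srt); rewrite ?inE ?ss //.
  have bin j : p.2 ord0 j \in s.
    by rewrite (perm_mem ps) mem_cat map_f ?orbT ?mem_enum.
  have bN j : (index (p.2 ord0 j) s < N)%N by rewrite -ss index_mem.
  pose pos : {ffun 'I_l -> 'I_N} := [ffun j => Ordinal (bN j)].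
  have xpos j : x (pos j) = p.2 ord0 j by rewrite /x ffunE nth_index.
  have ubs : uniq bs by move: uall; rewrite cat_uniq => /and3P[].
  have ipos : injective pos.
    move=> j j' e; have : p.2 ord0 j = p.2 ord0 j' by rewrite -!xpos e.
    exact: (elimT (injectiveP (fun j => p.2 ord0 j)) ubs).
  have xinj := increasing_inj hx.
  have critE i : (i \in critslots pos) = (x i \notin bs).
    rewrite inE; congr (~~ _); apply/codomP/mapP => -[j].
      by move=> ->; exists j; rewrite ?mem_enum // xpos.
    by move=> _ ej; exists j; apply: xinj; rewrite ej xpos.
  have finj : injective (fun i => f.[x i]).
    have uvs : uniq [seq f.[z] | z <- s] by rewrite (perm_uniq (perm_map _ ps)).
    move=> i j e; apply: ord_inj; apply/eqP.
    rewrite -(nth_uniq 0 _ _ uvs) ?size_map ?ss //.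
    by rewrite !(nth_map 0) ?ss //; apply/eqP.
  have [sg hsg] := perm_of_rank finj.
  have cfg : config p (sg, pos) x.
    split => //=.
      rewrite dc; congr (_ *: _).
      (* The critical slots are those not occupied by boundary points, so the product over them is
         the product over [c]. *)
      have -> : critpoly (critslots pos) x = \prod_(z <- s | z \notin bs) ('X - z%:P).
        rewrite (big_nth 0) ss big_mkord /critpoly.
        by apply: eq_bigl => i; rewrite critE.
      rewrite (perm_big _ ps) big_cat /= [X in _ * X]big1_seq ?mulr1; last first.
        by move=> z /andP[/negP].
      rewrite big_seq_cond [RHS]big_seq_cond; apply: eq_bigl => z.
      case zc : (z \in c) => //=; apply/esym/negP => zb.
      move: uall; rewrite cat_uniq => /and3P[_ /hasPn/(_ z zb)/negP + _].
      by apply.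
  by exists (sg, pos); [exact: config_type cfg|exists x].
move=> [t /= tT [x [hx dx bx ox]]]; have [ip _] := typesP R tT.
have cC := card_critslots ip; set C := critslots t.2 in dx cC.
have sz : size [seq x i | i <- enum C] == n.-1 by rewrite size_map -cardE cC.
exists (Tuple sz); split; first by rewrite dx big_map big_enum.
set f := Ppoly p.1 in dx ox *.
rewrite /image_mem.
have -> : [seq f.[p.2 ord0 i] | i <- enum 'I_l]
    = [seq f.[x i] | i <- [seq t.2 j | j <- enum 'I_l]].
  by rewrite -[RHS]map_comp; apply/eq_in_map => j _ /=; rewrite bx.
have -> : [seq f.[z] | z <- Tuple sz] = [seq f.[x i] | i <- enum C].
  by rewrite -[LHS]map_comp.
rewrite -map_cat map_inj_uniq; last first.
  move=> i j /= e; have := ox i j; have := ox j i; rewrite e ltxx => h1 h2.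
  apply: (@perm_inj _ t.1); apply: ord_inj; apply/eqP.
  by rewrite eqn_leq leqNgt -h1 leqNgt -h2.
rewrite cat_uniq enum_uniq map_inj_uniq // enum_uniq andbT /=.
apply/hasPn => _ /mapP[j _ ->]; rewrite mem_enum inE negbK; exact: codom_f.
Qed.

(** The cells are open, pairwise disjoint and cover the space, so a connected subset that meets one
    of them stays in it; and any two points of a cell are joined by a connected subset of it. *)
Lemma connected_component_cell t p : t \in types m l -> cell t p ->
  connected_component (@very_nice R n l) p = cell t.
Proof.
move=> tT tp; have [ip _] := typesP R tT.
apply/seteqP; split => q; last first.
  move=> tq; have [A [cA sA Ap Aq]] := cell_connected ip tp tq.
  exists A => //; split => //; rewrite very_nice_cells => u /sA tu.
  by exists t; [exact: tT|exact: tu].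
move=> [A [Ap sA cA] Aq].
pose other : set space := \bigcup_(u in [set u : type | u \in types m l /\ u <> t]) cell u.
have oo : open other.
  rewrite openE => u [v [vT vt] vu]; have [iv _] := typesP R vT.
  by apply: filterS (cell_open iv vu) => z vz; exists v.
have oc : open (cell t : set space).
  by rewrite openE => u tu; exact: cell_open.
have e : A `&` cell t = A `&` ~` other.
  apply/seteqP; split => z [Az] h; split => //.
    by move=> [u [_ ut] uz]; apply: ut; exact: cell_disjoint uz h.
  have := sA _ Az; rewrite very_nice_cells => -[u /= uT uz].
  have [<- //|/eqP ut] := eqVneq u t.
  by exfalso; apply: h; exists u.
have eA : A `&` cell t = A.
  apply: cA.
  - by exists p.
  - by exists (cell t).
  - by exists (~` other) => //; exact: open_closedC.
by have : A q by []; rewrite -eA => -[].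
Qed.

Lemma components_types : components (@very_nice R n l)
  = (@cell R m l) @` [set` types m l].
Proof.
apply/seteqP; split => A.
  move=> [p]; rewrite {1}very_nice_cells => -[t /= tT tp] <-.
  by exists t => //; rewrite (connected_component_cell tT tp).
move=> [t /= tT <-]; have [p tp] := cell_nonempty R tT.
exists p; last exact: (connected_component_cell tT tp).
by rewrite very_nice_cells; exists t.
Qed.

Lemma finite_components : finite_set (components (@very_nice R n l)).
Proof. by rewrite components_types; apply: finite_image; exact: finite_finset. Qed.

(** The cells of the types are nonempty and disjoint, so distinct types give distinct components. *)
Lemma Knl_types : Knl R n l = #|types m l|.
Proof.
rewrite /Knl components_types fset_set_image; last exact: finite_finset.
rewrite card_in_imfset /=; last first.
  move=> t u; rewrite !in_fset_set ?inE /=; [|exact: finite_finset..].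
  move=> tT uT e; have [p tp] := cell_nonempty R tT.
  by apply: (cell_disjoint tp); rewrite -e.
rewrite cardE; apply/perm_size/uniq_perm; [exact: fset_uniq|exact: enum_uniq|].
move=> t; rewrite mem_enum in_fset_set; last exact: finite_finset.
by apply/idP/idP; [move=> /set_mem|move=> tT; apply/mem_set].
Qed.
End Open.

(** * Derivatives of the secant and tangent *)

Section DerivativeSequences.
Variables (R : realType) (U : set R).
Implicit Types (f g : R -> R) (u v : nat -> R -> R).

Lemma derive1_congr f g t : open U -> (forall s, U s -> f s = g s) -> U t ->
  f^`()%classic t = g^`()%classic t.
Proof.
move=> oU fg Ut; rewrite /derive1.
have nr : \forall h \near (0 : R)^', f (h + t) = g (h + t).
  have : \forall h \near (0 : R), U (h + t).
    have c : (fun h : R => h + t) @ (0 : R) --> (0 + t).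
      by apply: cvgD; [exact: cvg_id|exact: cvg_cst].
    by apply: c; rewrite add0r; apply: open_nbhs_nbhs.
  move=> h0; apply: (@filterS _ _ _ [set h | U (h + t)]).
    by move=> h; exact: fg.
  exact: nbhs_dnbhs h0.
congr (lim _); apply/seteqP; split; apply: near_eq_cvg.
  by apply: filterS nr => h ->; rewrite (fg t).
by apply: filterS nr => h ->; rewrite (fg t).
Qed.

Lemma derive1n_congr f g k t : open U -> (forall s, U s -> f s = g s) -> U t ->
  derive1n k f t = derive1n k g t.
Proof.
move=> oU fg; elim: k t => [|k ih] t Ut; first exact: fg.
by rewrite !derive1nS; apply: derive1_congr.
Qed.

Definition derivatives u := forall k t, U t -> is_derive t 1 (u k) (u k.+1 t).

Lemma derive1n_derivatives u k t : open U -> derivatives u -> U t ->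
  derive1n k (u 0%N) t = u k t.
Proof.
move=> oU du; elim: k t => [//|k ih] t Ut.
rewrite derive1nS (derive1_congr oU ih Ut) derive1E.
by have := du k t Ut => ?; rewrite derive_val.
Qed.

Lemma derivatives_shift u m : derivatives u -> derivatives (fun k => u (k + m)%N).
Proof. by move=> du k t Ut; exact: du. Qed.

Lemma derivativesD u v : derivatives u -> derivatives v ->
  derivatives (fun k t => u k t + v k t).
Proof.
move=> du dv k t Ut; have := du k t Ut => ?; have := dv k t Ut => ?.
exact: (is_deriveD (f := u k) (g := v k)).
Qed.

Lemma derivativesZ u (c : R) : derivatives u -> derivatives (fun k t => c * u k t).
Proof.
move=> du k t Ut; have := du k t Ut => ?.
exact: (is_deriveZ (f := u k) c).
Qed.

(* The k-th derivative of [t * u 0 t], by the Leibniz rule. *)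
Definition mulX u k t : R := t * u k t + k%:R * u k.-1 t.

Lemma derivatives_mulX u : derivatives u -> derivatives (mulX u).
Proof.
move=> du k t Ut; have := du k t Ut => d1.
have d2 : is_derive t 1 (fun s => s * u k s) (t *: u k.+1 t + u k t *: 1).
  exact: (is_deriveM (f := @id R) (g := u k)).
have d3 : is_derive t 1 (fun s => k%:R * u k.-1 s) (k%:R * u k t).
  case: k {d1 d2} => [|k]; last by have := du k t Ut => ?; exact: (is_deriveZ (f := u k) _).
  rewrite mul0r (_ : (fun s => _) = cst 0); first exact: is_derive_cst.
  by apply/funext => s; rewrite mul0r.
have d4 := @is_deriveD _ _ _ _ _ _ _ _ _ d2 d3.
apply: (@is_derive_eq _ _ _ _ _ _ _ _ d4).
by rewrite /mulX /= /GRing.scale /= mulr1 -natr1; ring.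
Qed.

End DerivativeSequences.

Section SecTan.
Variable R : realType.

Definition poscos : set R := [set t | 0 < cos t].

Lemma open_poscos : open poscos.
Proof.
apply: (@open_comp _ _ (@cos R) [set x | 0 < x]); last exact: open_gt.
by move=> t _; exact: continuous_cos.
Qed.

(** The [N]-th derivative of sec + tan where cos is positive, as a homogeneous polynomial of degree
    [N + 1] in sec and tan. *)
Definition sectan (N : nat) (t : R) : R :=
  \sum_(n < N.+2) (bcoef N n)%:R * (cos t)^-1 ^+ n * tan t ^+ (N.+1 - n).

Lemma is_derive_sec (t : R) : poscos t ->
  is_derive t 1 (fun s => (cos s)^-1) ((cos t)^-1 * tan t).
Proof.
move=> ct; have c0 : cos t != 0 by rewrite gt_eqF.
apply: (@is_derive_eq _ _ _ _ _ _ _ _ (@is_deriveV _ (@cos R) t _ _ c0 (is_derive_cos t))).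
by rewrite /tan /GRing.scale /=; field.
Qed.

Lemma is_derive_tan_sec (t : R) : poscos t ->
  is_derive t 1 tan ((cos t)^-1 ^+ 2).
Proof.
move=> ct; have c0 : cos t != 0 by rewrite gt_eqF.
by rewrite exprVn; exact: is_derive_tan.
Qed.

Lemma is_derive_exprn (f : R -> R) k (t df : R) : is_derive t 1 f df ->
  is_derive t 1 (fun s => f s ^+ k) (k%:R * f t ^+ k.-1 * df).
Proof.
move=> d; rewrite (_ : (fun s => _) = f ^+ k).
  exact: (@is_deriveX _ _ f k t 1 df d).
by elim: k => [|k ih]; apply/funext => s; rewrite ?expr0 // !exprS -ih.
Qed.

Lemma is_derive_sectan_term (t c : R) n l : poscos t ->
  is_derive t 1 (fun s => c * (cos s)^-1 ^+ n * tan s ^+ l)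
    (c * (n%:R * (cos t)^-1 ^+ n * tan t ^+ l.+1
          + l%:R * (cos t)^-1 ^+ n.+2 * tan t ^+ l.-1)).
Proof.
move=> ct; have d1 := is_derive_exprn n (is_derive_sec ct).
have d2 := is_derive_exprn l (is_derive_tan_sec ct).
have d3 := @is_deriveM _ _ _ _ _ _ _ _ d1 d2.
have d4 := @is_deriveZ _ _ _ _ c _ _ _ d3.
rewrite (_ : (fun s => _) = c \*: ((fun s => (cos s)^-1 ^+ n) * (fun s => tan s ^+ l))).
  apply: (@is_derive_eq _ _ _ _ _ _ _ _ d4); rewrite /GRing.scale /=.
  congr (_ * _).
  have -> : n%:R * (cos t)^-1 ^+ n.-1 * ((cos t)^-1 * tan t)
      = n%:R * (cos t)^-1 ^+ n * tan t.
    by case: n {d1 d3 d4} => [|n]; rewrite ?mul0r // exprSr !mulrA.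
  by rewrite !exprS; ring.
by apply/funext => s; rewrite /= /GRing.scale /= mulrA.
Qed.

(** Since sec' = sec tan and tan' = sec^2, the derivative of a monomial has two terms, one with the
    same exponent of sec and one with this exponent raised by two; they match the two terms of
    [bcoefS]. *)
Lemma derivatives_sectan : derivatives poscos sectan.
Proof.
move=> N t ct; pose x := (cos t)^-1; pose y := tan t.
have d := @is_derive_sum _ _ _ N.+2 (fun (n : 'I_N.+2) s =>
    (bcoef N n)%:R * (cos s)^-1 ^+ n * tan s ^+ (N.+1 - n)) t 1 _
  (fun n : 'I_N.+2 => is_derive_sectan_term (bcoef N n)%:R n (N.+1 - n) ct).
rewrite (_ : sectan N = \sum_(n < N.+2) (fun s =>
    (bcoef N n)%:R * (cos s)^-1 ^+ n * tan s ^+ (N.+1 - n))); last first.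
  by apply/funext => s; rewrite fct_sumE.
apply: (@is_derive_eq _ _ _ _ _ _ _ _ d); rewrite -/x -/y /sectan -/x -/y.
under [RHS]eq_bigr do rewrite bcoefS natrD !mulrDl.
under [LHS]eq_bigr do rewrite mulrDr.
rewrite !big_split /=; congr (_ + _).
  rewrite [RHS]big_ord_recr /= bcoef_gt // muln0 !mul0r addr0.
  apply: eq_bigr => i _; rewrite natrM -subSn; last by rewrite -ltnS.
  by ring.
rewrite [RHS]big_ord_recl /= !mul0r add0r [RHS]big_ord_recl /= !mul0r add0r.
rewrite [LHS]big_ord_recr /= subnn !mul0r mulr0 addr0.
apply: eq_bigr => i _; rewrite /bump /= add1n !subSS natrM.
have -> : (N.+1 - i).-1 = (N - i)%N by rewrite subSn // -ltnS.
by ring.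
Qed.

Lemma sectan_bound (M t : R) N : 1 <= M -> `|(cos t)^-1| <= M -> `|tan t| <= M ->
  `|sectan N t| <= 2 * N`!%:R * M ^+ N.+1.
Proof.
move=> M1 hx hy; have M0 : 0 <= M by apply: le_trans M1.
apply: le_trans (ler_norm_sum _ _ _) _.
rewrite -natrM -sum_bcoef natr_sum mulr_suml; apply: ler_sum => i _.
rewrite -mulrA normrM ger0_norm // ler_wpM2l // normrM !normrX.
have e : (N.+1 = i + (N.+1 - i))%N by rewrite subnKC // -ltnS.
rewrite [X in _ <= M ^+ X]e exprD.
by apply: ler_pM; rewrite ?exprn_ge0 //; apply: lerXn2r; rewrite ?nnegrE.
Qed.

(** At 0, where tan vanishes, only the pure power of sec survives in [sectan N]; its coefficient is
    the [N]-th Bernoulli-Euler number. *)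
Definition euler N := bcoef N N.+1.

Lemma sectan0 N : sectan N 0 = (euler N)%:R.
Proof.
rewrite /sectan big_ord_recr /= cos0 invr1 expr1n subnn expr0 !mulr1 tan0.
rewrite big1 ?add0r // => i _; rewrite subSn; last by rewrite -ltnS.
by rewrite exprS mul0r mulr0.
Qed.

Lemma Kfun_sectan (t : R) : Kfun t = sectan 0 t.
Proof.
by rewrite /Kfun /sectan !big_ord_recr big_ord0 /= !expr1 expr0 !mulr1 !mul1r add0r.
Qed.

(* Mean value theorem for the Taylor polynomial of [u 0] based at [s] and
   evaluated at [t], as a function of [s]. *)
Lemma taylor_bound (u : nat -> R -> R) (t B : R) k :
  (forall j (s : R), `|s| <= `|t| -> is_derive s 1 (u j) (u j.+1 s)) ->
  (forall s, `|s| <= `|t| -> `|u k.+1 s| <= B) ->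
  `|u 0%N t - \sum_(j < k.+1) u j 0 / j`!%:R * t ^+ j|
    <= B * `|t| ^+ k.+1 / k`!%:R.
Proof.
move=> du hB.
pose phi (i : nat) (s : R) := \sum_(j < i.+1) u j s / j`!%:R * (t - s) ^+ j.
(* The derivative of the Taylor sum in its base point telescopes to a single term. *)
have dphi i (s : R) : `|s| <= `|t| ->
    is_derive s 1 (phi i) (u i.+1 s / i`!%:R * (t - s) ^+ i).
  move=> hs; elim: i => [|i ih].
    rewrite (_ : phi 0%N = u 0%N).
      by rewrite expr0 mulr1 divr1; exact: du.
    by apply/funext => z; rewrite /phi big_ord1 expr0 mulr1 divr1.
  have dts : is_derive s 1 (fun z => t - z) (- 1).
    have := @is_deriveB _ _ _ (cst t) id s 1 0 1 (is_derive_cst _ _ _) (is_derive_id _ _).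
    by rewrite sub0r.
  have dp := is_derive_exprn i.+1 dts.
  have d1 := @is_deriveM _ _ _ _ _ _ _ _ (du i.+1 s hs) dp.
  have d2 := @is_deriveZ _ _ _ _ (i.+1`!%:R^-1) _ _ _ d1.
  have d3 := @is_deriveD _ _ _ _ _ _ _ _ _ ih d2.
  rewrite (_ : phi i.+1 = phi i + (i.+1`!%:R^-1 \*: (u i.+1 * (fun z => (t - z) ^+ i.+1)))).
    apply: (@is_derive_eq _ _ _ _ _ _ _ _ d3); rewrite /GRing.scale /= factS natrM.
    by field; rewrite nat1r !pnatr_eq0 -lt0n fact_gt0.
  apply/funext => z; rewrite /phi big_ord_recr /= /GRing.scale /=; congr (_ + _).
  rewrite -[RHS]/(i.+1`!%:R^-1 * (u i.+1 z * (t - z) ^+ i.+1)).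
  by rewrite mulrA [_ * u _ _]mulrC.
have phit : phi k t = u 0%N t.
  rewrite /phi big_ord_recl /= subrr expr0 mulr1 divr1 big1 ?addr0 // => i _.
  by rewrite /bump /= exprS mul0r mulr0.
have phi0 : phi k 0 = \sum_(j < k.+1) u j 0 / j`!%:R * t ^+ j.
  by apply: eq_bigr => j _; rewrite subr0.
rewrite -phit -phi0.
have bound c : `|c| <= `|t| -> `|t - c| <= `|t| ->
    `|u k.+1 c / k`!%:R * (t - c) ^+ k * t| <= B * `|t| ^+ k.+1 / k`!%:R.
  move=> hc htc; have f0 : 0 <= k`!%:R^-1 :> R by rewrite invr_ge0.
  rewrite !normrM normrX (ger0_norm f0) exprSr.
  rewrite -!mulrA [leRHS]mulrA [X in _ <= X]mulrC !mulrA.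
  rewrite [X in X <= _](_ : _ = (`|u k.+1 c| * (`|t - c| ^+ k * `|t|)) * k`!%:R^-1); last by ring.
  rewrite [X in _ <= X](_ : _ = (B * (`|t| ^+ k * `|t|)) * k`!%:R^-1); last by ring.
  apply: ler_wpM2r => //; apply: ler_pM; rewrite ?mulr_ge0 ?exprn_ge0 ?normr_ge0 //.
    exact: hB.
  by apply: ler_wpM2r => //; apply: lerXn2r; rewrite ?nnegrE.
have cont (a b : R) : (forall s, a <= s <= b -> `|s| <= `|t|) ->
    {within `[a, b], continuous phi k}.
  move=> h; apply: derivable_within_continuous => s; rewrite in_itv /= => /h hs.
  by have := dphi k s hs.
case: (ltgtP 0 t) => [t0|t0|<-]; last first.
- by rewrite subrr normr0 expr0n /= mulr0 mul0r.
- have [||c] := @MVT R (phi k) (fun s => u k.+1 s / k`!%:R * (t - s) ^+ k) t 0 t0.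
  + move=> s; rewrite in_itv /= => /andP[h1 h2]; apply: dphi.
    by rewrite !ler0_norm; lra.
  + by apply: cont => s /andP[h1 h2]; rewrite !ler0_norm; lra.
  rewrite in_itv /= => /andP[h1 h2] e.
  rewrite distrC e sub0r mulrN normrN; apply: bound.
    by rewrite !ler0_norm; lra.
  by rewrite !ler0_norm; lra.
have [||c] := @MVT R (phi k) (fun s => u k.+1 s / k`!%:R * (t - s) ^+ k) 0 t t0.
- move=> s; rewrite in_itv /= => /andP[h1 h2]; apply: dphi.
  by rewrite !ger0_norm; lra.
- by apply: cont => s /andP[h1 h2]; rewrite !ger0_norm; lra.
rewrite in_itv /= => /andP[h1 h2] ->; rewrite subr0; apply: bound.
  by rewrite !ger0_norm; lra.
by rewrite !ger0_norm; lra.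
Qed.

End SecTan.

(** * Generating functions *)

Section Egf.
Variable R : realType.

(* The convergence in [has_egf] at a given point, for real coefficients. *)
Definition egf_at (u : nat -> R) (t F : R) :=
  pseries (fun n => u n / n`!%:R) t @ \oo --> F.

Lemma egf_at_eq (u v : nat -> R) t F G : u =1 v -> F = G ->
  egf_at u t F -> egf_at v t G.
Proof. by move=> /funext -> ->. Qed.

Lemma egf_atD (u v : nat -> R) t F G : egf_at u t F -> egf_at v t G ->
  egf_at (fun n => u n + v n) t (F + G).
Proof.
move=> hu hv; rewrite /egf_at (_ : pseries _ t = fun k =>
  pseries (fun n => u n / n`!%:R) t k + pseries (fun n => v n / n`!%:R) t k).
  exact: cvgD.
apply/funext => k; rewrite /pseries /series /= -big_split /=.
by apply: eq_bigr => i _; rewrite !mulrDl.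
Qed.

Lemma egf_atZ (u : nat -> R) t F (c : R) : egf_at u t F ->
  egf_at (fun n => c * u n) t (c * F).
Proof.
move=> hu; rewrite /egf_at (_ : pseries _ t = fun k =>
  c * pseries (fun n => u n / n`!%:R) t k).
  by apply: cvgM => //; exact: cvg_cst.
apply/funext => k; rewrite /pseries /series /= mulr_sumr.
by apply: eq_bigr => i _; rewrite !mulrA.
Qed.

(** The operator [t d/dt] multiplies the coefficients by [n], and the shift [v] of [u] has the
    derivative of the series of [u] as its series. *)
Lemma egf_at_mulX (u v : nat -> R) t F : egf_at v t F ->
  (forall n, v n = u n.+1) -> egf_at (fun n => n%:R * u n) t (t * F).
Proof.
move=> hv vu; rewrite /egf_at -cvg_shiftS /=.
rewrite (_ : (fun n => _) = fun k => t * pseries (fun n => v n / n`!%:R) t k).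
  by apply: cvgM => //; exact: cvg_cst.
apply/funext => k; rewrite /pseries /series /= big_nat_recl // !mul0r add0r mulr_sumr.
apply: eq_bigr => i _; rewrite vu factS natrM exprS.
by field; rewrite nat1r !pnatr_eq0 -lt0n fact_gt0.
Qed.

(** The binomial coefficient of [m + N] over [m] is one of the terms of [(1 + 1)^(m + N)]. *)
Lemma fact_addn_le m N : ((m + N)`! <= m`! * N`! * 2 ^ (m + N))%N.
Proof.
rewrite -[(m + N)`!](@bin_fact (m + N) m) ?leq_addr // addKn.
rewrite [leqRHS]mulnC leq_mul2r; apply/orP; right.
rewrite -[2%N]/(1 + 1)%N expnDn.
under eq_bigr do rewrite !exp1n !muln1.
rewrite (bigD1 (inord m)) //= inordK ?leq_addr //.
Qed.

(** Where cos exceeds 1/2, both sec and tan are at most 2 in absolute value, so [sectan_bound]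
    controls all derivatives and the Taylor remainder tends to 0 near 0. *)
Lemma euler_egf m : \forall t \near (0 : R),
  egf_at (fun n => (euler (n + m))%:R) t (sectan m t).
Proof.
have ct : \forall s \near (0 : R), 2^-1 < cos s.
  have : cos s @[s --> (0 : R)] --> (1 : R) by rewrite -(@cos0 R); exact: continuous_cos.
  move=> /cvgrPdist_lt/(_ 2^-1); rewrite invr_gt0 ltr0n => /(_ isT); apply: filterS => s.
  by rewrite ltr_norml => /andP[_]; lra.
have /nbhs_ballP[r /= r0 hr] := ct.
(* The remainder is at most [c0 (8 |t|)^k], with one factor 2 from the bound on sec and tan, one
   from [fact_addn_le] and one from [k + 1 <= 2^k]; the radius 1/16 makes [8 |t|] less than 1. *)
pose rho : R := Num.min r (16^-1).
have rho0 : 0 < rho by rewrite lt_min r0 invr_gt0 ltr0n.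
apply/nbhs_ballP; exists rho => // t0; pose t : R := t0; rewrite -/t /ball /= sub0r normrN lt_min => /andP[tr t16].
have cs s : `|s| <= `|t| -> 2^-1 < cos s.
  by move=> hs; apply: hr; rewrite /ball /= sub0r normrN; apply: le_lt_trans tr.
have secb s : `|s| <= `|t| -> `|(cos s)^-1| <= 2.
  move=> /cs hc; rewrite ger0_norm; last by rewrite invr_ge0; lra.
  by rewrite -[2]invrK lef_pV2 ?posrE; lra.
have tanb s : `|s| <= `|t| -> `|tan s| <= 2.
  move=> hs; have := secb s hs; rewrite /tan normrM => h.
  by apply: le_trans h; rewrite ler_piMl // ler_norml sin_geN1 sin_le1.
have du j (s : R) : `|s| <= `|t| -> is_derive s 1 (sectan (j + m)) (sectan (j.+1 + m) s).
  by move=> hs; apply: derivatives_sectan; rewrite /poscos /=; have := cs s hs; lra.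
pose q : R := 8 * `|t|.
have q0 : 0 <= q by rewrite mulr_ge0.
have q1' : q < 1 by rewrite /q; lra.
have q1 : `|q| < 1 by rewrite ger0_norm.
rewrite /egf_at -cvg_shiftS /=; apply/cvgrPdist_le => e e0.
pose c0 : R := 2 * m`!%:R * 4 ^+ m.
have c0_ge0 : 0 <= c0 by rewrite !mulr_ge0 // exprn_ge0.
have : (fun k => c0 * q ^+ k) @ \oo --> c0 * 0.
  by apply: cvgM; [exact: cvg_cst|exact: cvg_expr].
rewrite mulr0 => /cvgrPdist_le/(_ e e0); apply: filterS => k.
rewrite sub0r normrN ger0_norm; last by rewrite mulr_ge0 // exprn_ge0 // mulr_ge0.
apply: le_trans.
have -> : pseries (fun n => (euler (n + m))%:R / n`!%:R) t k.+1
    = \sum_(j < k.+1) sectan (j + m) (0 : R) / j`!%:R * t ^+ j.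
  rewrite /pseries /series /= big_mkord; apply: eq_bigr => j _.
  by rewrite sectan0.
have := @taylor_bound R (fun j => sectan (j + m)) t
  (2 * (k.+1 + m)`!%:R * 2 ^+ (k.+1 + m).+1) k du.
rewrite add0n => /(_ _)/le_trans; apply.
  move=> s hs; apply: sectan_bound; first by lra.
    exact: secb.
  exact: tanb.
have fk0 : 0 < k`!%:R :> R by rewrite ltr0n fact_gt0.
rewrite ler_pdivrMr //.
have h1 : (k.+1 + m)`!%:R <= m`!%:R * k.+1`!%:R * 2 ^+ (m + k.+1) :> R.
  by rewrite -natrX -!natrM ler_nat addnC; exact: fact_addn_le.
have h2 : k.+1%:R <= 2 ^+ k :> R by rewrite -natrX ler_nat ltn_expl.
have tk0 : 0 <= `|t| ^+ k.+1 by rewrite exprn_ge0.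
apply: (@le_trans _ _ (2 * (m`!%:R * k.+1`!%:R * 2 ^+ (m + k.+1)) * 2 ^+ (k.+1 + m).+1 * `|t| ^+ k.+1)).
  apply: ler_wpM2r => //; apply: ler_wpM2r; first by rewrite exprn_ge0.
  by rewrite ler_pM2l.
rewrite factS natrM.
have -> : 2 * (m`!%:R * (k.+1%:R * k`!%:R) * 2 ^+ (m + k.+1)) * 2 ^+ (k.+1 + m).+1 * `|t| ^+ k.+1
   = c0 * k`!%:R * ((k.+1%:R * 2) * (4 * `|t|) ^+ k.+1) :> R.
  have e4 : (4 : R) = 2 * 2 by rewrite -natrM.
  by rewrite /c0 e4 !exprMn !exprS !exprD !exprS; ring.
rewrite [leRHS]mulrAC; apply: ler_wpM2l; first by rewrite mulr_ge0.
apply: (@le_trans _ _ (q ^+ k.+1)); last first.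
  by rewrite exprSr ler_piMr ?exprn_ge0 // /q; lra.
have -> : q ^+ k.+1 = (2 ^+ k * 2) * (4 * `|t|) ^+ k.+1.
  by rewrite -exprSr -exprMn mulrA -natrM.
by rewrite !ler_wpM2r // exprn_ge0 // mulr_ge0.
Qed.

End Egf.

(** * Reduction of the counts to Bernoulli-Euler numbers *)

Section Counting.
Variable R : realType.


Lemma components0 l : (1 < l)%N -> components (@very_nice R 0 l) = set0.
Proof.
move=> l1; rewrite /components (_ : @very_nice R 0 l = set0) ?image_set0 //.
apply/seteqP; split => // p [c [_]].
rewrite cat_uniq => /and3P[_ _ /injectiveP].
case: l l1 p => [|[|l]] // _ p /(_ ord0 (lift ord0 ord0)).
by rewrite /Ppoly /= !horner0 => /(_ erefl)/(congr1 val).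
Qed.

Lemma finite_components_very_nice n l : (1 < l)%N ->
  finite_set (components (@very_nice R n l)).
Proof.
case: n => [|m] l1; last exact: finite_components.
by rewrite components0.
Qed.

(** For [n = m + 1] there are [m + l + 2 = n + l + 1] slots. For [n = 0] both sides are 0, the zero
    polynomial having equal boundary values. *)
Lemma KnlE n l : Knl R n l.+2 = (l.+2`! * bcoef (n + l.+1) n)%N.
Proof.
case: n => [|m]; last by rewrite Knl_types card_types addnS // addSnnS.
by rewrite /Knl components0 // fset_set0 cardfs0 bcoef0 // muln0.
Qed.

Lemma eulerS n : euler n.+1 = bcoef n n.
Proof. by rewrite /euler bcoefS bcoef_gt // muln0 subSnn mul1n. Qed.

(** The count is [2 b(n+1, n)], which is what the recurrence for [E_(n+3) = b(n+2, n+2)] leaves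
    besides the multiple of [b(n+1, n+2) = E_(n+1)]. *)
Lemma Knl2_euler n : (Knl R n 2 + (n + 2) * euler (n + 1) = euler (n + 3))%N.
Proof.
rewrite KnlE !addnS !addn0 !eulerS [in RHS]bcoefS -eulerS /euler.
rewrite (_ : (n.+2 - n = 2)%N); first by rewrite /factorial /=; lia.
lia.
Qed.

Lemma bcoef_euler n : (euler (n + 5) = (n + 4) * euler (n + 3) + 2 * bcoef n.+3 n.+2)%N.
Proof.
rewrite !addnS !addn0 eulerS bcoefS -[euler n.+3]/(bcoef n.+3 n.+4).
by rewrite (_ : (n.+4 - n.+2 = 2)%N) //; lia.
Qed.

Lemma bcoef_euler' n :
  (bcoef n.+3 n.+2 = (n + 2) * euler (n + 3) + 3 * bcoef n.+2 n)%N.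
Proof.
rewrite !addnS !addn0 eulerS bcoefS.
by rewrite (_ : (n.+3 - n = 3)%N) //; lia.
Qed.

Lemma Knl3_euler n : (Knl R n 3 + (3 * n + 8) * euler (n + 3) = euler (n + 5))%N.
Proof.
have := bcoef_euler n; rewrite bcoef_euler' => ->.
by rewrite KnlE !addnS addn0 /factorial /=; nia.
Qed.

(** The count is [24 b(n+3, n)]: the recurrence is unfolded from [E_(n+7)] until this coefficient
    appears, and [b(n+3, n+2)] is eliminated by means of [E_(n+5)]. *)
Lemma Knl4_euler n :
  (Knl R n 4 + (6 * n + 20) * euler (n + 5)
   = euler (n + 7) + 3 * (n + 2) * (n + 4) * euler (n + 3))%N.
Proof.
have := bcoef_euler n.+2; rewrite bcoef_euler'.
have -> : bcoef n.+4 n.+2 = ((n + 2) * bcoef n.+3 n.+2 + 4 * bcoef n.+3 n)%N.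
  by rewrite bcoefS (_ : (n.+4 - n = 4)%N) //; lia.
have := bcoef_euler n.
rewrite KnlE !addnS !addn0 /factorial /=; nia.
Qed.

End Counting.

(** * Generating functions and their closed forms *)

Section Values.
Variable R : realType.
Local Notation W := (@sectan R).
Local Notation E := euler.

Lemma egf_near (u : nat -> nat) (F : R -> R) :
  (\forall t \near (0 : R), egf_at (fun n => (u n)%:R) t (F t)) -> has_egf u F.
Proof. by []. Qed.

Lemma egf_shifted_euler m : \forall t \near (0 : R),
  egf_at (fun n => (E (n + m))%:R) t (W m t)
  /\ egf_at (fun n => n%:R * (E (n + m))%:R) t (t * W m.+1 t).
Proof.
apply: filterS2 (euler_egf R m) (euler_egf R m.+1) => t h1 h2; split=> //.
by apply: egf_at_mulX h2 _ => n; rewrite addnS.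
Qed.

Lemma egf_Knl2 : has_egf (fun n => Knl R n 2)
  (fun t => W 3 t - 2 * W 1 t - t * W 2 t).
Proof.
apply: egf_near; apply: filterS2 (euler_egf R 3) (egf_shifted_euler 1) => t h3 [h1 h1'].
apply: egf_at_eq (egf_atD h3 (egf_atD (egf_atZ (c := (- 2)) h1) (egf_atZ (c := (- 1)) h1'))).
  by move=> n; rewrite -(Knl2_euler R) !natrD natrM natrD; ring.
by ring.
Qed.

Lemma egf_Knl3 : has_egf (fun n => Knl R n 3)
  (fun t => W 5 t - 8 * W 3 t - 3 * t * W 4 t).
Proof.
apply: egf_near; apply: filterS2 (euler_egf R 5) (egf_shifted_euler 3) => t h5 [h3 h3'].
apply: egf_at_eq (egf_atD h5 (egf_atD (egf_atZ (c := (- 8)) h3) (egf_atZ (c := (- 3)) h3'))).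
  by move=> n; rewrite -(Knl3_euler R) natrD natrM natrD natrM; ring.
by ring.
Qed.

(** In falling factorials [3 (n+2) (n+4) = 3 n (n-1) + 21 n + 24], whence the coefficients of
    [t^2 W 5], [t W 4] and [W 3]. *)
Lemma egf_Knl4 : has_egf (fun n => Knl R n 4)
  (fun t => W 7 t - 6 * t * W 6 t - 20 * W 5 t + 3 * t ^+ 2 * W 5 t
            + 21 * t * W 4 t + 24 * W 3 t).
Proof.
apply: egf_near; apply: filterS3 (euler_egf R 7) (egf_shifted_euler 5) (filterI (egf_shifted_euler 3) (egf_shifted_euler 4)) => t h7 [h5 h5'] [[h3 h3'] [_ h4']].
have h3'' : egf_at (fun n => n%:R * (n.-1%:R * (E (n + 3))%:R)) t (t * (t * W 5 t)).
  by apply: egf_at_mulX h4' _ => n; rewrite addnS.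
apply: egf_at_eq (egf_atD h7 (egf_atD (egf_atZ (c := (- 20)) h5) (egf_atD (egf_atZ (c := (- 6)) h5')
  (egf_atD (egf_atZ (c := 24) h3) (egf_atD (egf_atZ (c := 21) h3') (egf_atZ (c := 3) h3'')))))).
  move=> n; have := Knl4_euler R n => /(congr1 (fun k => k%:R : R)).
  rewrite !natrD !natrM !natrD => e.
  have -> : (Knl R n 4)%:R = (E (n + 7))%:R + 3 * (n%:R + 2) * (n%:R + 4) * (E (n + 3))%:R - (6 * n%:R + 20) * (E (n + 5))%:R :> R.
    by lra.
  by case: n {e} => [|n]; rewrite -?natr1 /=; ring.
by ring.
Qed.


Lemma sectan_sin k (t : R) :
  W k t = (cos t)^-1 ^+ k.+1 * \sum_(n < k.+2) (bcoef k n)%:R * sin t ^+ (k.+1 - n).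
Proof.
rewrite /sectan mulr_sumr; apply: eq_bigr => n _.
rewrite /tan exprMn -!mulrA [RHS]mulrCA; congr (_ * _).
by rewrite mulrCA mulrC -exprD subnKC // -ltnS.
Qed.

Lemma sin_lt1 (t : R) : poscos t -> -1 < sin t < 1.
Proof.
move=> ct; have := cos2Dsin2 t.
have h : 0 < cos t ^+ 2 by rewrite exprn_gt0.
by move=> e; apply/andP; split; nra.
Qed.

Lemma inv_cos_sqr (t : R) : poscos t -> (cos t)^-1 ^+ 2 = ((1 - sin t) * (1 + sin t))^-1.
Proof.
move=> ct; rewrite exprVn; congr (_^-1); have := cos2Dsin2 t; lra.
Qed.

Lemma inv_cos (t : R) : poscos t -> (cos t)^-1 = cos t / ((1 - sin t) * (1 + sin t)).
Proof.
move=> ct; rewrite -inv_cos_sqr // exprVn expr2 invfM mulrA mulfV ?mul1r //.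
by rewrite gt_eqF.
Qed.

Ltac eval_bcoef := repeat match goal with
  |- context [bcoef ?N ?n] => let v := eval vm_compute in (bcoef N n) in change (bcoef N n) with v
  end.

(** By [sectan_sin] the derivative is a power of sec times a polynomial in sin. Even powers of sec
    are rational in sin, odd ones leave one factor cos, and the powers of [1 + s] cancel. *)
Lemma sectan_closed (t : R) : poscos t -> let s := sin t in let c := cos t in
  [/\ W 0 t = c / (1 - s), W 1 t = (1 - s)^-1, W 2 t = c / (1 - s) ^+ 2 &
   [/\ W 3 t = (2 + s) / (1 - s) ^+ 2, W 4 t = c * (5 + s) / (1 - s) ^+ 3 &
    W 5 t = (16 + 13 * s + s ^+ 2) / (1 - s) ^+ 3]].
Proof.
move=> ct s c; have /andP[s1 s2] := sin_lt1 ct.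
have x2 := inv_cos_sqr ct; have x1 := inv_cos ct; rewrite -/s -/c in s1 s2 x1 x2.
have x3 : c^-1 ^+ 3 = c / ((1 - s) * (1 + s)) ^+ 2.
  by rewrite exprS x2 x1 -mulrA -expr2 exprVn.
have x4 : c^-1 ^+ 4 = ((1 - s) * (1 + s))^-1 ^+ 2 by rewrite (exprM _ 2 2) x2.
have x5 : c^-1 ^+ 5 = c / ((1 - s) * (1 + s)) ^+ 3.
  by rewrite exprS x4 x1 -mulrA -exprS exprVn.
have x6 : c^-1 ^+ 6 = ((1 - s) * (1 + s))^-1 ^+ 3 by rewrite (exprM _ 2 3) x2.
have d1 : 1 - s != 0 by rewrite gt_eqF //; lra.
have d2 : 1 + s != 0 by rewrite gt_eqF //; lra.
have subst k v w : c^-1 ^+ k.+1 = v ->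
    v * \sum_(n < k.+2) (bcoef k n)%:R * s ^+ (k.+1 - n) = w -> W k t = w.
  by move=> <- <-; exact: sectan_sin.
split; [apply: (subst 0%N _ _ x1)|apply: (subst 1%N _ _ x2)|apply: (subst 2%N _ _ x3)|split;
  [apply: (subst 3%N _ _ x4)|apply: (subst 4%N _ _ x5)|apply: (subst 5%N _ _ x6)]];
  rewrite !big_ord_recr big_ord0;
  rewrite [bcoef]lock /= -lock; eval_bcoef; field; rewrite ?d1 ?d2 //.
Qed.


Lemma nbhs_poscos : nbhs (0 : R) (@poscos R).
Proof. by apply: open_nbhs_nbhs; split; [exact: open_poscos|rewrite /poscos /= cos0]. Qed.

Lemma near_poscos (P : R -> Prop) : (forall t, poscos t -> P t) -> \forall t \near (0 : R), P t.
Proof. by move=> h; apply: filterS nbhs_poscos. Qed.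

Local Notation shift m := (fun k => W (k + m)).

Lemma derivatives_shifted m : derivatives (@poscos R) (shift m).
Proof. exact/derivatives_shift/derivatives_sectan. Qed.

Lemma derive1n_Kfun k t : poscos t -> derive1n k (@Kfun R) t = W k t.
Proof.
rewrite (_ : @Kfun R = W 0); last by apply/funext => s; rewrite Kfun_sectan.
exact: (derive1n_derivatives _ (@open_poscos R) (@derivatives_sectan R)).
Qed.

Lemma A2_sectan t : poscos t ->
  derive1n 3 (@Kfun R) t - derive1n 2 (fun s => s * Kfun s) t
  = W 3 t - 2 * W 1 t - t * W 2 t.
Proof.
move=> ct; rewrite derive1n_Kfun // (_ : (fun s => _) = mulX W 0); last first.
  by apply/funext => s; rewrite /mulX Kfun_sectan mul0r addr0.
rewrite (derive1n_derivatives _ (@open_poscos R) (derivatives_mulX (@derivatives_sectan R))) //.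
by rewrite /mulX /=; ring.
Qed.

Lemma A3_sectan t : poscos t ->
  derive1n 3 (fun t => derive1n 2 (@Kfun R) t - 3 * t * derive1n 1 (@Kfun R) t + Kfun t) t
  = W 5 t - 8 * W 3 t - 3 * t * W 4 t.
Proof.
(* [h k] is the [k]-th derivative of the bracket, the Leibniz rule being contained in [mulX]. *)
move=> ct; pose h k (t : R) := W (k + 2) t + (- 3 * mulX (shift 1) k t + W k t).
have dh : derivatives (@poscos R) h.
  apply: derivativesD; first exact: derivatives_shifted.
  apply: derivativesD; last exact: derivatives_sectan.
  exact/derivativesZ/derivatives_mulX/derivatives_shifted.
rewrite (derive1n_congr (g := h 0%N) _ (@open_poscos R) _ ct).
  by rewrite (derive1n_derivatives _ (@open_poscos R) dh) // /h /mulX /=; ring.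
move=> s cs; rewrite !derive1n_Kfun // Kfun_sectan /h /mulX /=; ring.
Qed.

Lemma A4_inner t : poscos t ->
  derive1n 3 (@Kfun R) t - 6 * t * derive1n 2 (@Kfun R) t
    + (3 * t ^+ 2 + 4) * derive1n 1 (@Kfun R) t - 3 * t * Kfun t
  = W 3 t - 6 * t * W 2 t + (3 * t ^+ 2 + 4) * W 1 t - 3 * t * W 0 t.
Proof. by move=> ct; rewrite !derive1n_Kfun // Kfun_sectan. Qed.

Lemma A4_sectan t : poscos t ->
  derive1n 4 (fun t => derive1n 3 (@Kfun R) t - 6 * t * derive1n 2 (@Kfun R) t
    + (3 * t ^+ 2 + 4) * derive1n 1 (@Kfun R) t - 3 * t * Kfun t) t
  = W 7 t - 6 * t * W 6 t - 20 * W 5 t + 3 * t ^+ 2 * W 5 t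
    + 21 * t * W 4 t + 24 * W 3 t.
Proof.
(* As before, [h k] is the [k]-th derivative of the bracket; the double [mulX] accounts for the term
   with [t^2]. *)
move=> ct; pose h k (t : R) := W (k + 3) t + (- 6 * mulX (shift 2) k t +
  (3 * mulX (mulX (shift 1)) k t + (4 * W (k + 1) t + - 3 * mulX W k t))).
have dh : derivatives (@poscos R) h.
  have dW := @derivatives_shifted.
  apply: derivativesD; first exact: dW.
  apply: derivativesD; first exact/derivativesZ/derivatives_mulX/dW.
  apply: derivativesD; first exact/derivativesZ/derivatives_mulX/derivatives_mulX/dW.
  apply: derivativesD; first exact/derivativesZ/dW.
  exact/derivativesZ/derivatives_mulX/derivatives_sectan.
rewrite (derive1n_congr (g := h 0%N) _ (@open_poscos R) _ ct).
  by rewrite (derive1n_derivatives _ (@open_poscos R) dh) // /h /mulX /=; ring.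
by move=> s cs; rewrite A4_inner // /h /mulX /=; ring.
Qed.

End Values.

Lemma has_egf_near (R : realType) (u : nat -> nat) (F G : R -> R) :
  (\forall t \near (0 : R), G t = F t) -> has_egf u F -> has_egf u G.
Proof. by move=> e; apply: filterS2 e => t ->. Qed.

Theorem corollary4p2 (R : realType) :
  let K : R -> R := @Kfun R in
  let A2 : R -> R := fun t => derive1n 3 K t - derive1n 2 (fun s => s * K s) t in
  let A3 : R -> R := derive1n 3 (fun t => derive1n 2 K t - 3 * t * derive1n 1 K t + K t) in
  let A4 : R -> R :=
    derive1n 4 (fun t => derive1n 3 K t - 6 * t * derive1n 2 K t
                  + (3 * t ^+ 2 + 4) * derive1n 1 K t - 3 * t * K t) in
  [/\ forall n l : nat, (2 <= l <= 4)%N ->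
        finite_set (components (@very_nice R n l)),
      has_egf (fun n => Knl R n 2) A2 /\
      (\forall t \near (0 : R),
         A2 t = (3 * sin t - t * cos t) / (1 - sin t) ^+ 2),
      has_egf (fun n => Knl R n 3) A3 /\
      (\forall t \near (0 : R),
         A3 t = 3 / (1 - sin t) ^+ 3
                * (sin t * (3 * sin t + 7) - t * cos t * (5 + sin t)))
    & has_egf (fun n => Knl R n 4) A4 /\
      (\forall t \near (0 : R),
         A4 t = derive1n 4 (fun s => 3 * s ^+ 2 / (1 - sin s)
                  - 3 * s * cos s / (1 - sin s) ^+ 2 * (3 - sin s)
                  + 3 * (2 - sin s) / (1 - sin s) ^+ 2) t)].
Proof.
move=> K A2 A3 A4.
have d1 (t : R) : poscos t -> 1 - sin t != 0.
  by move=> /sin_lt1/andP[_ h]; rewrite gt_eqF // subr_gt0.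
split.
- by move=> n l /andP[l2 _]; exact: finite_components_very_nice.
- split; first exact: has_egf_near (near_poscos (@A2_sectan R)) (egf_Knl2 R).
  apply: near_poscos => t ct; rewrite /A2 /K A2_sectan //.
  have [_ -> -> [-> _ _]] := sectan_closed ct; field; exact: d1.
- split; first exact: has_egf_near (near_poscos (@A3_sectan R)) (egf_Knl3 R).
  apply: near_poscos => t ct; rewrite /A3 /K A3_sectan //.
  have [_ _ _ [-> -> ->]] := sectan_closed ct; field; exact: d1.
- split; first exact: has_egf_near (near_poscos (@A4_sectan R)) (egf_Knl4 R).
  apply: near_poscos => t ct; rewrite /A4 /K.
  (* Both sides are fourth derivatives, so it suffices to compare the functions themselves on the
     open set where cos is positive. *)
  apply: (derive1n_congr _ (@open_poscos R) _ ct) => s cs.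
  rewrite A4_inner //.
  have [-> -> -> [-> _ _]] := sectan_closed cs; field; exact: d1.
Qed.
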